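(* Let $\Omega\subseteq\mathbb{R}^2$ be a smooth bounded and simply connected domain, and let $v\in C^2(\overline\Omega;\mathbb{R}^3)$ be a solution of $$\begin{cases}\Delta v=H(\xi,v,\nabla v)\,v_x\wedge v_y & \text{in }\Omega,\\ v=0&\text{on }\partial\Omega,\end{cases}$$ for some continuous scalar function $H(\xi,v,\nabla v)$. Then $v\equiv0$ in $\Omega$.
   Context: Here $\xi=(x,y)$ denotes the point of $\Omega$, subscripts $x,y$ denote partial derivatives, $\wedge$ is the cross product in $\mathbb{R}^3$, and $\Delta$ acts componentwise. $H$ is a real-valued continuous function of $(\xi,v,\nabla v)\in\overline\Omega\times\mathbb{R}^3\times\mathbb{R}^{3\times2}$. *)

(* Defs.v *)
From HB Require Import structures.
From mathcomp Require Import all_boot all_order all_algebra.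
From mathcomp Require Import all_classical all_reals all_analysis.
Import Order.TTheory GRing.Theory Num.Theory.
Import numFieldNormedType.Exports.

Set Implicit Arguments.
Unset Strict Implicit.
Unset Printing Implicit Defensive.

Local Open Scope classical_set_scope.
Local Open Scope ring_scope.

Section Topology.
Context {R : realType} {T : topologicalType}.

Definition boundary (A : set T) : set T := closure A `\` interior A.

Definition path_in (A : set T) (c : R -> T) : Prop :=
  {within `[0, 1], continuous c} /\ (forall t, t \in `[0, 1] -> A (c t)).

Definition path_connected (A : set T) : Prop :=
  forall a b, A a -> A b -> exists c, [/\ path_in A c, c 0 = a & c 1 = b].

(* [h] contracts the loop [c] to its base point, inside [A] and with the base
   point fixed; the first variable is the homotopy parameter. *)
Definition null_homotopic_in (A : set T) (c : R -> T) : Prop :=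
  exists h : R * R -> T,
  [/\ {within `[0, 1] `*` `[0, 1], continuous h},
      forall s t, s \in `[0, 1] -> t \in `[0, 1] -> A (h (s, t)),
      forall t, t \in `[0, 1] -> h (0, t) = c t,
      forall t, t \in `[0, 1] -> h (1, t) = c 0 &
      forall s, s \in `[0, 1] -> h (s, 0) = c 0 /\ h (s, 1) = c 0].

Definition simply_connected (A : set T) : Prop :=
  path_connected A /\
  forall c, path_in A c -> c 0 = c 1 -> null_homotopic_in A c.

Definition domain (A : set T) : Prop := [/\ A !=set0, open A & connected A].

End Topology.
Arguments simply_connected R {T} A.

Section Calculus.
Context {R : realType}.

Definition partial {n : nat} {W : normedModType R} (j : 'I_n)
  (f : 'rV[R]_n -> W) : 'rV[R]_n -> W := 'D_(delta_mx 0 j) f.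

Definition laplacian {n : nat} {W : normedModType R} (f : 'rV[R]_n -> W)
  (p : 'rV[R]_n) : W := \sum_(j < n) partial j (partial j f) p.

Definition gradient {n m : nat} (f : 'rV[R]_n -> 'rV[R]_m) (p : 'rV[R]_n) :
  'M[R]_(m, n) := \matrix_(i < m, j < n) partial j f p 0 i.

(* Indices are taken modulo 3. *)
Definition cross (u w : 'rV[R]_3) : 'rV[R]_3 :=
  \row_k (u 0 (k + 1) * w 0 (k + 2) - u 0 (k + 2) * w 0 (k + 1)).

Definition extends_continuously {T W : topologicalType} (A : set T)
    (f : T -> W) : Prop :=
  exists g : T -> W,
    {within closure A, continuous g} /\ (forall p, A p -> f p = g p).

(* All partial derivatives of order at most [k] exist in the open set [A] and
   extend continuously to its closure. *)
Fixpoint derivatives_extend {n : nat} {W : normedModType R} (k : nat)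
    (A : set 'rV[R]_n) (f : 'rV[R]_n -> W) : Prop :=
  extends_continuously A f /\
  if k is k'.+1 then
    forall j : 'I_n, (forall p, A p -> derivable f p (delta_mx 0 j)) /\
                     derivatives_extend k' A (partial j f)
  else True.

(* $C^k(\overline A)$. A function is total here, but only its values on
   [closure A] matter; its derivatives are only evaluated in [A]. *)
Definition Ck_closure {n : nat} {W : normedModType R} (k : nat)
    (A : set 'rV[R]_n) (f : 'rV[R]_n -> W) : Prop :=
  {within closure A, continuous f} /\ derivatives_extend k A f.

Definition smooth (g : R -> R) : Prop := forall k x, derivable (derive1n k g) x 1.

(* In suitable orthonormal coordinates centred at any boundary point, [A] is
   locally the set of points strictly above the graph of a smooth function. *)
Definition smooth_boundary (A : set 'rV[R]_2) : Prop :=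
  forall p, boundary A p ->
  exists (Q : 'M[R]_2) (g : R -> R),
    [/\ Q *m Q^T = 1%:M, smooth g &
        \forall q \near p,
          A q <-> g (((q - p) *m Q) 0 0) < ((q - p) *m Q) 0 1].

End Calculus.

(* Main.v *)
(* The Laplacian of v is orthogonal to v_x and v_y, so the Hopf differential
   phi = |v_x|^2 - |v_y|^2 - 2 i v_x.v_y is holomorphic.

   phi vanishes.  If phi(p) <> 0, pull v back to the unit disc by a Riemann map f with
   f(0) = p; this needs no boundary regularity, since u = v o f tends to 0 at the
   circle by compactness alone.  In the coordinate e^(t+is), let M and A be the means
   over s of |u|^2 and |u_t|^2.  Holomorphy of phi gives that |u_s|^2 also has mean A
   and that A is bounded below; the equation gives M'' >= (7/2) A near t = 0, where u
   is small, and Cauchy-Schwarz gives M'^2 <= 4 M A.  No such M tends to 0 at t = 0.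

   When phi = 0, v is conformal, |Lap v| <= C |v_x| and |v_x| = |v_y|, and then
   |v|^2 exp(2 psi(x)), for a suitable convex psi, has no positive interior maximum.

   The Riemann map is obtained from the mean value property on circles, square roots
   of zero-free holomorphic functions being constructed by lifting along paths. *)
Require Import Defs.
From mathcomp Require Import all_boot all_order all_algebra.
From mathcomp Require Import all_classical all_reals all_analysis.
From mathcomp Require Import ring lra.
Import Order.TTheory GRing.Theory Num.Theory.
Import numFieldNormedType.Exports.
From mathcomp Require Import complex.
Import ComplexField.Normc.

Set Implicit Arguments.
Unset Strict Implicit.
Unset Printing Implicit Defensive.

Local Open Scope classical_set_scope.
Local Open Scope ring_scope.

(** * The complex plane with the real-valued modulus *)

(** Two obstacles shape the proof. The first: at a positive maximum of |v|^2 exp(2 psi(x)) one only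
    learns v . v_x = - psi' |v|^2, hence |v_x| >= psi' |v|, while the second-order test needs
    |v_x|^2 + |v_y|^2 to dominate 2 psi'^2 |v|^2. Conformality supplies the missing |v_y| = |v_x|,
    so the Hopf differential has to be treated before. The second: nothing is known about u_t at the
    circle, so no boundary integral can be taken there. It is replaced by a differential inequality
    for t < 0: M'' >= (7/2) A and M'^2 <= 4 M A give M M'' >= (7/8) M'^2, which says that M^(1/8) is
    convex. As M tends to 0, M is O(|t|^8), whereas A >= c > 0 forces M >= (7 c / 4) t^2. For
    harmonic u the constant 7/2 would be 4; any constant above 2 still excludes the order t^2.
    Simple connectedness pays off at the centre of the disc: there the pulled-back Hopf differential
    times z^2 vanishes, so its circle means are 0, and this is the equality of the means of |u_t|^2
    and |u_s|^2. *)

Section ComplexNorm.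
Context {R : realType}.
Implicit Types z w : R[i].

Lemma normc_ge0 z : 0 <= normc z.
Proof. by case: z => a b; rewrite sqrtr_ge0. Qed.

Lemma normc_sqr z : normc z ^+ 2 = Re z ^+ 2 + Im z ^+ 2.
Proof. by case: z => a b; rewrite sqr_sqrtr// addr_ge0// sqr_ge0. Qed.

Lemma normc_eq0 z : (normc z == 0) = (z == 0).
Proof.
by apply/eqP/eqP => [/eq0_normc//|->]; rewrite normc0.
Qed.

Lemma normc_gt0 z : (0 < normc z) = (z != 0).
Proof. by rewrite lt_def normc_ge0 andbT normc_eq0. Qed.

Lemma normc_le0 z : (normc z <= 0) = (z == 0).
Proof. by rewrite le_eqVlt ltNge normc_ge0 orbF normc_eq0. Qed.

Lemma normcD z w : normc (z + w) <= normc z + normc w.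
Proof. exact: le_normcD. Qed.

Lemma normc_N z : normc (- z) = normc z.
Proof. exact: normcN. Qed.

Lemma normc_distC z w : normc (z - w) = normc (w - z).
Proof. by rewrite -normc_N opprB. Qed.

Lemma normcB z w : normc (z - w) <= normc z + normc w.
Proof. by rewrite -(normc_N w) normcD. Qed.

Lemma normc_triangle x z w : normc (z - w) <= normc (z - x) + normc (x - w).
Proof. by rewrite (le_trans _ (normcD _ _))// subrKA. Qed.

Lemma lerB_normc z w : normc z - normc w <= normc (z - w).
Proof. by rewrite lerBlDr -{1}(subrK w z) normcD. Qed.

Lemma normc_real (x : R) : normc x%:C%C = `|x|.
Proof. by rewrite /= expr0n addr0 sqrtr_sqr. Qed.

Lemma normcX z n : normc (z ^+ n) = normc z ^+ n.
Proof.
elim: n => [|n IH]; first by rewrite !expr0 normc1.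
by rewrite !exprS normcM IH.
Qed.

Lemma normr_Re_le z : `|Re z| <= normc z.
Proof.
rewrite -(@ler_pXn2r _ 2) ?nnegrE ?normc_ge0// normc_sqr real_normK ?num_real//.
by rewrite lerDl sqr_ge0.
Qed.

Lemma normr_Im_le z : `|Im z| <= normc z.
Proof.
rewrite -(@ler_pXn2r _ 2) ?nnegrE ?normc_ge0// normc_sqr real_normK ?num_real//.
by rewrite lerDr sqr_ge0.
Qed.

Lemma Re_le_normc z : Re z <= normc z.
Proof. exact: le_trans (ler_norm _) (normr_Re_le _). Qed.

Lemma normc_le_ReIm z : normc z <= `|Re z| + `|Im z|.
Proof.
rewrite -(@ler_pXn2r _ 2) ?nnegrE ?normc_ge0 ?addr_ge0// normc_sqr.
rewrite sqrrD !real_normK ?num_real// addrAC lerDl mulrn_wge0//.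
Qed.

Lemma ReD z w : Re (z + w) = Re z + Re w. Proof. by case: z; case: w. Qed.
Lemma ImD z w : Im (z + w) = Im z + Im w. Proof. by case: z; case: w. Qed.
Lemma ReN z : Re (- z) = - Re z. Proof. by case: z. Qed.
Lemma ImN z : Im (- z) = - Im z. Proof. by case: z. Qed.
Lemma ReB z w : Re (z - w) = Re z - Re w. Proof. by rewrite ReD ReN. Qed.
Lemma ImB z w : Im (z - w) = Im z - Im w. Proof. by rewrite ImD ImN. Qed.
Lemma ReM z w : Re (z * w) = Re z * Re w - Im z * Im w.
Proof. by case: z; case: w. Qed.
Lemma ImM z w : Im (z * w) = Re z * Im w + Im z * Re w.
Proof. by case: z; case: w. Qed.
Lemma eqcP z w : Re z = Re w -> Im z = Im w -> z = w.
Proof. by case: z => a b; case: w => c d /= -> ->. Qed.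

Lemma normc_conj z : normc (conjc z) = normc z.
Proof. by case: z => a b /=; rewrite sqrrN. Qed.

Lemma mulc_conj z : z * conjc z = ((normc z) ^+ 2)%:C%C.
Proof.
rewrite normc_sqr; apply: eqcP; rewrite ?ReM ?ImM; case: z => a b /=; ring.
Qed.

(** The value 1 at 0 keeps the modulus equal to 1 everywhere. Multiplying by the conjugate rotates
    [z] onto the positive axis, which reduces complex estimates to real parts. *)
Definition dirc z : R[i] := if z == 0 then 1 else z / (normc z)%:C%C.

Lemma normc_dir z : normc (dirc z) = 1.
Proof.
rewrite /dirc; case: eqP => [_|/eqP z0]; first exact: normc1.
rewrite normcM normcV normc_real ger0_norm ?normc_ge0// divff//.
by rewrite normc_eq0.
Qed.

Lemma conj_dirM z : conjc (dirc z) * z = (normc z)%:C%C.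
Proof.
rewrite /dirc; case: eqP => [->|/eqP z0]; first by rewrite normc0 mulr0.
have nz : ((normc z)%:C)%C != 0 by rewrite (inj_eq (@complexI R)) normc_eq0.
have -> : conjc (z / (normc z)%:C%C) = conjc z / (normc z)%:C%C.
  rewrite -!fmorphV; move: (normc z)^-1 => y.
  by apply: eqcP; case: (z) => a b /=; ring.
rewrite mulrAC [conjc z * z]mulrC mulc_conj.
by rewrite rmorphXn expr2 mulfK.
Qed.

End ComplexNorm.

(** * Limits for the real modulus *)

Section Filters.
Context {R : realType}.

Definition cnbhs (z : R[i]) : set_system R[i] :=
  [set P | exists2 d : R, 0 < d & forall w, normc (w - z) < d -> P w].

Global Instance cnbhs_filter z : ProperFilter (cnbhs z).
Proof.
apply: Build_ProperFilter.
  by move=> [d d0 dP]; apply: (dP z); rewrite subrr normc0.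
split.
- by exists 1.
- move=> P Q [d d0 dP] [e e0 eQ]; exists (Num.min d e); first by rewrite lt_min d0.
  by move=> w; rewrite lt_min => /andP[/dP ? /eQ].
- by move=> P Q PQ [d d0 dP]; exists d => // w /dP /PQ.
Qed.

Lemma cnbhs_ball (z : R[i]) d : 0 < d -> \forall w \near cnbhs z, normc (w - z) < d.
Proof. by move=> d0; exists d. Qed.

Definition copen (U : set R[i]) := forall z, U z -> cnbhs z U.

(* The norm of [R[i]] in MathComp is complex-valued, hence these filters and
   limits defined from the real modulus [normc]. *)
Definition cto {T : Type} (F : set_system T) (g : T -> R[i]) (l : R[i]) :=
  forall e : R, 0 < e -> \forall x \near F, normc (g x - l) < e.

Context {T : Type} {F : set_system T} {FF : Filter F}.
Implicit Types g h : T -> R[i].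

Lemma cto_cst l : cto F (fun=> l) l.
Proof. by move=> e e0; apply: nearW => x; rewrite subrr normc0. Qed.

Lemma ctoD g h l m : cto F g l -> cto F h m -> cto F (fun x => g x + h x) (l + m).
Proof.
move=> gl hm e e0; have e2 : 0 < e / 2 by rewrite divr_gt0.
near=> x; rewrite opprD addrACA (le_lt_trans (normcD _ _))// (splitr e) ltrD//.
- by near: x; exact: gl.
- by near: x; exact: hm.
Unshelve. all: end_near. Qed.

Lemma ctoN g l : cto F g l -> cto F (fun x => - g x) (- l).
Proof.
by move=> gl e /gl; apply: filterS => x; rewrite -opprD normc_N.
Qed.

Lemma cto_bounded g l : cto F g l -> \forall x \near F, normc (g x) < normc l + 1.
Proof.
move=> /(_ 1 ltr01); apply: filterS => x; rewrite -ltrBlDl; apply: le_lt_trans.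
exact: lerB_normc.
Qed.

Lemma ctoM g h l m : cto F g l -> cto F h m -> cto F (fun x => g x * h x) (l * m).
Proof.
move=> gl hm e e0.
pose K := normc l + normc m + 1.
have K0 : 0 < K by rewrite ltr_pwDr// addr_ge0// normc_ge0.
have e2 : 0 < e / 2 / K by rewrite !divr_gt0.
near=> x.
have -> : g x * h x - l * m = (g x - l) * m + g x * (h x - m) by ring.
rewrite (le_lt_trans (normcD _ _))// (splitr e) !normcM ltrD//.
- rewrite (@le_lt_trans _ _ (normc (g x - l) * K))//.
    rewrite ler_wpM2l ?normc_ge0// /K; have := normc_ge0 l; lra.
  by rewrite -ltr_pdivlMr//; near: x; exact: gl.
- rewrite (@le_lt_trans _ _ (K * normc (h x - m)))//.
    rewrite ler_wpM2r ?normc_ge0// ltW// (@lt_le_trans _ _ (normc l + 1))//.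
      by near: x; exact: cto_bounded.
    by rewrite /K; have := normc_ge0 m; lra.
  by rewrite mulrC -ltr_pdivlMr//; near: x; exact: hm.
Unshelve. all: end_near. Qed.

Lemma cto_neq0 g l : cto F g l -> l != 0 ->
  \forall x \near F, normc l / 2 < normc (g x).
Proof.
rewrite -normc_gt0 => gl l0; have /gl : 0 < normc l / 2 by rewrite divr_gt0.
apply: filterS => x; rewrite normc_distC => h.
have := lerB_normc l (g x); lra.
Qed.

Lemma ctoV g l : cto F g l -> l != 0 -> cto F (fun x => (g x)^-1) l^-1.
Proof.
move=> gl l0 e e0; have nl : 0 < normc l by rewrite normc_gt0.
have e2 : 0 < e * (normc l * (normc l / 2)) by rewrite !mulr_gt0.
near=> x.
have gx : normc l / 2 < normc (g x) by near: x; exact: cto_neq0.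
have gx0 : 0 < normc (g x) by rewrite (lt_trans _ gx)// divr_gt0.
have gx' : g x != 0 by rewrite -normc_gt0.
have -> : (g x)^-1 - l^-1 = (l - g x) / (l * g x) by field; rewrite gx'.
rewrite normcM normcV normcM ltr_pdivrMr ?mulr_gt0// normc_distC.
have /lt_trans : normc (g x - l) < e * (normc l * (normc l / 2)).
  by near: x; exact: gl.
by apply; rewrite !ltr_pM2l.
Unshelve. all: end_near. Qed.

Lemma cto_Re g l : cto F g l -> (fun x => Re (g x)) @ F --> Re l.
Proof.
move=> gl; apply/cvgrPdist_lt => e /gl; apply: filterS => x.
by rewrite distrC -ReB; apply: le_lt_trans (normr_Re_le _).
Qed.

Lemma cto_Im g l : cto F g l -> (fun x => Im (g x)) @ F --> Im l.
Proof.
move=> gl; apply/cvgrPdist_lt => e /gl; apply: filterS => x.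
by rewrite distrC -ImB; apply: le_lt_trans (normr_Im_le _).
Qed.

Lemma cto_ReIm g (l : R[i]) : (fun x => Re (g x)) @ F --> Re l ->
  (fun x => Im (g x)) @ F --> Im l -> cto F g l.
Proof.
move=> /cvgrPdist_lt rg /cvgrPdist_lt ig e e0; have e2 : 0 < e / 2 by rewrite divr_gt0.
near=> x; rewrite (le_lt_trans (normc_le_ReIm _))// (splitr e) ReB ImB ltrD//.
- by rewrite distrC; near: x; exact: rg.
- by rewrite distrC; near: x; exact: ig.
Unshelve. all: end_near. Qed.

Lemma cto_normc g l : cto F g l -> (fun x => normc (g x)) @ F --> normc l.
Proof.
move=> gl; apply/cvgrPdist_lt => e /gl; apply: filterS => x.
rewrite distrC; apply: le_lt_trans; rewrite ler_norml lerB_normc andbT.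
by rewrite lerNl opprB normc_distC lerB_normc.
Qed.

Lemma cto_comp (G : R[i] -> R[i]) g l m : cto (cnbhs l) G m -> cto F g l ->
  cto F (G \o g) m.
Proof.
move=> Gm gl e /Gm[d d0 dP]; have := gl _ d0.
by apply: filterS => x /dP.
Qed.

End Filters.

Notation ccont g z := (cto (cnbhs z) g (g z)).

Lemma ccont_id {R : realType} (z : R[i]) : ccont id z.
Proof. by move=> e e0; exact: cnbhs_ball. Qed.

Lemma cto_real {R : realType} {T} {F : set_system T} {FF : Filter F} (f : T -> R) (l : R) :
  f @ F --> l -> cto F (fun x => (f x)%:C%C) l%:C%C.
Proof. by move=> h; apply: cto_ReIm => //=; exact: cvg_cst. Qed.

Lemma cto_conj {R : realType} {T} {F : set_system T} {FF : Filter F} (f : T -> R[i]) l :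
  cto F f l -> cto F (fun x => conjc (f x)) (conjc l).
Proof.
by move=> h e /h; apply: filterS => x; rewrite -rmorphB normc_conj.
Qed.

(** * Differentiation *)

Section ComplexDerivative.
Context {R : realType}.
Implicit Types (g h : R[i] -> R[i]) (z l : R[i]).

(* Caratheodory's form of complex differentiability. *)
Definition cder g z l := exists2 r : R[i] -> R[i],
  \forall w \near cnbhs z, g w - g z = r w * (w - z) & cto (cnbhs z) r l.

Lemma cnbhs_singleton z (P : set R[i]) : cnbhs z P -> P z.
Proof. by move=> [d d0]; apply; rewrite subrr normc0. Qed.

Lemma cder_near g h z l : (\forall w \near cnbhs z, g w = h w) ->
  cder g z l -> cder h z l.
Proof.
move=> gh [r gr rl]; exists r => //; near=> w.
rewrite -(near gh w)// -(cnbhs_singleton gh)//.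
by near: w.
Unshelve. all: end_near. Qed.

Lemma cder_cont g z l : cder g z l -> ccont g z.
Proof.
move=> [r gr rl].
have h : cto (cnbhs z) (fun w => g z + r w * (w - z)) (g z).
  rewrite -[X in cto _ _ X]addr0 -(mulr0 l) -(subrr z).
  apply: ctoD; first exact: cto_cst.
  by apply: ctoM => //; apply: ctoD; [exact: ccont_id|exact: cto_cst].
move=> e /h; apply: filterS2 gr => w gr; rewrite -gr.
by rewrite [g z + _]addrC subrK.
Qed.

Lemma cder_cst c z : cder (fun=> c) z 0.
Proof.
exists (fun=> 0); last exact: cto_cst.
by apply: nearW => w; rewrite subrr mul0r.
Qed.

Lemma cder_id z : cder id z 1.
Proof. by exists (fun=> 1); [apply: nearW => w; rewrite mul1r|exact: cto_cst]. Qed.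

Lemma cderD g h z l m : cder g z l -> cder h z m ->
  cder (fun w => g w + h w) z (l + m).
Proof.
move=> [r gr rl] [s hs sm]; exists (fun w => r w + s w); last exact: ctoD.
by apply: filterS2 gr hs => w gr hs; rewrite opprD addrACA gr hs mulrDl.
Qed.

Lemma cderM g h z l m : cder g z l -> cder h z m ->
  cder (fun w => g w * h w) z (l * h z + g z * m).
Proof.
move=> dg dh; have hz := cder_cont dh; case: dg dh => [r gr rl] [s hs sm].
exists (fun w => r w * h w + g z * s w).
  apply: filterS2 gr hs => w gr hs.
  have -> : g w * h w - g z * h z = (g w - g z) * h w + g z * (h w - h z) by ring.
  by rewrite gr hs; ring.
by apply: ctoD; apply: ctoM => //; exact: cto_cst.
Qed.

Lemma cderZ c g z l : cder g z l -> cder (fun w => c * g w) z (c * l).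
Proof.
by move=> dg; have := cderM (cder_cst c z) dg; rewrite mul0r add0r.
Qed.

Lemma cderV g z l : cder g z l -> g z != 0 ->
  cder (fun w => (g w)^-1) z (- l / g z ^+ 2).
Proof.
move=> dg gz0; have cg := cder_cont dg; case: dg => [r gr rl].
exists (fun w => - r w / (g w * g z)).
  apply: filterS2 gr (cto_neq0 cg gz0) => w gr gw.
  have gw0 : g w != 0.
    by rewrite -normc_gt0 (le_lt_trans _ gw)// divr_ge0// normc_ge0.
  have -> : (g w)^-1 - (g z)^-1 = - (g w - g z) / (g w * g z).
    by field; rewrite gw0 gz0.
  by rewrite gr; ring.
apply: ctoM; first exact: ctoN.
rewrite expr2; apply: ctoV; last by rewrite mulf_neq0.
by apply: ctoM => //; exact: cto_cst.
Qed.

(** Slopes multiply in Caratheodory's form, so points with [h w = h z] need no separate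
    treatment. *)
Lemma cder_comp g h z l m : cder g (h z) l -> cder h z m ->
  cder (fun w => g (h w)) z (l * m).
Proof.
move=> dg dh; have ch := cder_cont dh; case: dg dh => [r gr rl] [s hs sm].
exists (fun w => r (h w) * s w); last first.
  by apply: ctoM => //; exact: (cto_comp rl).
have [d d0 dP] := gr.
apply: filterS2 hs (ch _ d0) => w hs hw.
by rewrite dP// hs mulrA.
Qed.

(** Difference of squares: the slope of [s] is that of [g] divided by [s w + s z], which tends to
    [2 * s z]. Continuity of [s] is assumed because it is what selects a branch. *)
Lemma cder_sqrt g s z l : ccont s z -> (\forall w \near cnbhs z, s w ^+ 2 = g w) ->
  s z != 0 -> cder g z l -> cder s z (l / (2 * s z)).
Proof.
move=> cs sg sz0 [r gr rl]; exists (fun w => r w / (s w + s z)); last first.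
  rewrite mulrDl mul1r; apply: ctoM => //; apply: ctoV.
    by apply: ctoD => //; exact: cto_cst.
  by rewrite -mulr2n mulrn_eq0.
have sgz := cnbhs_singleton sg.
have cs2 : cto (cnbhs z) (fun w => s w + s z) (s z + s z).
  by apply: ctoD => //; exact: cto_cst.
have s20 : s z + s z != 0 by rewrite -mulr2n mulrn_eq0.
near=> w.
have sw0 : s w + s z != 0.
  rewrite -normc_gt0; apply: (@le_lt_trans _ _ (normc (s z + s z) / 2)).
    by rewrite divr_ge0// normc_ge0.
  by near: w; exact: cto_neq0.
rewrite mulrAC; apply: (mulIf sw0); rewrite mulfVK//.
rewrite -(near gr w)// -sgz -(near sg w)//; ring.
Unshelve. all: end_near. Qed.

Lemma cderP g z l : cder g z l <-> forall e : R, 0 < e ->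
  \forall w \near cnbhs z, normc (g w - g z - l * (w - z)) <= e * normc (w - z).
Proof.
split=> [[r gr rl] e e0|h].
  apply: filterS2 gr (rl e e0) => w -> rle.
  by rewrite -mulrBl normcM ler_wpM2r ?normc_ge0// ltW.
(* The quotient is 0 / 0 at [z]; the value [l] there makes the limit hold on full neighbourhoods. *)
exists (fun w => if w == z then l else (g w - g z) / (w - z)).
  apply: nearW => w; case: eqP => [->|/eqP wz]; first by rewrite !subrr mulr0.
  by rewrite mulfVK// subr_eq0.
move=> e e0; have e2 : 0 < e / 2 by rewrite divr_gt0.
apply: filterS (h _ e2) => w; case: eqP => [->|/eqP wz].
  by move=> _; rewrite subrr normc0.
have wz0 : 0 < normc (w - z) by rewrite normc_gt0 subr_eq0.
move=> le.
have -> : (g w - g z) / (w - z) - l = (g w - g z - l * (w - z)) / (w - z).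
  by field; rewrite subr_eq0.
rewrite normcM normcV ltr_pdivrMr// (le_lt_trans le)// ltr_pM2r//; lra.
Qed.

(* [(a, b)] is the gradient; again in Caratheodory's form, with no uniqueness
   of [r] and [s] required. *)
Definition rder (w : R[i] -> R) z (a b : R) := exists r s : R[i] -> R,
  [/\ \forall y \near cnbhs z, w y - w z = r y * Re (y - z) + s y * Im (y - z),
      r @ cnbhs z --> a & s @ cnbhs z --> b].

Lemma cvg_Re z : (@Re R) @ cnbhs z --> Re z.
Proof. by apply: cto_Re; exact: ccont_id. Qed.

Lemma cvg_Im z : (@Im R) @ cnbhs z --> Im z.
Proof. by apply: cto_Im; exact: ccont_id. Qed.

Lemma rder_cont w z a b : rder w z a b -> w @ cnbhs z --> w z.
Proof.
move=> [r [s [wrs ra sb]]].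
have h : (fun y => w z + (r y * (Re y - Re z) + s y * (Im y - Im z))) @ cnbhs z
    --> w z + (a * (Re z - Re z) + b * (Im z - Im z)).
  apply: cvgD; first exact: cvg_cst.
  apply: cvgD; apply: cvgM => //; apply: cvgB; first [exact: cvg_cst|idtac].
    exact: cvg_Re.
  exact: cvg_Im.
move: h; rewrite !subrr !mulr0 !addr0; apply: cvg_trans; apply: near_eq_cvg.
by apply: filterS wrs => y; rewrite ReB ImB => <-; rewrite addrC subrK.
Qed.

Lemma rder_cst c z : rder (fun=> c) z 0 0.
Proof.
exists (fun=> 0), (fun=> 0); split; [|exact: cvg_cst..].
by apply: nearW => y; rewrite subrr !mul0r addr0.
Qed.

Lemma rderD v w z a b c d : rder v z a b -> rder w z c d ->
  rder (fun y => v y + w y) z (a + c) (b + d).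
Proof.
move=> [r [s [vrs ra sb]]] [p [q [wpq pc qd]]].
exists (fun y => r y + p y), (fun y => s y + q y); split; [|exact: cvgD..].
apply: filterS2 vrs wpq => y e1 e2.
by rewrite opprD addrACA e1 e2; ring.
Qed.

Lemma rderM v w z a b c d : rder v z a b -> rder w z c d ->
  rder (fun y => v y * w y) z (a * w z + v z * c) (b * w z + v z * d).
Proof.
move=> dv dw; have cw := rder_cont dw.
move: dv dw => [r [s [vrs ra sb]]] [p [q [wpq pc qd]]].
exists (fun y => r y * w y + v z * p y), (fun y => s y * w y + v z * q y); split.
- apply: filterS2 vrs wpq => y e1 e2.
  have -> : v y * w y - v z * w z = (v y - v z) * w y + v z * (w y - w z) by ring.
  by rewrite e1 e2; ring.
- by apply: cvgD; apply: cvgM => //; exact: cvg_cst.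
- by apply: cvgD; apply: cvgM => //; exact: cvg_cst.
Qed.

Lemma rderZ k w z a b : rder w z a b -> rder (fun y => k * w y) z (k * a) (k * b).
Proof.
by move=> dw; have := rderM (rder_cst k z) dw; rewrite !mul0r !add0r.
Qed.

Lemma rderN w z a b : rder w z a b -> rder (fun y => - w y) z (- a) (- b).
Proof.
move=> dw; have := rderZ (-1) dw; rewrite !mulN1r.
by under eq_fun do rewrite mulN1r.
Qed.

Lemma rder_near v w z a b : (\forall y \near cnbhs z, v y = w y) ->
  rder v z a b -> rder w z a b.
Proof.
move=> vw [r [s [vrs ra sb]]]; exists r, s; split => //.
have vwz := cnbhs_singleton vw.
by apply: filterS2 vw vrs => y <-; rewrite vwz.
Qed.

Lemma cder_Re g z l : cder g z l -> rder (fun y => Re (g y)) z (Re l) (- Im l).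
Proof.
move=> [r gr rl]; exists (fun y => Re (r y)), (fun y => - Im (r y)); split.
- by apply: filterS gr => y; rewrite -ReB => ->; rewrite ReM mulNr.
- exact: cto_Re.
- by apply: cvgN; exact: cto_Im.
Qed.

Lemma cder_Im g z l : cder g z l -> rder (fun y => Im (g y)) z (Im l) (Re l).
Proof.
move=> [r gr rl]; exists (fun y => Im (r y)), (fun y => Re (r y)); split.
- by apply: filterS gr => y; rewrite -ImB => ->; rewrite ImM addrC.
- exact: cto_Im.
- exact: cto_Re.
Qed.

(** The two gradients encode u_x = v_y = a and v_x = - u_y = b. Each of the four real slopes
    contributes an error of at most [e / 4]. *)
Lemma rder_cauchy_riemann (u v : R[i] -> R) z a b :
  rder u z a (- b) -> rder v z b a ->
  cder (fun y => (u y +i* v y)%C) z (a +i* b)%C.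
Proof.
move=> [r [s [urs ra sb]]] [p [q [vpq pb qa]]]; apply/cderP => e e0.
have e4 : 0 < e / 4 by rewrite divr_gt0.
move/cvgrPdist_le: ra => /(_ _ e4) ra; move/cvgrPdist_le: sb => /(_ _ e4) sb.
move/cvgrPdist_le: pb => /(_ _ e4) pb; move/cvgrPdist_le: qa => /(_ _ e4) qa.
near=> y; apply: le_trans (normc_le_ReIm _) _.
set x := y - z.
have -> : Re ((u y +i* v y)%C - (u z +i* v z)%C - (a +i* b)%C * x) =
  u y - u z - (a * Re x - b * Im x) by rewrite ReB ReM ReB.
have -> : Im ((u y +i* v y)%C - (u z +i* v z)%C - (a +i* b)%C * x) =
  v y - v z - (a * Im x + b * Re x) by rewrite ImB ImM ImB.
rewrite (near urs y)// (near vpq y)// -/x.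
have -> : r y * Re x + s y * Im x - (a * Re x - b * Im x) =
  - (a - r y) * Re x - (- b - s y) * Im x by ring.
have -> : p y * Re x + q y * Im x - (a * Im x + b * Re x) =
  - (b - p y) * Re x - (a - q y) * Im x by ring.
have bnd (c k : R) : `|c| <= e / 4 -> `|k| <= normc x -> `|c * k| <= e / 4 * normc x.
  by move=> hc hk; rewrite normrM ler_pM.
have e1 := bnd _ _ (near ra y _) (normr_Re_le x).
have e2 := bnd _ _ (near sb y _) (normr_Im_le x).
have e3 := bnd _ _ (near pb y _) (normr_Re_le x).
have e5 := bnd _ _ (near qa y _) (normr_Im_le x).
rewrite !mulNr.
apply: (@le_trans _ _ ((e / 4 * normc x + e / 4 * normc x) +
   (e / 4 * normc x + e / 4 * normc x))); last by lra.
apply: lerD; rewrite (le_trans (ler_normB _ _))// normrN lerD ?e1 ?e2 ?e3 ?e5//.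
Unshelve. all: end_near. Qed.

End ComplexDerivative.

(** * Differentiable curves in the plane *)

Section Curves.
Context {R : realType}.

Lemma is_deriveP (f : R -> R) (t l : R) :
  is_derive t 1 f l <-> (fun h => h^-1 * (f (t + h) - f t)) @ 0^' --> l.
Proof.
have E : (fun h => h^-1 *: ((f \o shift t) (h *: 1) - f t)) =
         (fun h => h^-1 * (f (t + h) - f t)).
  by apply/funext => h /=; rewrite [h%:A]mulr1 [h + t]addrC.
split=> [[df <-]|h].
  by move: df; rewrite /derivable /derive E.
by split; rewrite /derivable /derive E; [apply/cvg_ex; exists l|apply: cvg_lim].
Qed.

Definition dcurve (c : R -> R[i]) (t : R) (l : R[i]) :=
  is_derive t 1 (fun s => Re (c s)) (Re l) /\
  is_derive t 1 (fun s => Im (c s)) (Im l).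

Lemma dcurveP c t l : dcurve c t l <->
  cto (0 : R)^' (fun h => (h^-1)%:C%C * (c (t + h) - c t)) l.
Proof.
have EE h : Re ((h^-1)%:C%C * (c (t + h) - c t)) = h^-1 * (Re (c (t + h)) - Re (c t)).
  by rewrite ReM/= ReB mul0r subr0.
have FF h : Im ((h^-1)%:C%C * (c (t + h) - c t)) = h^-1 * (Im (c (t + h)) - Im (c t)).
  by rewrite ImM/= ImB mul0r addr0.
split=> [[/is_deriveP a /is_deriveP b]|h].
  by apply: cto_ReIm; [under eq_fun do rewrite EE|under eq_fun do rewrite FF].
split; apply/is_deriveP.
  by apply: cvg_trans (cto_Re h); apply: near_eq_cvg; apply: nearW.
by apply: cvg_trans (cto_Im h); apply: near_eq_cvg; apply: nearW.
Qed.

Lemma is_derive_cvg (f : R -> R) (t l : R) : is_derive t 1 f l ->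
  f @ t --> f t.
Proof. by move=> [df _]; apply/differentiable_continuous/derivable1_diffP. Qed.

Lemma dcurve_cont c t l : dcurve c t l -> cto (nbhs t) c (c t).
Proof.
by move=> [a b]; apply: cto_ReIm; [exact: is_derive_cvg a|exact: is_derive_cvg b].
Qed.

Lemma cvg_shift0 (t : R) : (fun h => t + h) @ (0 : R)^' --> t.
Proof.
rewrite -[X in _ --> X]addr0; apply: cvg_within_filter.
by apply: cvgD; [exact: cvg_cst|exact: cvg_id].
Qed.

Lemma dcurve_comp (g : R[i] -> R[i]) c t l m : cder g (c t) m -> dcurve c t l ->
  dcurve (fun s => g (c s)) t (m * l).
Proof.
move=> [r gr rm] dc; have cc := dcurve_cont dc; move/dcurveP: dc => dc.
have ch : cto (0 : R)^' (fun h => c (t + h)) (c t).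
  by move=> e /cc; exact: cvg_shift0.
apply/dcurveP.
have H : cto (0 : R)^' (fun h => r (c (t + h)) *
    ((h^-1)%:C%C * (c (t + h) - c t))) (m * l).
  by apply: ctoM => //; exact: (cto_comp rm ch).
have [d d0 dP] := gr.
move=> e /H; apply: filterS2 (ch _ d0) => h hd.
by rewrite dP// mulrCA.
Qed.

Lemma is_derive_rder (w : R[i] -> R) c t l a b : rder w (c t) a b ->
  dcurve c t l -> is_derive t 1 (fun s => w (c s)) (a * Re l + b * Im l).
Proof.
move=> [r [s [wrs ra sb]]] dc; have cc := dcurve_cont dc.
have [/is_deriveP dr /is_deriveP di] := dc.
have ch : cto (0 : R)^' (fun h => c (t + h)) (c t).
  by move=> e /cc; exact: cvg_shift0.
have cn : (fun h => c (t + h)) @ (0 : R)^' --> cnbhs (c t).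
  by move=> P [d d0 dP]; apply: filterS (ch _ d0) => h /dP.
apply/is_deriveP.
have H : (fun h => r (c (t + h)) * (h^-1 * (Re (c (t + h)) - Re (c t))) +
    s (c (t + h)) * (h^-1 * (Im (c (t + h)) - Im (c t)))) @ (0 : R)^' -->
    a * Re l + b * Im l.
  by apply: cvgD; apply: cvgM => //; [exact: (cvg_comp _ _ cn ra)
    |exact: (cvg_comp _ _ cn sb)].
apply: cvg_trans H; apply: near_eq_cvg.
have [d d0 dP] := wrs.
by apply: filterS (ch _ d0) => h /dP /= ->; rewrite !(ReB, ImB)/=; ring.
Qed.

End Curves.

(** * Means over the circle *)

Section CircleMean.
Context {R : realType}.
Implicit Types f g : R -> R.

(** Both signs of [h] are covered at once, as difference quotients require. *)
Lemma MVT_dist f (df : R -> R) (x h : R) :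
  (forall s, `|s - x| <= `|h| -> is_derive s 1 f (df s)) ->
  exists2 c, `|c - x| <= `|h| & f (x + h) - f x = df c * h.
Proof.
move=> Hd.
have cont a b : (forall s, s \in `[a, b] -> `|s - x| <= `|h|) ->
    {within `[a, b], continuous f}.
  move=> ab; apply: continuous_in_subspaceT => s sab; apply: is_derive_cvg.
  by apply: Hd; apply: ab; move: sab; rewrite inE.
have [h0|h0|->] := ltgtP h 0; last by exists x; rewrite ?subrr ?addr0 ?normr0 ?mulr0 ?subrr.
- have sub s : s \in `[x + h, x] -> `|s - x| <= `|h|.
    rewrite in_itv/= => /andP[h1 h2]; rewrite (ltr0_norm h0) ler0_norm; lra.
  have [||c cx E] := @MVT_segment R f df (x + h) x _ _ (cont _ _ sub); first lra.
    by move=> s /subset_itv_oo_cc/sub/Hd.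
  exists c; first exact: sub.
  by rewrite -[LHS]opprB E; ring.
- have sub s : s \in `[x, x + h] -> `|s - x| <= `|h|.
    rewrite in_itv/= => /andP[h1 h2]; rewrite (gtr0_norm h0) ger0_norm; lra.
  have [||c cx E] := @MVT_segment R f df x (x + h) _ _ (cont _ _ sub); first lra.
    by move=> s /subset_itv_oo_cc/sub/Hd.
  exists c; first exact: sub.
  by rewrite E; ring.
Qed.

Local Notation I := (`[0, 2 * pi]%classic : set R).

Definition mean f : R := (2 * pi)^-1 * \int[lebesgue_measure]_(x in I) f x.

Let pi20 : 0 < 2 * pi :> R.
Proof. by rewrite mulr_gt0// pi_gt0. Qed.

Let integr f : continuous f -> lebesgue_measure.-integrable I (EFin \o f).
Proof.
move=> cf; apply: continuous_compact_integrable; first exact: segment_compact.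
exact: continuous_subspaceT.
Qed.

Lemma meanD f g : continuous f -> continuous g ->
  mean (fun x => f x + g x) = mean f + mean g.
Proof.
move=> cf cg; have If := integr cf; have Ig := integr cg.
by rewrite /mean RintegralD// mulrDr.
Qed.

Lemma meanZ k f : continuous f -> mean (fun x => k * f x) = k * mean f.
Proof.
by move=> cf; rewrite /mean RintegralZl// ?mulrA 1?[k * _]mulrC//; exact: integr.
Qed.

Lemma meanN f : continuous f -> mean (fun x => - f x) = - mean f.
Proof.
by move=> cf; rewrite -mulN1r -meanZ//; congr mean; apply/funext => x; rewrite mulN1r.
Qed.

Lemma meanB f g : continuous f -> continuous g ->
  mean (fun x => f x - g x) = mean f - mean g.
Proof.
by move=> cf cg; rewrite meanD ?meanN// => x; apply: cvgN; exact: cg.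
Qed.

Lemma le_mean f g : continuous f -> continuous g -> (forall x, f x <= g x) ->
  mean f <= mean g.
Proof.
move=> cf cg fg; rewrite /mean ler_pM2l ?invr_gt0//.
by apply: le_Rintegral => //; exact: integr.
Qed.

Lemma mean_cst k : mean (fun=> k) = k.
Proof.
rewrite /mean Rintegral_cst//= lebesgue_measure_itv/= lte_fin pi20 -EFinB subr0/=.
by rewrite mulrCA mulVf ?mulr1// gt_eqF.
Qed.

Lemma mean_ge0 f : (forall x, 0 <= f x) -> 0 <= mean f.
Proof.
by move=> f0; rewrite /mean mulr_ge0 ?invr_ge0 ?(ltW pi20)// Rintegral_ge0.
Qed.

Lemma normr_mean f (k : R) : continuous f -> (forall x, x \in `[0, 2 * pi] -> `|f x| <= k) ->
  `|mean f| <= k.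
Proof.
move=> cf fk; rewrite /mean normrM gtr0_norm ?invr_gt0//.
have cn : continuous (fun x => `|f x|) by move=> x; apply: cvg_norm; exact: cf.
rewrite ler_pdivrMl//; apply: le_trans (le_normr_Rintegral _ (integr cf)) _ => //.
have <- : \int[lebesgue_measure]_(x in I) k = 2 * pi * k.
  rewrite Rintegral_cst//= lebesgue_measure_itv/= lte_fin pi20 -EFinB subr0/=.
  by rewrite mulrC.
by apply: le_Rintegral => //; apply: integr => // x; exact: cvg_cst.
Qed.

Lemma mean_derive f g : (forall x : R, is_derive x 1 f (g x)) -> continuous g ->
  f 0 = f (2 * pi) -> mean g = 0.
Proof.
move=> df cg f02; rewrite /mean /Rintegral (@continuous_FTC2 _ _ f)//.
- by rewrite f02 -EFinB subrr mulr0.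
- exact: continuous_subspaceT.
- split.
  + by move=> x _; have [] := df x.
  + by apply: cvg_at_right_filter; exact: is_derive_cvg (df _).
  + by apply: cvg_at_left_filter; exact: is_derive_cvg (df _).
- by move=> x _; rewrite derive1E; have [_ ->] := df x.
Qed.

(* Cauchy-Schwarz, from the sign of the mean of a square. *)
Lemma mean_CS (a b c : R -> R) : continuous a -> continuous b -> continuous c ->
  (forall x, 0 <= a x) -> (forall x, 0 <= c x) ->
  (forall x, b x ^+ 2 <= a x * c x) -> mean b ^+ 2 <= mean a * mean c.
Proof.
move=> ca cb cc a0 c0 H.
have Q k : 0 <= mean a * k ^+ 2 + 2 * mean b * k + mean c.
  have E : mean a * k ^+ 2 + 2 * mean b * k + mean c =
      mean (fun x => (k ^+ 2 * a x + (2 * k) * b x) + c x).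
    have c1 : continuous (fun x => k ^+ 2 * a x).
      by move=> x; apply: cvgM; [exact: cvg_cst|exact: ca].
    have c2 : continuous (fun x => (2 * k) * b x).
      by move=> x; apply: cvgM; [exact: cvg_cst|exact: cb].
    rewrite meanD// ?meanD// ?meanZ//; first by ring.
    by move=> x; apply: cvgD; [exact: c1|exact: c2].
  rewrite E; apply: mean_ge0 => x.
  have := H x; have := a0 x; have := c0 x.
  move: (a x) (b x) (c x) => A B C C0 A0 HH.
  (* Where [A = 0] the hypothesis forces [B = 0]; elsewhere the square is completed after
     multiplying by [A]. *)
  have [A00|A00] := eqVneq A 0.
    have : B ^+ 2 <= 0 by move: HH; rewrite A00 mul0r.
    rewrite le_eqVlt ltNge sqr_ge0 orbF sqrf_eq0 => /eqP ->.
    by rewrite A00 !mulr0 !add0r.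
  have A1 : 0 < A by rewrite lt_def A00.
  rewrite -(pmulr_rge0 _ A1).
  have -> : A * (k ^+ 2 * A + 2 * k * B + C) = (A * k + B) ^+ 2 + (A * C - B ^+ 2) by ring.
  by rewrite addr_ge0// ?sqr_ge0// subr_ge0.
have a0' : 0 <= mean a by exact: mean_ge0.
have [A00|A00] := eqVneq (mean a) 0.
  rewrite A00 mul0r; have [->|b0] := eqVneq (mean b) 0; first by rewrite expr0n.
  (* With [mean a = 0] the quadratic is affine in [k], and at this [k] it equals -1. *)
  have := Q (- (mean c + 1) / (2 * mean b)); rewrite A00 mul0r add0r.
  have -> : 2 * mean b * (- (mean c + 1) / (2 * mean b)) + mean c = -1 by field.
  by rewrite ler0N1.
have A1 : 0 < mean a by rewrite lt_def A00.
have := Q (- mean b / mean a).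
rewrite -(pmulr_rge0 _ A1).
have -> : mean a * (mean a * (- mean b / mean a) ^+ 2 +
  2 * mean b * (- mean b / mean a) + mean c) = mean a * mean c - mean b ^+ 2 by field.
by rewrite subr_ge0.
Qed.

(** Differentiation under the mean without dominated convergence: compactness of [[0, 2 * pi]] makes
    [F1 s] uniformly close to [F1 s0], and the mean value theorem turns every difference quotient
    into a value of [F1]. *)
Lemma is_derive_mean (F F1 : R -> R -> R) (s0 : R) :
  (\forall s \near s0, forall x : R, is_derive (s : R) 1 (F^~ x) (F1 s x)) ->
  (\forall s \near s0, continuous (F s)) ->
  (forall x, {for (s0, x), continuous (fun p : R * R => F1 p.1 p.2)}) ->
  is_derive s0 1 (fun s => mean (F s)) (mean (F1 s0)).
Proof.
move=> dF cF cF1; apply/is_deriveP/cvgrPdist_le => e e0.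
have cF10 : continuous (F1 s0).
  move=> x; apply: (@continuous_comp _ _ _ (fun x => (s0, x)) (fun p => F1 p.1 p.2)).
    exact: (cvg_pair (cvg_cst s0) (@cvg_id _ (nbhs x))).
  exact: cF1.
have e2 : 0 < e / 2 by rewrite divr_gt0.
have unif : \forall s \near s0, forall x, x \in `[0, 2 * pi] ->
    `|F1 s x - F1 s0 x| <= e.
  have /compact_near_coveringP := @segment_compact R 0 (2 * pi).
  move=> /(_ _ (nbhs s0) (fun s x => `|F1 s x - F1 s0 x| <= e)); apply.
  move=> x _.
  have /cvgrPdist_lt /(_ _ e2) H1 := cF1 x.
  have /cvgrPdist_lt /(_ _ e2) H2 := cF10 x.
  have [[A B] /= [A0 B0] AB] := H1.
  exists (B `&` [set y | `|F1 s0 x - F1 s0 y| < e / 2], A) => /=.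
    by split => //; apply: filterI.
  move=> [y s] /= [[By y2] As].
  have := AB (s, y) (conj As By) => /= h.
  rewrite -(subrK (F1 s0 x) (F1 s y)) -addrA (le_trans (ler_normD _ _))//.
  by rewrite (splitr e) distrC lerD// ltW.
have cFs0 := nbhs_singleton cF.
have [d /= d0 dP] : \forall s \near s0,
   [/\ forall x : R, is_derive (s : R) 1 (F^~ x) (F1 s x), continuous (F s) &
    forall x, x \in `[0, 2 * pi] -> `|F1 s x - F1 s0 x| <= e].
  by near=> s; split; near: s.
have dP' s : `|s - s0| < d -> [/\ forall x : R, is_derive (s : R) 1 (F^~ x) (F1 s x),
    continuous (F s) & forall x, x \in `[0, 2 * pi] -> `|F1 s x - F1 s0 x| <= e].
  by rewrite distrC => /dP.
near=> h.
have h0 : h != 0 by near: h; exact: nbhs_dnbhs_neq.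
have hd : `|h| < d.
  near: h; apply: dnbhs0_lt => //.
have [_ cFh _] : [/\ forall x : R, is_derive (s0 + h) 1 (F^~ x) (F1 (s0 + h) x),
    continuous (F (s0 + h)) &
    forall x, x \in `[0, 2 * pi] -> `|F1 (s0 + h) x - F1 s0 x| <= e].
  by apply: dP'; rewrite addrAC subrr add0r.
rewrite distrC -meanB// -meanZ; last first.
  by move=> x; apply: cvgB; [exact: cFh|exact: cFs0].
have c3 : continuous (fun x => h^-1 * (F (s0 + h) x - F s0 x)).
  by move=> x; apply: cvgM; [exact: cvg_cst|apply: cvgB; [exact: cFh|exact: cFs0]].
rewrite -meanB//; apply: normr_mean.
  by move=> x; apply: cvgB; [exact: c3|exact: cF10].
move=> x xI.
have [c ch ->] : exists2 c, `|c - s0| <= `|h| & F (s0 + h) x - F s0 x = F1 c x * h.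
  apply: (@MVT_dist (F^~ x) (F1^~ x)) => s sh.
  by have [] := dP' s (le_lt_trans sh hd).
rewrite mulrCA mulVf// mulr1.
by have [_ _] := dP' c (le_lt_trans ch hd); apply.
Unshelve. all: end_near. Qed.

Definition cmean (f : R -> R[i]) : R[i] :=
  (mean (fun x => Re (f x)) +i* mean (fun x => Im (f x)))%C.

Definition ccurve (f : R -> R[i]) := forall t, cto (nbhs t) f (f t).

Lemma ccurve_Re c : ccurve c -> continuous (fun x => Re (c x)).
Proof. by move=> cc t; exact: (cto_Re (cc t)). Qed.

Lemma ccurve_Im c : ccurve c -> continuous (fun x => Im (c x)).
Proof. by move=> cc t; exact: (cto_Im (cc t)). Qed.

Lemma ccurve_normc c : ccurve c -> continuous (fun x => normc (c x)).
Proof. by move=> cc t; exact: (cto_normc (cc t)). Qed.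

Lemma cmeanD c d : ccurve c -> ccurve d ->
  cmean (fun x => c x + d x) = cmean c + cmean d.
Proof.
move=> cc cd; apply: eqcP => /=.
  by rewrite -meanD; [|exact: ccurve_Re..]; congr mean; apply/funext => x; rewrite ReD.
by rewrite -meanD; [|exact: ccurve_Im..]; congr mean; apply/funext => x; rewrite ImD.
Qed.

Lemma cmeanZ k c : ccurve c -> cmean (fun x => k * c x) = k * cmean c.
Proof.
move=> cc; have cr := ccurve_Re cc; have ci := ccurve_Im cc.
have cz (u : R) (f : R -> R) : continuous f -> continuous (fun x => u * f x).
  by move=> cf x; apply: cvgM; [exact: cvg_cst|exact: cf].
apply: eqcP; rewrite /= ?ReM ?ImM /= -!meanZ//.
  by rewrite -meanB; [|exact: cz..]; congr mean; apply/funext => x; rewrite ReM.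
by rewrite -meanD; [|exact: cz..]; congr mean; apply/funext => x; rewrite ImM.
Qed.

Lemma cmean_cst k : cmean (fun=> k) = k.
Proof. by apply: eqcP; rewrite /= mean_cst. Qed.

(** The mean is rotated onto the positive axis; its modulus is then the mean of a real part. *)
Lemma normc_cmean c : ccurve c -> normc (cmean c) <= mean (fun x => normc (c x)).
Proof.
move=> cc; rewrite -[normc _]/(Re (normc (cmean c))%:C%C) -conj_dirM -cmeanZ//.
rewrite /=; apply: le_mean; last first.
- move=> x; apply: le_trans (Re_le_normc _) _.
  by rewrite normcM normc_conj normc_dir mul1r.
- exact: ccurve_normc.
- by apply: ccurve_Re => t; apply: ctoM; [exact: cto_cst|exact: cc].
Qed.

Lemma normc_cmean_le c k : ccurve c -> (forall x, normc (c x) <= k) ->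
  normc (cmean c) <= k.
Proof.
move=> cc ck; apply: le_trans (normc_cmean cc) _.
rewrite -[leRHS]mean_cst; apply: le_mean => //; first exact: ccurve_normc.
by move=> x; exact: cvg_cst.
Qed.

Lemma cmean_derive c d : (forall x, dcurve c x (d x)) -> ccurve d ->
  c 0 = c (2 * pi) -> cmean d = 0.
Proof.
move=> dc cd c02; apply: eqcP => /=.
  apply: (@mean_derive (fun x => Re (c x))); last by rewrite c02.
    by move=> x; have [] := dc x.
  exact: ccurve_Re.
apply: (@mean_derive (fun x => Im (c x))); last by rewrite c02.
  by move=> x; have [] := dc x.
exact: ccurve_Im.
Qed.

Lemma dcurve_cmean (F F1 : R -> R -> R[i]) (s0 : R) :
  (\forall s \near s0, forall x, dcurve (F^~ x) s (F1 s x)) ->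
  (\forall s \near s0, ccurve (F s)) ->
  (forall x, cto (nbhs (s0, x)) (fun p : R * R => F1 p.1 p.2) (F1 s0 x)) ->
  dcurve (fun s => cmean (F s)) s0 (cmean (F1 s0)).
Proof.
move=> dF cF cF1; split => /=.
  apply: (@is_derive_mean (fun s x => Re (F s x)) (fun s x => Re (F1 s x))).
  - by apply: filterS dF => s dF x; have [] := dF x.
  - by apply: filterS cF => s; exact: ccurve_Re.
  - by move=> x; exact: cto_Re (cF1 x).
apply: (@is_derive_mean (fun s x => Im (F s x)) (fun s x => Im (F1 s x))).
- by apply: filterS dF => s dF x; have [] := dF x.
- by apply: filterS cF => s; exact: ccurve_Im.
- by move=> x; exact: cto_Im (cF1 x).
Qed.

Definition cis (t : R) : R[i] := (cos t +i* sin t)%C.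

Lemma normc_cis t : normc (cis t) = 1.
Proof. by rewrite /= cos2Dsin2 sqrtr1. Qed.

Lemma cis0 : cis 0 = 1.
Proof. by rewrite /cis cos0 sin0. Qed.

Lemma cis2pi : cis (2 * pi) = 1.
Proof. by rewrite /cis mulr_natl cos2pi sin2pi. Qed.

Lemma dcurve_cis t : dcurve cis t ('i%C * cis t).
Proof.
split => /=; apply: is_derive_eq; rewrite ?mul0r ?mul1r ?add0r ?sub0r//.
Qed.

Lemma ccurve_cis : ccurve cis.
Proof. by move=> t; exact: dcurve_cont (dcurve_cis t). Qed.

End CircleMean.

(** * Holomorphic functions *)

(** The derivative is part of the data and is required to be continuous, so that circle means can be
    differentiated under the integral; no theorem of Goursat type is involved. *)
Definition holo {R : realType} (U : set R[i]) (g g' : R[i] -> R[i]) :=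
  forall z, U z -> cder g z (g' z) /\ ccont g' z.

Definition disc {R : realType} (a : R[i]) (r : R) : set R[i] :=
  [set z | normc (z - a) < r].

(** * Fourier coefficients on circles and the estimates that they give *)

Section Moments.
Context {R : realType}.
Implicit Types (g h : R[i] -> R[i]) (a z w : R[i]).

Lemma disc_center a (r : R) : 0 < r -> disc a r a.
Proof. by rewrite /disc /= subrr normc0. Qed.

Lemma disc_circle a (s t r : R) : `|s| < r -> disc a r (a + s%:C%C * cis t).
Proof.
by rewrite /disc /= addrAC subrr add0r normcM normc_real normc_cis mulr1.
Qed.

Lemma copen_disc a (r : R) : copen (disc a r).
Proof.
move=> z za; exists (r - normc (z - a)); first by rewrite subr_gt0.
move=> w; rewrite ltrBrDr => wz; rewrite /disc /=.
by apply: le_lt_trans (normc_triangle z _ _) _.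
Qed.

Lemma sub_disc a b (r s : R) : normc (b - a) + s <= r -> disc b s `<=` disc a r.
Proof.
move=> h z zb; rewrite /disc /=; apply: le_lt_trans (normc_triangle b _ _) _.
by apply: lt_le_trans h; rewrite addrC ltrD2l.
Qed.

Lemma holoS (U V : set R[i]) g g' : V `<=` U -> holo U g g' -> holo V g g'.
Proof. by move=> VU Hg z /VU; exact: Hg. Qed.

Lemma holo_cont (U : set R[i]) g g' z : holo U g g' -> U z -> ccont g z.
Proof. by move=> Hg /Hg[/cder_cont]. Qed.

Lemma cto_cvg_comp {S T : Type} (F : set_system S) (G : set_system T)
    (f : S -> T) (c : T -> R[i]) l : f @ F --> G -> cto G c l -> cto F (c \o f) l.
Proof. by move=> fG cl e /cl /fG. Qed.

Lemma dcurve_const_itv (J : R -> R[i]) (u v : R) : u <= v ->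
  (forall t, u <= t -> t <= v -> dcurve J t 0) -> J u = J v.
Proof.
move=> uv dJ.
have H (f : R -> R) : (forall t : R, u <= t -> t <= v -> is_derive t 1 f 0) ->
    f u = f v.
  move=> df.
  have [t||c _] := @MVT_segment R f (fun=> 0) u v uv; last first.
  - by rewrite mul0r => /eqP; rewrite subr_eq0 => /eqP.
  - apply: continuous_in_subspaceT => t; rewrite inE/= in_itv/= => /andP[h1 h2].
    exact: is_derive_cvg (df t h1 h2).
  - by rewrite in_itv/= => /andP[h1 h2]; apply: df; exact: ltW.
apply: eqcP.
  by apply: (H (fun t => Re (J t))) => t h1 h2; have [] := dJ t h1 h2.
by apply: (H (fun t => Im (J t))) => t h1 h2; have [] := dJ t h1 h2.
Qed.

Lemma dcurve_const (J : R -> R[i]) (r s : R) : (forall t, `|t| < r -> dcurve J t 0) ->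
  0 <= s < r -> J s = J 0.
Proof.
move=> dJ /andP[s0 sr]; apply/esym/dcurve_const_itv => // t t0 ts.
by apply: dJ; rewrite ger0_norm// (le_lt_trans ts).
Qed.

Lemma dcurve_cst (k : R[i]) (t : R) : dcurve (fun=> k) t 0.
Proof. by split; exact: is_derive_cst. Qed.

Lemma dcurveD (c d : R -> R[i]) t l m : dcurve c t l -> dcurve d t m ->
  dcurve (fun x => c x + d x) t (l + m).
Proof.
move=> [c1 c2] [d1 d2]; split.
  rewrite ReD; have := is_deriveD c1 d1; congr (is_derive _ _ _ _).
  by apply/funext => x; rewrite ReD.
rewrite ImD; have := is_deriveD c2 d2; congr (is_derive _ _ _ _).
by apply/funext => x; rewrite ImD.
Qed.

Lemma dcurve_eq (c : R -> R[i]) t l m : dcurve c t l -> l = m -> dcurve c t m.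
Proof. by move=> ? <-. Qed.

Lemma dcurveM (c d : R -> R[i]) t l m : dcurve c t l -> dcurve d t m ->
  dcurve (fun x => c x * d x) t (l * d t + c t * m).
Proof.
move=> [c1 c2] [d1 d2]; split.
  have := is_deriveB (is_deriveM c1 d1) (is_deriveM c2 d2).
  rewrite /GRing.scale/= => H; apply: is_derive_eq.
    by move: H; congr (is_derive _ _ _ _); apply/funext => x; rewrite ReM.
  by rewrite ReD !ReM; ring.
have := is_deriveD (is_deriveM c1 d2) (is_deriveM c2 d1).
rewrite /GRing.scale/= => H; apply: is_derive_eq.
  by move: H; congr (is_derive _ _ _ _); apply/funext => x; rewrite ImM.
by rewrite ImD !ImM; ring.
Qed.

Lemma dcurveZ k (c : R -> R[i]) t l : dcurve c t l ->
  dcurve (fun x => k * c x) t (k * l).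
Proof.
by move=> dc; apply: dcurve_eq (dcurveM (dcurve_cst k t) dc) _; rewrite mul0r add0r.
Qed.

Lemma dcurve_real (t : R) : dcurve (fun s => s%:C%C) t 1.
Proof. by split => /=; [exact: is_derive_id|exact: is_derive_cst]. Qed.

Lemma dcurve_ray a k (t : R) : dcurve (fun s => a + s%:C%C * k) t k.
Proof.
apply: dcurve_eq (dcurveD (dcurve_cst a t)
  (dcurveM (dcurve_real t) (dcurve_cst k t))) _.
by rewrite add0r mul1r mulr0 addr0.
Qed.

Lemma dcurve_circle a (s t : R) :
  dcurve (fun t => a + s%:C%C * cis t) t (s%:C%C * ('i%C * cis t)).
Proof.
apply: dcurve_eq (dcurveD (dcurve_cst a t) (dcurveZ s%:C%C (dcurve_cis t))) _.
by rewrite add0r.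
Qed.

Lemma cto_polar a (s t : R) : cto (nbhs (s, t))
  (fun p : R * R => a + p.1%:C%C * cis p.2) (a + s%:C%C * cis t).
Proof.
apply: ctoD; first exact: cto_cst.
apply: ctoM; first by apply: cto_real; exact: cvg_fst.
by apply: (@cto_cvg_comp _ _ _ (nbhs t) snd); [exact: cvg_snd|exact: ccurve_cis].
Qed.

(* [m] is a multiple of [t |-> exp(i k t)]. *)
Section Moment.
Variables (a : R[i]) (r k : R) (m : R -> R[i]).
Hypothesis dm : forall t, dcurve m t ('i%C * k%:C%C * m t).
Hypothesis m02 : m 0 = m (2 * pi).

Let cm : ccurve m. Proof. by move=> t; exact: dcurve_cont (dm t). Qed.

Lemma ccurve_moment g s : (forall z, disc a r z -> ccont g z) -> `|s| < r ->
  ccurve (fun t => g (a + s%:C%C * cis t) * m t).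
Proof.
move=> cg sr t; apply: ctoM; last exact: cm.
exact: (cto_comp (cg _ (disc_circle a t sr)) (dcurve_cont (dcurve_circle a s t))).
Qed.

Variables (g g' : R[i] -> R[i]).
Hypothesis Hg : holo (disc a r) g g'.

Let cg' z : disc a r z -> ccont g' z. Proof. by move=> /Hg[]. Qed.
Let cg z : disc a r z -> ccont g z. Proof. by move=> /Hg[/cder_cont]. Qed.

(** A Fourier coefficient of [g] on the circle of radius [s]; [dmoment] is its derivative in [s]. *)
Definition moment s := cmean (fun t => g (a + s%:C%C * cis t) * m t).
Definition dmoment s := cmean (fun t => g' (a + s%:C%C * cis t) * cis t * m t).

Lemma dcurve_moment s : `|s| < r -> dcurve moment s (dmoment s).
Proof.
move=> sr.
have nr : \forall u \near s, `|u| < r.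
  exists (r - `|s|) => /=; first by rewrite subr_gt0.
  by move=> u /=; rewrite distrC ltrBrDr; apply: le_lt_trans; rewrite -{1}(subrK s u) ler_normD.
apply: (@dcurve_cmean _ (fun s t => g (a + s%:C%C * cis t) * m t)
  (fun s t => g' (a + s%:C%C * cis t) * cis t * m t)).
- apply: filterS nr => u ur t.
  have [dg _] := Hg (disc_circle a t ur).
  apply: dcurve_eq (dcurveM (dcurve_comp dg (dcurve_ray a (cis t) u))
    (dcurve_cst (m t) u)) _.
  by rewrite mulr0 addr0.
- by apply: filterS nr => u; exact: ccurve_moment.
- move=> t; apply: ctoM.
    apply: ctoM.
      exact: (cto_comp (cg' (disc_circle a t sr)) (@cto_polar a s t)).
    by apply: (@cto_cvg_comp _ _ _ (nbhs t) snd); [exact: cvg_snd|exact: ccurve_cis].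
  by apply: (@cto_cvg_comp _ _ _ (nbhs t) snd); [exact: cvg_snd|exact: cm].
Qed.

Lemma ccurve_dmoment s : `|s| < r ->
  ccurve (fun t => g' (a + s%:C%C * cis t) * cis t * m t).
Proof.
move=> sr t; apply: ctoM; last exact: cm.
apply: ctoM; last exact: ccurve_cis.
exact: (cto_comp (cg' (disc_circle a t sr)) (dcurve_cont (dcurve_circle a s t))).
Qed.

(** The angular derivative of [g * m] is i times [s * g' * cis * m + k * g * m], and its mean is 0
    by periodicity. So the moment J solves s J' = - k J: it behaves like the power - k of the
    radius. *)
Lemma moment_dmoment s : `|s| < r -> s%:C%C * dmoment s = - (k%:C%C * moment s).
Proof.
move=> sr; have c1 := ccurve_dmoment sr; have c2 := ccurve_moment cg sr.
have c3 : ccurve (fun t => s%:C%C * (g' (a + s%:C%C * cis t) * cis t * m t)).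
  by move=> t; apply: ctoM; [exact: cto_cst|exact: c1].
have c4 : ccurve (fun t => k%:C%C * (g (a + s%:C%C * cis t) * m t)).
  by move=> t; apply: ctoM; [exact: cto_cst|exact: c2].
have c5 : ccurve (fun t => s%:C%C * (g' (a + s%:C%C * cis t) * cis t * m t) +
     k%:C%C * (g (a + s%:C%C * cis t) * m t)).
  by move=> t; apply: ctoD; [exact: c3|exact: c4].
have H : cmean (fun t => 'i%C * (s%:C%C * (g' (a + s%:C%C * cis t) * cis t * m t) +
     k%:C%C * (g (a + s%:C%C * cis t) * m t))) = 0.
  apply: (@cmean_derive _ (fun t => g (a + s%:C%C * cis t) * m t)).
  - move=> t; have [dg _] := Hg (disc_circle a t sr).
    apply: dcurve_eq (dcurveM (dcurve_comp dg (dcurve_circle a s t)) (dm t)) _.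
    by ring.
  - by move=> t; apply: ctoM; [exact: cto_cst|exact: c5].
  - by rewrite cis0 cis2pi m02.
move: H; rewrite cmeanZ// cmeanD// !cmeanZ// => /eqP.
rewrite mulf_eq0 => /orP[|]; last by rewrite addr_eq0 => /eqP.
by rewrite eq_complex/= oner_eq0 andbF.
Qed.

End Moment.

Lemma dcurve_cst1 (t : R) : dcurve (fun=> 1 : R[i]) t ('i%C * 0%:C%C * 1).
Proof. by apply: dcurve_eq (dcurve_cst _ _) _; rewrite mulr0 mul0r. Qed.

Lemma dcurve_cisX n (t : R) :
  dcurve (fun t => cis t ^+ n) t ('i%C * n%:R%:C%C * cis t ^+ n).
Proof.
elim: n => [|n IH].
  by under [X in dcurve X]eq_fun do rewrite expr0; exact: dcurve_cst1.
under [X in dcurve X]eq_fun do rewrite exprS.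
apply: dcurve_eq (dcurveM (dcurve_cis t) IH) _.
rewrite exprS -addn1 natrD rmorphD/=.
by rewrite -[X in _ * (_ + X)]/(1 : R[i]); ring.
Qed.

Lemma cisX2pi n : cis (0 : R) ^+ n = cis (2 * pi) ^+ n.
Proof. by rewrite cis0 cis2pi. Qed.

Lemma ccurve_cisX n : ccurve (fun t : R => cis t ^+ n).
Proof. by move=> t; exact: dcurve_cont (dcurve_cisX n t). Qed.

Lemma cmean_cisX n : cmean (fun t : R => cis t ^+ n.+1) = 0.
Proof.
have H : cmean (fun t : R => ('i%C * n.+1%:R%:C%C) * cis t ^+ n.+1) = 0.
  apply: (cmean_derive (dcurve_cisX n.+1)); last exact: cisX2pi.
  by move=> t; apply: ctoM; [exact: cto_cst|exact: ccurve_cisX].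
move: H; rewrite cmeanZ; last exact: ccurve_cisX.
move=> /eqP; rewrite !mulf_eq0 => /orP[/orP[]|/eqP//].
  by rewrite eq_complex/= oner_eq0 andbF.
by rewrite eq_complex/= pnatr_eq0.
Qed.

Lemma cmean_cis : cmean (@cis R) = 0.
Proof. by rewrite -(cmean_cisX 0); congr cmean; apply/funext => t; rewrite expr1. Qed.

Section MeanValue.
Variables (a : R[i]) (r : R) (g g' : R[i] -> R[i]).
Hypothesis Hg : holo (disc a r) g g'.

Lemma ccurve_on_circle s : `|s| < r -> ccurve (fun t => g (a + s%:C%C * cis t)).
Proof.
move=> sr t; have [dg _] := Hg (disc_circle a t sr).
exact: dcurve_cont (dcurve_comp dg (dcurve_circle a s t)).
Qed.

Lemma mean_value s : 0 <= s < r -> cmean (fun t => g (a + s%:C%C * cis t)) = g a.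
Proof.
move=> sr.
have E u : moment a (fun=> 1) g u = cmean (fun t => g (a + u%:C%C * cis t)).
  by rewrite /moment; congr cmean; apply/funext => t; rewrite mulr1.
rewrite -E.
have -> : moment a (fun=> 1) g s = moment a (fun=> 1) g 0.
  apply: (dcurve_const _ sr) => t tr.
  apply: dcurve_eq (dcurve_moment dcurve_cst1 Hg tr) _.
  (* The identity s J' = - k J says nothing at radius 0; there the derivative is the mean of
     [g' a * cis], which vanishes. *)
  have [t0|t0] := eqVneq t 0; last first.
    have := moment_dmoment dcurve_cst1 erefl Hg tr.
    rewrite mul0r oppr0 => /eqP; rewrite mulf_eq0 => /orP[|/eqP//].
    by rewrite eq_complex/= (negPf t0).
  have -> : dmoment a (fun=> 1) g' t = cmean (fun x => g' a * cis x).
    by congr cmean; apply/funext => x; rewrite t0 mul0r addr0 mulr1.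
  by rewrite cmeanZ ?cmean_cis ?mulr0//; exact: ccurve_cis.
by rewrite E -[RHS]cmean_cst; congr cmean; apply/funext => t; rewrite mul0r addr0.
Qed.

(** With [k = n + 1], the product of J and the power n + 1 of the radius is constant, and it is 0 at
    radius 0. *)
Lemma mean_cisX n s : 0 < s < r ->
  cmean (fun t => g (a + s%:C%C * cis t) * cis t ^+ n.+1) = 0.
Proof.
move=> /andP[s0 sr]; pose J := moment a (fun t => cis t ^+ n.+1) g.
have dJ t : `|t| < r -> dcurve (fun u : R => u%:C%C ^+ n.+1 * J u) t 0.
  move=> tr.
  have dX k : dcurve (fun u : R => u%:C%C ^+ k.+1) t (k.+1%:R * t%:C%C ^+ k).
    elim: k => [|k IH].
      by under [X in dcurve X]eq_fun do rewrite expr1; rewrite expr0 mulr1; exact: dcurve_real.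
    under [X in dcurve X]eq_fun do rewrite exprS.
    apply: dcurve_eq (dcurveM (dcurve_real t) IH) _.
    by rewrite exprS -[in RHS]addn1 natrD; ring.
  apply: dcurve_eq (dcurveM (dX n) (dcurve_moment (dcurve_cisX n.+1) Hg tr)) _.
  have := moment_dmoment (dcurve_cisX n.+1) (cisX2pi n.+1) Hg tr.
  rewrite [t%:C%C ^+ n.+1]exprSr -(mulrA (t%:C%C ^+ n)) => ->.
  by rewrite rmorph_nat; ring.
have sr0 : 0 <= s < r by rewrite ltW.
have := dcurve_const dJ sr0; rewrite [X in _ = X * _]exprS !mul0r => /eqP.
rewrite mulf_eq0 expf_eq0/= => /orP[|/eqP//].
by rewrite eq_complex/= gt_eqF.
Qed.

Let conj_cis (t : R) : R[i] := conjc (cis t).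

Let dcurve_conj_cis (t : R) : dcurve conj_cis t ('i%C * (-1)%:C%C * conj_cis t).
Proof.
by split => /=; apply: is_derive_eq; rewrite ?mul0r ?mul1r ?add0r ?sub0r; ring.
Qed.

Lemma conj_cisM (t : R) : conjc (cis t) * cis t = 1.
Proof. by rewrite mulrC mulc_conj normc_cis expr1n. Qed.

(** Cauchy's formula for the derivative. With [k = -1], J / s is constant and equals the mean [L] of
    [g']. The mean value property of [g'] is not yet available, since [holo_deriv] rests on this
    lemma; the constant is identified by letting the radius tend to 0. *)
Lemma mean_conj_cis s : 0 < s < r ->
  cmean (fun t => g (a + s%:C%C * cis t) * conjc (cis t)) = s%:C%C * g' a.
Proof.
pose J := moment a conj_cis g; pose L s := dmoment a conj_cis g' s.
have m02 : conj_cis 0 = conj_cis (2 * pi) by rewrite /conj_cis cis0 cis2pi.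
have JL u : `|u| < r -> u%:C%C * L u = J u.
  move=> ur; rewrite /L (moment_dmoment dcurve_conj_cis m02 Hg ur).
  by rewrite rmorphN1 mulN1r opprK.
have LE u : L u = cmean (fun t => g' (a + u%:C%C * cis t)).
  rewrite /L /dmoment; congr cmean; apply/funext => t.
  by rewrite -mulrA [cis t * _]mulrC conj_cisM mulr1.
have r0 u : 0 < u < r -> `|u| < r by move=> /andP[u0 ur]; rewrite gtr0_norm.
have Lc (u v : R) : 0 < u -> u < v -> v < r -> L u = L v.
  move=> u0 uv vr.
  have nz (w : R) : 0 < w -> w%:C%C != 0 :> R[i].
    by move=> w0; rewrite eq_complex/= gt_eqF.
  have dLt t : u <= t -> t <= v -> dcurve (fun w : R => (w^-1)%:C%C * J w) t 0.
    move=> ut tv; have t0 : 0 < t by exact: lt_le_trans ut.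
    have tr : `|t| < r by rewrite r0// t0 (le_lt_trans tv).
    have dV : dcurve (fun w : R => (w^-1)%:C%C) t (- (t ^- 2))%:C%C.
      split => /=; last exact: is_derive_cst.
      apply: is_derive_eq; first by apply: is_deriveV; rewrite gt_eqF.
      by rewrite /GRing.scale/= mulr1.
    apply: dcurve_eq (dcurveM dV (dcurve_moment dcurve_conj_cis Hg tr)) _.
    rewrite -/J -/(L t) -(JL t tr) mulrA -mulrDl.
    apply/eqP; rewrite mulf_eq0; apply/orP; left; apply/eqP.
    rewrite -rmorphM -rmorphD /= [X in X%:C%C](_ : _ = 0)//.
    by field; rewrite gt_eqF.
  have E (w : R) : 0 < w -> w < r -> (w^-1)%:C%C * J w = L w.
    move=> w0 wr; rewrite -JL ?r0 ?w0// mulrA -rmorphM /= mulVf ?gt_eqF//.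
    by rewrite mul1r.
  rewrite -(E u)// -?(E v)//; [|exact: lt_trans uv|exact: lt_trans vr].
  exact: (@dcurve_const_itv (fun w : R => (w^-1)%:C%C * J w) u v (ltW uv) dLt).
move=> /andP[s0 sr]; rewrite -[LHS]/(J s) -JL ?r0 ?s0//; congr (_ * _).
apply/eqP; rewrite -subr_eq0 -normc_le0; apply/ler_addgt0Pl => e e0; rewrite addr0.
have [_ cg'] := Hg (disc_center a (lt_trans s0 sr)).
have [d d0 dP] := cg' e e0.
(* On the circle of this radius [g'] is within [e] of [g' a]; constancy of [L] carries the bound to
   radius [s]. *)
pose u := Num.min s d / 2.
have m0 : 0 < Num.min s d by rewrite lt_min s0.
have u0 : 0 < u by rewrite divr_gt0.
have um : u < Num.min s d by rewrite ltr_pdivrMr// mulr_natr mulr2n ltrDl.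
have /andP[us ud] : (u < s) && (u < d) by rewrite -lt_min.
have ur : `|u| < r by rewrite r0// u0 (lt_trans us).
rewrite -(Lc u s)// LE -[X in _ - X]cmean_cst -[X in _ + X]mulN1r.
have cc : ccurve (fun t => g' (a + u%:C%C * cis t)).
  move=> t; have [_ cgt] := Hg (disc_circle a t ur).
  exact: (cto_comp cgt (dcurve_cont (dcurve_circle a u t))).
have c1 : ccurve (fun=> g' a) by move=> t; exact: cto_cst.
have c2 : ccurve (fun=> -1 * g' a) by move=> t; exact: cto_cst.
rewrite -cmeanZ// -cmeanD//; apply: normc_cmean_le.
  by move=> t; apply: ctoD; [exact: cc|exact: c2].
move=> t; rewrite mulN1r ltW// dP// addrAC subrr add0r normcM normc_real normc_cis.
by rewrite mulr1 gtr0_norm.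
Qed.

End MeanValue.

(** Mean formulas hold on circles of radius [s < r]; this carries the resulting bounds to [r]. *)
Lemma le_of_lt_mul (x r K : R) : 0 < r -> (forall s, 0 < s -> s < r -> s * x <= K) ->
  r * x <= K.
Proof.
move=> r0 H; have [x0|x0] := leP x 0.
  have r2 : 0 < r / 2 by rewrite divr_gt0.
  have := H (r / 2) r2; rewrite ltr_pdivrMr// mulr_natr mulr2n ltrDl => /(_ r0).
  have : r / 2 * x <= 0 by rewrite mulr_ge0_le0// ltW.
  lra.
apply/ler_addgt0Pr => e e0.
(* The entry [r / 2] keeps [s] positive; replacing [r] by [r - e / x] costs exactly [e]. *)
pose s := Num.max (r / 2) (r - e / x).
have s0 : 0 < s by rewrite lt_max divr_gt0.
have sr : s < r.
  rewrite gt_max ltrBlDr ltrDl divr_gt0// andbT ltr_pdivrMr//.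
  by rewrite mulr_natr mulr2n ltrDl.
have := H s s0 sr; rewrite -(lerD2r e); apply: le_trans.
have : r - e / x <= s by rewrite le_max lexx orbT.
rewrite -(ler_pM2r x0) mulrBl mulfVK ?gt_eqF//; lra.
Qed.

Lemma cauchy_estimate a (r K : R) g g' : holo (disc a r) g g' -> 0 < r ->
  (forall z, disc a r z -> normc (g z) <= K) -> r * normc (g' a) <= K.
Proof.
move=> Hg r0 gK; apply: le_of_lt_mul => // s s0 sr.
have sr' : `|s| < r by rewrite gtr0_norm.
rewrite -[X in X * _](gtr0_norm s0) -normc_real -normcM -(mean_conj_cis Hg) ?s0//.
apply: normc_cmean_le.
  move=> t; apply: ctoM; first exact: (ccurve_on_circle Hg sr' t).
  by apply: cto_conj; exact: ccurve_cis.
move=> t; rewrite normcM normc_conj normc_cis mulr1; apply: gK.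
exact: disc_circle.
Qed.

(** The mean value theorem fails for complex values, so the error is first rotated onto the positive
    axis and the real theorem is applied to a real part along the segment. Taking [l = 0] gives
    Lipschitz bounds, [l = g' x] first-order Taylor bounds. *)
Lemma mean_value_ineq g g' (x y l : R[i]) (K : R) :
  (forall t : R, 0 <= t -> t <= 1 ->
    cder g (x + t%:C%C * (y - x)) (g' (x + t%:C%C * (y - x))) /\
    normc (g' (x + t%:C%C * (y - x)) - l) <= K) ->
  normc (g y - g x - l * (y - x)) <= K * normc (y - x).
Proof.
move=> H; set D := g y - g x - _; pose u := conjc (dirc D).
pose p (t : R) : R[i] := x + t%:C%C * (y - x).
pose f t := u * (g (p t) + - l * p t).
have df (t : R) : 0 <= t -> t <= 1 -> dcurve f t (u * ((g' (p t) - l) * (y - x))).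
  move=> t0 t1; have [dg _] := H t t0 t1; have dp := dcurve_ray x (y - x) t.
  apply: dcurve_eq (dcurveZ u (dcurveD (dcurve_comp dg dp) (dcurveZ (- l) dp))) _.
  by rewrite mulNr -mulrBl.
have [t||c c01 E] := @MVT_segment R (fun t => Re (f t))
    (fun t => Re (u * ((g' (p t) - l) * (y - x)))) 0 1 ler01.
- by rewrite in_itv/= => /andP[/ltW t0 /ltW t1]; have [] := df t t0 t1.
- apply: continuous_in_subspaceT => t; rewrite inE/= in_itv/= => /andP[t0 t1].
  by have [dt _] := df t t0 t1; exact: is_derive_cvg dt.
have -> : normc D = Re (f 1) - Re (f 0).
  rewrite -[normc D]/(Re (normc D)%:C%C) -conj_dirM -/u -ReB; congr Re.
  by rewrite /f /p mul0r addr0 mul1r subrKC /D; ring.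
rewrite E subr0 mulr1; apply: le_trans (Re_le_normc _) _.
rewrite !normcM normc_conj normc_dir mul1r ler_wpM2r ?normc_ge0//.
by move: c01; rewrite in_itv/= => /andP[c0 c1]; have [] := H c c0 c1.
Qed.

Lemma disc_convex a (r : R) x y (t : R) : disc a r x -> disc a r y ->
  0 <= t -> t <= 1 -> disc a r (x + t%:C%C * (y - x)).
Proof.
rewrite /disc /= => hx hy t0 t1.
have -> : x + t%:C%C * (y - x) - a = (1 - t)%:C%C * (x - a) + t%:C%C * (y - a).
  by rewrite rmorphB rmorph1; ring.
apply: le_lt_trans (normcD _ _) _; rewrite !normcM !normc_real.
rewrite ger0_norm ?subr_ge0// ger0_norm//.
have [->|t00] := eqVneq t 0; first by rewrite subr0 mul1r mul0r addr0.
have tp : 0 < t by rewrite lt_def t00.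
have h1 : (1 - t) * normc (x - a) <= (1 - t) * r by rewrite ler_wpM2l ?subr_ge0// ltW.
have h2 : t * normc (y - a) < t * r by rewrite ltr_pM2l.
lra.
Qed.

Lemma cder_unique g z l m : cder g z l -> cder g z m -> l = m.
Proof.
move=> /cderP gl /cderP gm; apply/eqP; rewrite -subr_eq0 -normc_le0.
apply/ler_addgt0Pl => e e0; rewrite addr0.
have e2 : 0 < e / 2 by rewrite divr_gt0.
have [d d0 dP] : \forall w \near cnbhs z,
   normc (g w - g z - l * (w - z)) <= e / 2 * normc (w - z) /\
   normc (g w - g z - m * (w - z)) <= e / 2 * normc (w - z).
  by apply: filterS2 (gl _ e2) (gm _ e2).
pose w := z + (d / 2)%:C%C.
have wz : w - z = (d / 2)%:C%C by rewrite /w addrAC subrr add0r.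
have nw : normc (w - z) = d / 2 by rewrite wz normc_real gtr0_norm// divr_gt0.
have [|h1 h2] := dP w; first by rewrite nw ltr_pdivrMr// mulr_natr mulr2n ltrDl.
have : normc ((l - m) * (w - z)) <= e * normc (w - z).
  have -> : (l - m) * (w - z) = (g w - g z - m * (w - z)) - (g w - g z - l * (w - z)).
    by ring.
  by apply: le_trans (normcB _ _) _; rewrite (splitr e) mulrDl lerD.
by rewrite normcM ler_pM2r// nw divr_gt0.
Qed.

Lemma holo_lip a (r K : R) g g' : holo (disc a r) g g' ->
  (forall z, disc a r z -> normc (g' z) <= K) ->
  forall x y, disc a r x -> disc a r y -> normc (g y - g x) <= K * normc (y - x).
Proof.
move=> Hg gK x y hx hy.
have := @mean_value_ineq g g' x y 0 K; rewrite mul0r subr0; apply => t t0 t1.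
have h := disc_convex hx hy t0 t1.
by rewrite subr0; split; [have [] := Hg _ h|exact: gK].
Qed.

(** Cauchy's formula for the derivative, read as an operator that makes sense for every [g]. It is
    linear and bounded, which is what [holo_deriv] exploits. *)
Definition cdiffq (r : R) g z : R[i] :=
  (r^-1)%:C%C * cmean (fun t => g (z + r%:C%C * cis t) * conjc (cis t)).

Lemma cdiffqE (r s : R) g g' z : holo (disc z s) g g' -> 0 < r -> r < s ->
  g' z = cdiffq r g z.
Proof.
move=> Hg r0 rs; rewrite /cdiffq (mean_conj_cis Hg) ?r0// mulrA -rmorphM /=.
by rewrite mulVf ?gt_eqF// mul1r.
Qed.

Lemma normc_cdiffq (r e : R) g : 0 < r -> 
  ccurve (fun t => g (r%:C%C * cis t)) ->
  (forall t, normc (g (r%:C%C * cis t)) <= e) -> normc (cdiffq r g 0) <= e / r.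
Proof.
move=> r0 cg ge; rewrite /cdiffq normcM normc_real gtr0_norm ?invr_gt0//.
rewrite mulrC ler_pM2r ?invr_gt0//.
have c1 : ccurve (fun t => conjc (@cis R t)).
  by move=> t; apply: cto_conj; exact: ccurve_cis.
apply: normc_cmean_le => [t|t].
  under [X in cto _ X]eq_fun do rewrite add0r.
  by rewrite add0r; apply: ctoM; [exact: cg|exact: c1].
by rewrite add0r normcM normc_conj normc_cis mulr1.
Qed.

Lemma cdiffq_lin (r : R) g h c z w :
  ccurve (fun t => g (w + r%:C%C * cis t)) ->
  ccurve (fun t => h (z + r%:C%C * cis t)) ->
  cdiffq r g w + c * cdiffq r h z =
  cdiffq r (fun x => g (w + x) + c * h (z + x)) 0.
Proof.
move=> cg ch; rewrite /cdiffq mulrCA -mulrDr; congr (_ * _).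
have c1 : ccurve (fun t => conjc (@cis R t)).
  by move=> t; apply: cto_conj; exact: ccurve_cis.
have c2 : ccurve (fun t => g (w + r%:C%C * cis t) * conjc (cis t)).
  by move=> t; apply: ctoM; [exact: cg|exact: c1].
have c3 : ccurve (fun t => h (z + r%:C%C * cis t) * conjc (cis t)).
  by move=> t; apply: ctoM; [exact: ch|exact: c1].
have c4 : ccurve (fun t => c * (h (z + r%:C%C * cis t) * conjc (cis t))).
  by move=> t; apply: ctoM; [exact: cto_cst|exact: c3].
rewrite -cmeanZ// -cmeanD//; congr cmean; apply/funext => t.
by rewrite add0r mulrDl mulrA.
Qed.

(** Over circles of one fixed radius, Cauchy's formula writes [g'] as a mean of [g], so [g']
    inherits a Lipschitz bound from [g]. The same mean of [g'] is the candidate for its derivative: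
    the first-order error of [g'] is the mean of that of [g], which is quadratic because [g'] is
    Lipschitz. *)
Lemma holo_deriv (U : set R[i]) g g' : copen U -> holo U g g' ->
  exists g2, holo U g' g2.
Proof.
(* The local candidates depend on the radius of a circle; a pointwise choice glues them, by
   uniqueness of the derivative. *)
move=> oU Hg; pose g2 z := xget 0 [set l | cder g' z l].
suff loc a : U a -> exists2 h : R[i] -> R[i], ccont h a &
    \forall z \near cnbhs a, cder g' z (h z).
  exists g2 => a /loc[h ch dh].
  have g2h : \forall z \near cnbhs a, h z = g2 z.
    apply: filterS dh => z dz; apply: (cder_unique dz).
    exact: (@xgetI _ 0 [set l | cder g' z l] _ dz).
  have ha := cnbhs_singleton g2h; rewrite -ha; split.
    exact: cnbhs_singleton dh.
  by move=> e e0; apply: filterS2 g2h (ch e e0) => z <-.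
move=> Ua.
have [_ cg'] := Hg a Ua.
pose K := normc (g' a) + 1.
have K0 : 0 < K by rewrite ltr_wpDl// normc_ge0.
have [R0 R00 R0P] : \forall z \near cnbhs a, U z /\ normc (g' z) <= K.
  apply: filterS2 (oU a Ua) (cg' 1 ltr01) => z Uz h; split => //.
  have := lerB_normc (g' z) (g' a); rewrite /K; lra.
have H0 : holo (disc a R0) g g' by apply: holoS Hg => z /R0P[].
(* A third leaves room for discs of radius [2 * r] about all points of [disc a r], so that circles
   of radius [r] lie well inside. *)
pose r := R0 / 3; have r0 : 0 < r by rewrite divr_gt0.
have R3 : R0 = 3 * r by rewrite /r; field.
have sub1 z : disc a r z -> disc z (2 * r) `<=` disc a R0.
  by rewrite /disc /= => h; apply: sub_disc; rewrite R3; lra.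
pose L := K / r.
have cc s h h' z : holo (disc z s) h h' -> forall q : R, 0 < q -> q < s ->
    ccurve (fun t => h (z + q%:C%C * cis t)).
  move=> Hh q q0 qs; apply: (ccurve_on_circle Hh); by rewrite gtr0_norm.
have lip1 z w : disc a r z -> disc a r w -> normc (g' z - g' w) <= L * normc (z - w).
  move=> hz hw; have Hz := holoS (sub1 z hz) H0; have Hw := holoS (sub1 w hw) H0.
  have rr : r < 2 * r by lra.
  rewrite (cdiffqE Hz r0 rr) (cdiffqE Hw r0 rr) -mulN1r cdiffq_lin; last 2 first.
  - exact: cc Hz _ r0 rr.
  - exact: cc Hw _ r0 rr.
  rewrite /L mulrAC; apply: normc_cdiffq => //.
    move=> t; apply: ctoD; first exact: (cc _ _ _ _ Hz _ r0 rr).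
    by apply: ctoM; [exact: cto_cst|exact: (cc _ _ _ _ Hw _ r0 rr)].
  move=> t; rewrite mulN1r.
  have := holo_lip H0 (K := K); rewrite -[z - w](_ : (z + r%:C%C * cis t) -
    (w + r%:C%C * cis t) = _); last by ring.
  apply; first by move=> x /R0P[].
    by apply: (sub1 w hw); apply: disc_circle; rewrite gtr0_norm.
  by apply: (sub1 z hz); apply: disc_circle; rewrite gtr0_norm.
pose q := r / 3; have q0 : 0 < q by rewrite divr_gt0.
have r3 : r = 3 * q by rewrite /q; field.
have sub2 z : disc a q z -> disc z (2 * q) `<=` disc a r.
  by rewrite /disc /= => h; apply: sub_disc; rewrite r3; lra.
have sub3 : disc a r `<=` disc a R0.
  by apply: sub_disc; rewrite subrr normc0 R3; lra.
have qq : q < 2 * q by lra.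
have Hz z : disc a q z -> holo (disc z (2 * q)) g g'.
  by move=> hz; apply: holoS H0; apply: subset_trans (sub2 z hz) sub3.
have cg2 z : disc a q z -> ccurve (fun t => g' (z + q%:C%C * cis t)).
  move=> hz t; have qa : `|q| < 2 * q by rewrite gtr0_norm.
  have [_ c] := Hz z hz _ (disc_circle z t qa).
  exact: (cto_comp c (dcurve_cont (dcurve_circle z q t))).
have L0 : 0 < L by rewrite divr_gt0.
exists (cdiffq q g').
  move=> e e0; have eL : 0 < e / (L / q) by rewrite !divr_gt0.
  have ha := disc_center a q0.
  apply: filterS2 (copen_disc ha) (cnbhs_ball a eL) => z hz hza.
  rewrite -mulN1r cdiffq_lin; [|exact: cg2..].
  apply: (@le_lt_trans _ _ (L * normc (z - a) / q)); last first.
    by rewrite mulrAC mulrC -ltr_pdivlMr// divr_gt0.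
  apply: normc_cdiffq => //.
    by move=> t; apply: ctoD; [exact: cg2|apply: ctoM; [exact: cto_cst|exact: cg2]].
  move=> t; rewrite mulN1r.
  rewrite -[z - a](_ : (z + q%:C%C * cis t) - (a + q%:C%C * cis t) = _); last by ring.
  have qa : `|q| < 2 * q by rewrite gtr0_norm.
  by apply: lip1; [apply: (sub2 z hz)|apply: (sub2 a ha)]; exact: disc_circle.
have ha := disc_center a q0.
apply: filterS (copen_disc ha) => z hz.
apply/cderP => e e0; have eL : 0 < e / (L / q) by rewrite !divr_gt0.
apply: filterS2 (copen_disc hz) (cnbhs_ball z eL) => w hw hwz.
rewrite (cdiffqE (Hz w hw) q0 qq) (cdiffqE (Hz z hz) q0 qq).
have cg1 x : disc a q x -> ccurve (fun t => g (x + q%:C%C * cis t)).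
  by move=> hx; exact: cc (Hz x hx) _ q0 qq.
have c1 : ccurve (fun t => g (w + q%:C%C * cis t) + -1 * g (z + q%:C%C * cis t)).
  by move=> t; apply: ctoD; [exact: cg1|apply: ctoM; [exact: cto_cst|exact: cg1]].
rewrite -mulN1r cdiffq_lin; [|exact: cg1..].
rewrite mulrC -mulNr.
rewrite (@cdiffq_lin _ _ g' _ z 0); last 2 first.
- by under [X in ccurve X]eq_fun do rewrite add0r.
- exact: cg2.
apply: (@le_trans _ _ (L * normc (w - z) ^+ 2 / q)); last first.
  rewrite expr2 mulrA mulrAC ler_wpM2r ?normc_ge0//.
  by rewrite mulrAC mulrC -ler_pdivlMr ?ltW// divr_gt0.
apply: normc_cdiffq => //.
  move=> t; apply: ctoD; first by under [X in cto _ X]eq_fun do rewrite add0r;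
    rewrite add0r; exact: c1.
  by apply: ctoM; [exact: cto_cst|exact: cg2].
move=> t; rewrite add0r mulN1r.
have qa : `|q| < 2 * q by rewrite gtr0_norm.
set x := z + _; set y := w + _.
have yx : w - z = y - x by rewrite /x /y; ring.
have hx : disc a r x by apply: (sub2 z hz); exact: disc_circle.
have hy : disc a r y by apply: (sub2 w hw); exact: disc_circle.
rewrite yx mulNr [_ * g' x]mulrC expr2 mulrA.
apply: (@mean_value_ineq g g') => u u0 u1.
have hu := disc_convex hx hy u0 u1; split.
  by have [] := H0 _ (sub3 _ hu).
apply: le_trans (lip1 _ _ hu hx) _; rewrite ler_pM2l// addrAC subrr add0r.
by rewrite normcM normc_real ger0_norm// ler_piMl// normc_ge0.
Qed.

Lemma cmean_conj (f : R -> R[i]) : ccurve f -> cmean (fun t => conjc (f t)) = conjc (cmean f).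
Proof.
move=> cf; apply: eqcP => /=.
  by congr mean; apply/funext => t; case: (f t).
rewrite -meanN; last exact: ccurve_Im.
by congr mean; apply/funext => t; case: (f t).
Qed.

Lemma Re_complexE (w : R[i]) : (Re w)%:C%C = 2^-1 * (w + conjc w).
Proof.
have -> : 2^-1 = (2^-1 : R)%:C%C :> R[i] by rewrite fmorphV rmorph_nat.
by apply: eqcP; case: w => x y /=; field.
Qed.

(* Harnack-type estimate: the derivative of a nonnegative harmonic function [L],
   given through the holomorphic function [D] with [D = L_x - i L_y]. *)
Lemma gradient_estimate a (r : R) (L : R[i] -> R) (D D' : R[i] -> R[i]) : 0 < r ->
  holo (disc a r) D D' ->
  (forall z, disc a r z -> rder L z (Re (D z)) (- Im (D z))) ->
  (forall z, disc a r z -> 0 <= L z) -> r * normc (D a) <= 2 * L a.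
Proof.
move=> r0 HD dL L0; apply: le_of_lt_mul => // s s0 sr.
have dray u t : `|u| < r ->
    is_derive (u : R) 1 (fun u : R => L (a + u%:C%C * cis t))
      (Re (D (a + u%:C%C * cis t) * cis t)).
  move=> ur; rewrite ReM -mulNr.
  apply: (is_derive_rder (dL _ (disc_circle a t ur)) (dcurve_ray a (cis t) u)).
have cL u : `|u| < r -> continuous (fun t => L (a + u%:C%C * cis t)).
  move=> ur t.
  have := is_derive_rder (dL _ (disc_circle a t ur)) (dcurve_circle a u t).
  exact: is_derive_cvg.
have cD u : `|u| < r -> ccurve (fun t => D (a + u%:C%C * cis t)).
  by move=> ur; exact: (ccurve_on_circle HD ur).
have nr (u : R) : `|u| < r -> \forall u \near u, `|u| < r.
  move=> ur; exists (r - `|u|) => /=; first by rewrite subr_gt0.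
  move=> v /=; rewrite distrC ltrBrDr; apply: le_lt_trans.
  by rewrite -{1}(subrK u v) ler_normD.
have jD u t : `|u| < r -> cto (nbhs (u, t))
    (fun p : R * R => D (a + p.1%:C%C * cis p.2)) (D (a + u%:C%C * cis t)).
  move=> ur; have [dD _] := HD _ (disc_circle a t ur).
  exact: (cto_comp (cder_cont dD) (@cto_polar a u t)).
have jcis (u t : R) : cto (nbhs (u, t)) (fun p : R * R => cis p.2) (cis t).
  by apply: (@cto_cvg_comp _ _ _ (nbhs t) snd); [exact: cvg_snd|exact: ccurve_cis].
have zD n u : 0 <= u < r -> cmean (fun t => D (a + u%:C%C * cis t) * cis t ^+ n.+1) = 0.
  move=> /andP[]; rewrite le_eqVlt => /orP[/eqP <- _|u0 ur]; last first.
    by have := @mean_cisX _ _ _ _ HD n u; rewrite u0 ur; exact.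
  transitivity (cmean (fun t => D a * cis t ^+ n.+1)).
    by congr cmean; apply/funext => t; rewrite mul0r addr0.
  by rewrite cmeanZ ?cmean_cisX ?mulr0//; exact: ccurve_cisX.
have sI : 0 <= s < r by rewrite ltW.
have absI (u : R) : 0 <= u -> u <= s -> `|u| < r.
  by move=> u0 us; rewrite ger0_norm// (le_lt_trans us).
have nI (u : R) : 0 <= u -> u <= s -> 0 <= u < r.
  by move=> -> us; rewrite (le_lt_trans us).
have meanL : mean (fun t => L (a + s%:C%C * cis t)) = L a.
  pose Y u := mean (fun t => L (a + u%:C%C * cis t)).
  have dY (u : R) : 0 <= u -> u <= s -> is_derive u 1 Y 0.
    move=> u0 us; have ur := absI u u0 us.
    have <- : mean (fun t => Re (D (a + u%:C%C * cis t) * cis t)) = 0.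
      rewrite -[LHS]/(Re (cmean (fun t => D (a + u%:C%C * cis t) * cis t))).
      rewrite -[RHS]/(Re (0 : R[i])) -(zD 0 u (nI u u0 us)).
      by congr Re; congr cmean; apply/funext => t; rewrite expr1.
    apply: (@is_derive_mean _ (fun u t => L (a + u%:C%C * cis t))
      (fun u t => Re (D (a + u%:C%C * cis t) * cis t))).
    - by apply: filterS (nr u ur) => v vr t; exact: dray.
    - by apply: filterS (nr u ur) => v; exact: cL.
    - by move=> t; apply: cto_Re; apply: ctoM; [exact: jD|exact: jcis].
  have /complexI : (Y 0)%:C%C = (Y s)%:C%C.
    apply: (@dcurve_const_itv (fun u => (Y u)%:C%C) 0 s (ltW s0)) => u u0 us.
    by split => /=; [exact: dY|exact: is_derive_cst].
  move=> YE; rewrite -[LHS]/(Y s) -YE -[RHS]mean_cst; congr mean.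
  by apply/funext => t; rewrite mul0r addr0.
pose F u t := (L (a + u%:C%C * cis t))%:C%C * conjc (cis t).
pose F1 u t := (Re (D (a + u%:C%C * cis t) * cis t))%:C%C * conjc (cis t).
have ccj : ccurve (fun t : R => conjc (cis t)).
  by move=> t; apply: cto_conj; exact: ccurve_cis.
have cF u : `|u| < r -> ccurve (F u).
  by move=> ur t; apply: ctoM; [apply: cto_real; exact: (cL u ur)|exact: ccj].
(* With the real part written as half a sum of conjugates, the first term has mean [D a] by the mean
   value property, and the second is the conjugate of a positive Fourier coefficient, hence 0. This
   half is the source of the factor 2 in the conclusion. *)
have F1E u : 0 <= u < r -> cmean (F1 u) = 2^-1 * D a.
  move=> ur; have ur' : `|u| < r by move/andP: ur => [u0 ?]; rewrite ger0_norm.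
  have c1 : ccurve (fun t => D (a + u%:C%C * cis t) * cis t ^+ 2).
    by move=> t; apply: ctoM; [exact: cD|exact: ccurve_cisX].
  have c2 : ccurve (fun t => conjc (D (a + u%:C%C * cis t) * cis t ^+ 2)).
    by move=> t; apply: cto_conj; exact: c1.
  have -> : F1 u = (fun t => 2^-1 * (D (a + u%:C%C * cis t) +
      conjc (D (a + u%:C%C * cis t) * cis t ^+ 2))).
    apply/funext => t; rewrite /F1 Re_complexE -mulrA mulrDl; congr (_ * (_ + _)).
      by rewrite -mulrA [cis t * _]mulrC conj_cisM mulr1.
    by rewrite rmorphM rmorphM rmorphXn/= expr2 mulrA.
  rewrite cmeanZ; last by move=> t; apply: ctoD; [exact: (cD u ur')|exact: c2].
  rewrite cmeanD//; last exact: cD.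
  by rewrite cmean_conj// (zD 1 u ur) (mean_value HD ur) rmorph0 addr0.
have dX (u : R) : 0 <= u -> u <= s ->
    dcurve (fun u => cmean (F u) + (- (2^-1 * D a)) * u%:C%C) u 0.
  move=> u0 us; have ur := absI u u0 us.
  have dF : dcurve (fun u => cmean (F u)) u (cmean (F1 u)).
    apply: (@dcurve_cmean _ F F1).
    - apply: filterS (nr u ur) => v vr t.
      have dr := dray v t vr.
      have dLc : dcurve (fun u : R => (L (a + u%:C%C * cis t))%:C%C) v
          (Re (D (a + v%:C%C * cis t) * cis t))%:C%C.
        by split => //=; exact: is_derive_cst.
      apply: dcurve_eq (dcurveM dLc (dcurve_cst (conjc (cis t)) v)) _.
      by rewrite mulr0 addr0.
    - by apply: filterS (nr u ur) => v; exact: cF.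
    - move=> t; apply: ctoM; last exact: (cto_conj (jcis u t)).
      apply: cto_real; apply: cto_Re; apply: ctoM; [exact: jD|exact: jcis].
  apply: dcurve_eq (dcurveD dF (dcurveZ _ (dcurve_real u))) _.
  by rewrite F1E ?nI// mulr1 subrr.
have := dcurve_const_itv (ltW s0) dX; rewrite mulr0 addr0.
have -> : cmean (F 0) = 0.
  have -> : F 0 = (fun t => (L a)%:C%C * conjc (cis t)).
    by apply/funext => t; rewrite /F mul0r addr0.
  rewrite cmeanZ// cmean_conj; last exact: ccurve_cis.
  by rewrite cmean_cis rmorph0 mulr0.
move=> /esym/eqP; rewrite mulNr subr_eq0 => /eqP E.
have sr' : `|s| < r by rewrite gtr0_norm.
(* Nonnegativity of [L] enters here: its first Fourier coefficient is bounded by its mean, which is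
   [L a]. *)
have : normc (cmean (F s)) <= L a.
  apply: le_trans (normc_cmean (cF s sr')) _; rewrite -meanL.
  apply: le_mean; [exact: ccurve_normc (cF s sr')|exact: cL|].
  move=> t; rewrite /F normcM normc_conj normc_cis mulr1 normc_real ger0_norm//.
  exact/L0/disc_circle.
rewrite E !normcM normc_real gtr0_norm// normcV -(normr_nat R 2).
rewrite -[normc 2](_ : `|2| = _); last by rewrite -normc_real rmorph_nat.
rewrite normr_nat; lra.
Qed.

End Moments.

(** * Algebra of holomorphic functions *)

Section HoloAlgebra.
Context {R : realType}.
Implicit Types (g h : R[i] -> R[i]) (a z w c : R[i]) (U : set R[i]).

Lemma holo_cst U c : holo U (fun=> c) (fun=> 0).
Proof. by move=> z _; split; [exact: cder_cst|exact: cto_cst]. Qed.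

Lemma holo_id U : holo U id (fun=> 1).
Proof. by move=> z _; split; [exact: cder_id|exact: cto_cst]. Qed.

Lemma holoD U g g' h h' : holo U g g' -> holo U h h' ->
  holo U (fun z => g z + h z) (fun z => g' z + h' z).
Proof.
move=> Hg Hh z Uz; have [dg cg] := Hg z Uz; have [dh ch] := Hh z Uz.
by split; [exact: cderD|exact: ctoD].
Qed.

Lemma holoM U g g' h h' : holo U g g' -> holo U h h' ->
  holo U (fun z => g z * h z) (fun z => g' z * h z + g z * h' z).
Proof.
move=> Hg Hh z Uz; have [dg cg] := Hg z Uz; have [dh ch] := Hh z Uz.
split; first exact: cderM.
by apply: ctoD; apply: ctoM => //; [exact: cder_cont dh|exact: cder_cont dg].
Qed.

Lemma holoZ U c g g' : holo U g g' -> holo U (fun z => c * g z) (fun z => c * g' z).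
Proof.
move=> Hg z Uz; have [dg cg] := Hg z Uz; split; first exact: cderZ.
by apply: ctoM => //; exact: cto_cst.
Qed.

Lemma holoV U g g' : holo U g g' -> (forall z, U z -> g z != 0) ->
  holo U (fun z => (g z)^-1) (fun z => - g' z / g z ^+ 2).
Proof.
move=> Hg g0 z Uz; have [dg cg] := Hg z Uz; split; first by apply: cderV => //; exact: g0.
apply: ctoM; first exact: ctoN.
apply: ctoV; last by rewrite expf_eq0 g0.
by rewrite expr2; under [X in cto _ X]eq_fun do rewrite expr2; apply: ctoM; exact: cder_cont dg.
Qed.

Lemma holo_comp U V g g' h h' : holo V g g' -> holo U h h' ->
  (forall z, U z -> V (h z)) -> holo U (fun z => g (h z)) (fun z => g' (h z) * h' z).
Proof.
move=> Hg Hh hUV z Uz; have [dh ch] := Hh z Uz; have [dg cg] := Hg _ (hUV z Uz).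
split; first exact: cder_comp.
by apply: ctoM => //; exact: (cto_comp cg (cder_cont dh)).
Qed.

Lemma holo_sqrt U g g' s : copen U -> holo U g g' -> (forall z, U z -> g z != 0) ->
  (forall z, U z -> ccont s z /\ s z ^+ 2 = g z) ->
  holo U s (fun z => g' z / (2 * s z)).
Proof.
move=> oU Hg g0 Hs z Uz; have [dg cg] := Hg z Uz; have [cs sg] := Hs z Uz.
have s0 : s z != 0 by have := g0 z Uz; rewrite -sg expf_eq0.
split.
  by apply: (@cder_sqrt _ g) => //; apply: filterS (oU z Uz) => w /Hs[].
apply: ctoM => //; apply: ctoV; last by rewrite mulf_neq0// pnatr_eq0.
by apply: ctoM => //; exact: cto_cst.
Qed.

(* [gradient_estimate] for [1 - Re (conj u * g)], where [u] is the direction of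
   [g a]. *)
Lemma gradient_bound a (r : R) g g' : 0 < r -> holo (disc a r) g g' ->
  (forall z, disc a r z -> normc (g z) <= 1) ->
  r * normc (g' a) <= 2 * (1 - normc (g a)).
Proof.
move=> r0 Hg g1; have [g2 Hg2] := holo_deriv (@copen_disc R a r) Hg.
pose u := conjc (dirc (g a)).
have -> : normc (g a) = Re (u * g a) by rewrite conj_dirM.
have -> : normc (g' a) = normc (- u * g' a).
  by rewrite normcM normc_N normc_conj normc_dir mul1r.
apply: (gradient_estimate (L := fun z => 1 - Re (u * g z)) r0 (holoZ (- u) Hg2)).
  move=> z /Hg[dg _]; have := cder_Re (cderZ u dg).
  move=> /rderN/(rderD (rder_cst 1 z)).
  by rewrite !add0r mulNr ReN ImN.
move=> z /g1 gz; rewrite subr_ge0 (le_trans (Re_le_normc _))//.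
by rewrite normcM normc_conj normc_dir mul1r.
Qed.

Lemma rder_comp1 (w : R[i] -> R) (f : R -> R) z (a b l : R) :
  is_derive (w z) 1 f l -> rder w z a b -> rder (fun y => f (w y)) z (l * a) (l * b).
Proof.
move=> df dw; have cw := rder_cont dw; case: dw => [r [s [wrs ra sb]]].
pose q (x : R) := if x == w z then l else (f x - f (w z)) / (x - w z).
have qx x : f x - f (w z) = q x * (x - w z).
  rewrite /q; case: eqP => [->|/eqP xz]; first by rewrite !subrr mulr0.
  by rewrite mulfVK// subr_eq0.
have cq : q @ w z --> l.
  move/is_deriveP : df => df; apply/cvgrPdist_lt => e e0.
  move/cvgrPdist_lt : df => /(_ e e0) [d /= d0 dP].
  exists d => //= x; rewrite distrC => xd; rewrite /q; case: eqP => [_|/eqP xz].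
    by rewrite subrr normr0.
  have xd' : `|x - w z| < d by rewrite distrC.
  have := dP (x - w z); rewrite /= sub0r normrN subr_eq0 => /(_ xd' xz).
  by rewrite subrKC mulrC distrC.
exists (fun y => q (w y) * r y), (fun y => q (w y) * s y); split.
- by apply: filterS wrs => y e; rewrite qx e; ring.
- by apply: cvgM => //; exact: (cvg_comp _ _ cw cq).
- by apply: cvgM => //; exact: (cvg_comp _ _ cw cq).
Qed.

(** The logarithm is taken of the squared modulus, a polynomial in the real and imaginary parts, and
    halved. The gradient is that of the real part of a local logarithm of [g], which need not be
    constructed. *)
Lemma rder_ln_normc g z l : cder g z l -> g z != 0 ->
  rder (fun y => ln (normc (g y))) z (Re (l / g z)) (- Im (l / g z)).
Proof.
move=> dg g0; have ng : 0 < normc (g z) by rewrite normc_gt0.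
have dr := cder_Re dg; have di := cder_Im dg.
have dsq := rderD (rderM dr dr) (rderM di di).
have dln : is_derive (normc (g z) ^+ 2) 1 (@ln R) (normc (g z) ^+ 2)^-1.
  by apply: is_derive1_ln; rewrite exprn_gt0.
have E y : Re (g y) * Re (g y) + Im (g y) * Im (g y) = normc (g y) ^+ 2.
  by rewrite normc_sqr !expr2.
have nearE : \forall y \near cnbhs z,
    2^-1 * ln (Re (g y) * Re (g y) + Im (g y) * Im (g y)) = ln (normc (g y)).
  have cg := cder_cont dg.
  apply: filterS (cto_neq0 cg g0) => y gy; rewrite E.
  have gy0 : 0 < normc (g y) by rewrite (le_lt_trans _ gy)// divr_ge0// ltW.
  by rewrite lnXn// -[ln _ *+ 2]mulr_natl mulrA mulVf ?mul1r// pnatr_eq0.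
apply: rder_near nearE _.
have := @rder_comp1 (fun y => Re (g y) * Re (g y) + Im (g y) * Im (g y)) (@ln R) z
   _ _ (normc (g z) ^+ 2)^-1 _ dsq.
rewrite E => /(_ dln)/(rderZ 2^-1).
have n2 : normc (g z) ^+ 2 != 0 by rewrite expf_eq0 gt_eqF.
have -> : l / g z = l * conjc (g z) * ((normc (g z) ^+ 2)^-1)%:C%C.
  apply: (mulIf g0); rewrite divfK// -!mulrA [_ * g z]mulrC (mulrA (conjc _)).
  by rewrite [conjc _ * _]mulrC mulc_conj -rmorphM/= divff// mulr1.
move: n2; case: (g z) => x y; case: l {dr di dsq dln dg} => p q; move: (normc _ ^+ 2) => n n0 /=.
by congr rder; field.
Qed.

End HoloAlgebra.

(** * Harnack's inequality, open mapping, uniform Taylor bounds *)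

Section Hurwitz.
Context {R : realType}.
Implicit Types (g h : R[i] -> R[i]) (a z w c : R[i]).

(** [L = - ln |h|] is harmonic and nonnegative. The gradient estimate on discs of radius [r / 2]
    gives |f'| <= 2 f for its restriction [f] to the segment from [a] to [z], so
    [f t * expR (2 * t)] is nondecreasing; this is where [expR (- 2)] comes from. *)
Lemma harnack_ln a (r : R) h h' : 0 < r -> holo (disc a r) h h' ->
  (forall z, disc a r z -> h z != 0 /\ normc (h z) < 1) ->
  forall z, disc a (r / 2) z ->
  ln (normc (h z)) <= expR (- 2) * ln (normc (h a)).
Proof.
move=> r0 Hh hP z hz.
have oD : copen (disc a r) by exact: copen_disc.
have [h2 Hh2] := holo_deriv oD Hh.
have h0 y : disc a r y -> h y != 0 by move=> /hP[].
have HD := holoZ (-1) (holoM Hh2 (holoV Hh h0)).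
pose L y := - ln (normc (h y)).
have dL y : disc a r y -> rder L y (Re (-1 * (h' y * (h y)^-1)))
    (- Im (-1 * (h' y * (h y)^-1))).
  move=> hy; have [dh _] := Hh y hy.
  by have := rderN (rder_ln_normc dh (h0 y hy)); rewrite mulN1r ReN ImN.
have L0 y : disc a r y -> 0 <= L y.
  move=> /hP[hy0 hy1]; rewrite oppr_ge0 -ln1 ler_ln ?posrE ?normc_gt0//.
  exact: ltW.
have r2 : 0 < r / 2 by rewrite divr_gt0.
have ha : disc a (r / 2) a by exact: disc_center.
have sub y : disc a (r / 2) y -> disc y (r / 2) `<=` disc a r.
  by rewrite /disc /= => hy; apply: sub_disc; lra.
have est y : disc a (r / 2) y ->
    r / 2 * normc (-1 * (h' y * (h y)^-1)) <= 2 * L y.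
  move=> hy.
  apply: (gradient_estimate r2 (holoS (sub y hy) HD)) => x /(sub y hy).
    exact: dL.
  exact: L0.
pose f (t : R) := L (a + t%:C%C * (z - a)).
pose f' (t : R) := Re (-1 * (h' (a + t%:C%C * (z - a)) * (h (a + t%:C%C * (z - a)))^-1) * (z - a)).
have seg t : 0 <= t -> t <= 1 -> disc a (r / 2) (a + t%:C%C * (z - a)).
  exact: disc_convex.
have sub2 y : disc a (r / 2) y -> disc a r y.
  move=> hy; apply: (sub y hy); exact: disc_center.
have df (t : R) : 0 <= t -> t <= 1 -> is_derive t 1 f (f' t).
  move=> t0 t1; rewrite /f' ReM -mulNr.
  exact: (is_derive_rder (dL _ (sub2 _ (seg t t0 t1))) (dcurve_ray a (z - a) t)).
have df2 (t : R) : 0 <= t -> t <= 1 ->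
    is_derive t 1 (fun t => f t * expR (2 * t)) ((f' t + 2 * f t) * expR (2 * t)).
  move=> t0 t1; have dft := df t t0 t1.
  apply: is_derive_eq; rewrite /GRing.scale/=; ring.
have [t||c c01 E] := @MVT_segment R (fun t => f t * expR (2 * t))
    (fun t => (f' t + 2 * f t) * expR (2 * t)) 0 1 ler01.
- by rewrite in_itv/= => /andP[/ltW t0 /ltW t1]; exact: df2.
- apply: continuous_in_subspaceT => t; rewrite inE/= in_itv/= => /andP[t0 t1].
  exact: is_derive_cvg (df2 t t0 t1).
move: c01; rewrite in_itv/= => /andP[c0 c1].
have nn : 0 <= (f' c + 2 * f c) * expR (2 * c).
  rewrite mulr_ge0 ?expR_ge0//.
  have e1 := est _ (seg c c0 c1).
  have e2 := normr_Re_le (-1 * (h' (a + c%:C%C * (z - a)) * (h (a + c%:C%C * (z - a)))^-1) * (z - a)).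
  move: e2; rewrite -/(f' c) normcM => e2.
  have e3 : normc (z - a) <= r / 2 by exact: ltW.
  have : `|f' c| <= 2 * f c.
    apply: le_trans e2 _; apply: le_trans e1.
    by rewrite mulrC; apply: ler_wpM2r => //; exact: normc_ge0.
  rewrite ler_norml; lra.
move: E; rewrite subr0 !mulr1 mulr0 expR0 mulr1 => E.
have : f 0 <= f 1 * expR 2 by rewrite -subr_ge0 E.
rewrite /f mul0r addr0 mul1r subrKC /L => le1.
rewrite -(ler_pM2l (expR_gt0 2)) mulrA -expRD subrr expR0 mul1r; lra.
Qed.

(* The modulus of smallness [d] does not depend on [h]. *)
Lemma hurwitz_unif (e : R) : 0 < e -> exists2 d : R, 0 < d &
  forall a (r : R) h h', 0 < r -> holo (disc a r) h h' ->
  (forall z, disc a r z -> h z != 0 /\ normc (h z) < 1) ->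
  normc (h a) < d -> forall z, disc a (r / 2) z -> normc (h z) < e.
Proof.
(* Chosen so that [expR (- 2) * ln d = ln e], against the Harnack constant. *)
move=> e0; exists (expR (expR 2 * ln e)); first exact: expR_gt0.
move=> a r h h' r0 Hh hP had z hz.
have za : disc a r z by apply: lt_trans hz _; rewrite ltr_pdivrMr// mulr_natr mulr2n ltrDl.
have [hz0 _] := hP z za; have [ha0 _] := hP a (disc_center a r0).
have le1 := harnack_ln r0 Hh hP hz.
rewrite -ltr_ln ?posrE ?normc_gt0//; apply: le_lt_trans le1 _.
have : ln (normc (h a)) < expR 2 * ln e.
  by rewrite -[ltRHS]expRK ltr_ln// ?posrE ?normc_gt0 ?expR_gt0.
rewrite -(ltr_pM2l (expR_gt0 (-2))) mulrA -expRD addNr expR0 mul1r.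
by rewrite mulrC.
Qed.

(** If [w] is omitted, 1 / (g - w) is holomorphic and its value at [a] is a mean over a circle.
    Since [g' a != 0], [g] stays at distance at least [m] from [g a] on that circle, so a [w] closer
    than [m / 2] to [g a] would violate the mean bound. *)
Lemma open_mapping a (r : R) g g' : 0 < r -> holo (disc a r) g g' -> g' a != 0 ->
  exists2 d : R, 0 < d & forall w, normc (w - g a) < d ->
  exists2 z, disc a r z & g z = w.
Proof.
move=> r0 Hg ga0; have [dg _] := Hg a (disc_center a r0).
have n0 : 0 < normc (g' a) / 2 by rewrite divr_gt0// normc_gt0.
move/cderP : dg => /(_ _ n0) [d1 d10 d1P].
pose p := Num.min r d1 / 2.
have m0 : 0 < Num.min r d1 by rewrite lt_min r0.
have p0 : 0 < p by rewrite divr_gt0.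
have pm : p < Num.min r d1 by rewrite ltr_pdivrMr// mulr_natr mulr2n ltrDl.
have /andP[pr pd] : (p < r) && (p < d1) by rewrite -lt_min.
have pr' : `|p| < r by rewrite gtr0_norm.
pose m := normc (g' a) / 2 * p; have mm0 : 0 < m by rewrite mulr_gt0.
exists (m / 2); first by rewrite divr_gt0.
move=> w wg; apply: contrapT => H.
have gw z : disc a r z -> g z - w != 0.
  by move=> zr; rewrite subr_eq0; apply/eqP => E; apply: H; exists z.
have HV := holoV (holoD Hg (holo_cst (- w))) gw.
have := mean_value HV (s := p); rewrite ltW// => /(_ pr) E.
have circ t : m / 2 <= normc (g (a + p%:C%C * cis t) - w).
  set z := a + _.
  have za : normc (z - a) = p.
    by rewrite /z addrAC subrr add0r normcM normc_real normc_cis mulr1 gtr0_norm.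
  have := d1P z; rewrite za => /(_ pd) h1.
  have h2 : normc (g' a * (z - a)) = normc (g' a) * p by rewrite normcM za.
  have h3 := lerB_normc (g' a * (z - a)) (g' a * (z - a) - (g z - g a)).
  have h4 := normc_distC (g' a * (z - a)) (g z - g a).
  have h5 := lerB_normc (g z - g a) (w - g a).
  have h6 : g' a * (z - a) - (g' a * (z - a) - (g z - g a)) = g z - g a by ring.
  have h7 : g z - g a - (w - g a) = g z - w by ring.
  have mE : normc (g' a) * p = 2 * m by rewrite /m; field.
  rewrite h6 h2 h4 mE in h3; rewrite h7 in h5; rewrite -/m in h1.
  lra.
have c1 : ccurve (fun t => (g (a + p%:C%C * cis t) - w)^-1).
  exact: (ccurve_on_circle HV pr').
have : normc (g a - w)^-1 <= (m / 2)^-1.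
  rewrite -E; apply: normc_cmean_le => // t.
  have m2 : 0 < m / 2 by rewrite divr_gt0.
  have ct := lt_le_trans m2 (circ t).
  by rewrite normcV lef_pV2 ?posrE.
have ga : 0 < normc (g a - w) by rewrite normc_gt0 gw//; exact: disc_center.
rewrite normcV lef_pV2 ?posrE ?divr_gt0// normc_distC => le2.
by have := lt_le_trans wg le2; rewrite ltxx.
Qed.

(** The constants depend on [r] alone, so that the bounds survive pointwise limits. Each Cauchy
    estimate is taken on discs of radius [r / 3]: one gives [3 / r], two give [9 / r ^+ 2]. *)
Lemma second_order a (r : R) g g' : 0 < r -> holo (disc a r) g g' ->
  (forall z, disc a r z -> normc (g z) <= 1) ->
  (forall z, disc a (r / 3) z -> normc (g' z) <= 3 / r) /\
  (forall z w, disc a (r / 3) z -> disc a (r / 3) w ->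
    normc (g' w - g' z) <= 9 / r ^+ 2 * normc (w - z) /\
    normc (g w - g z - g' z * (w - z)) <= 9 / r ^+ 2 * normc (w - z) ^+ 2).
Proof.
move=> r0 Hg g1; have [g2 Hg2] := holo_deriv (@copen_disc R a r) Hg.
have r3 : 0 < r / 3 by rewrite divr_gt0.
have b1 z : disc a (2 * (r / 3)) z -> normc (g' z) <= 3 / r.
  rewrite /disc /= => hz.
  have sub : disc z (r / 3) `<=` disc a r by apply: sub_disc; lra.
  have := cauchy_estimate (K := 1) (holoS sub Hg) r3 (fun y hy => g1 y (sub y hy)).
  by rewrite -ler_pdivlMl// mulr1 invf_div.
have b2 z : disc a (r / 3) z -> normc (g2 z) <= 9 / r ^+ 2.
  rewrite /disc /= => hz.
  have sub : disc z (r / 3) `<=` disc a (2 * (r / 3)) by apply: sub_disc; lra.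
  have sub' : disc z (r / 3) `<=` disc a r by apply: sub_disc; lra.
  have := cauchy_estimate (holoS sub' Hg2) r3 (fun y hy => b1 y (sub y hy)).
  rewrite -ler_pdivlMl// invf_div => /le_trans; apply.
  by rewrite expr2 invfM !mulrA; lra.
have sub3 : disc a (r / 3) `<=` disc a r.
  by apply: sub_disc; rewrite subrr normc0; lra.
have K0 : 0 <= 9 / r ^+ 2 by rewrite divr_ge0// sqr_ge0.
split.
  by move=> z hz; apply: b1; rewrite /disc /=; apply: lt_trans hz _; lra.
move=> z w hz hw.
have lip x : disc a (r / 3) x -> normc (g' x - g' z) <= 9 / r ^+ 2 * normc (x - z).
  by move=> hx; exact: (holo_lip (holoS sub3 Hg2) b2 hz hx).
split; first exact: lip.
rewrite expr2 mulrA; apply: (@mean_value_ineq _ g g') => t t0 t1.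
have ht := disc_convex hz hw t0 t1; split; first by have [] := Hg _ (sub3 _ ht).
apply: le_trans (lip _ ht) _; rewrite ler_wpM2l// addrAC subrr add0r.
by rewrite normcM normc_real ger0_norm// ler_piMl// normc_ge0.
Qed.

End Hurwitz.

(** * The Riemann mapping theorem *)

Section Mobius.
Context {R : realType}.
Implicit Types c z w : R[i].

Definition mobius c z := (z - c) / (1 - conjc c * z).
Definition dmobius c z : R[i] := (1 - normc c ^+ 2)%:C%C / (1 - conjc c * z) ^+ 2.

Lemma normc_mobius_aux c z : normc (1 - conjc c * z) ^+ 2 - normc (z - c) ^+ 2 =
  (1 - normc c ^+ 2) * (1 - normc z ^+ 2).
Proof. by rewrite !normc_sqr; case: c => a b; case: z => x y /=; ring. Qed.

Lemma one_minus_sqr_gt0 c : normc c < 1 -> 0 < 1 - normc c ^+ 2.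
Proof. by move=> c1; rewrite subr_gt0 expr_lt1// normc_ge0. Qed.

Lemma mobius_den c z : normc c < 1 -> normc z < 1 -> 1 - conjc c * z != 0.
Proof.
move=> c1 z1; apply/eqP => E.
have := normc_mobius_aux c z; rewrite E normc0 expr0n/= sub0r => H.
have := mulr_gt0 (one_minus_sqr_gt0 c1) (one_minus_sqr_gt0 z1).
by rewrite -H oppr_gt0 ltNge sqr_ge0.
Qed.

Lemma normc_mobius c z : normc c < 1 -> normc z < 1 -> normc (mobius c z) < 1.
Proof.
move=> c1 z1; have d0 := mobius_den c1 z1.
rewrite /mobius normcM normcV ltr_pdivrMr ?normc_gt0// mul1r.
rewrite -(@ltr_pXn2r _ 2) ?nnegrE ?normc_ge0// -subr_gt0 normc_mobius_aux.
by rewrite mulr_gt0 ?one_minus_sqr_gt0.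
Qed.

Lemma mobius_inj c z w : normc c < 1 -> normc z < 1 -> normc w < 1 ->
  mobius c z = mobius c w -> z = w.
Proof.
move=> c1 z1 w1 /eqP; rewrite /mobius eqr_div ?mobius_den// => /eqP E.
have : (z - w) * (1 - c * conjc c) = 0.
  transitivity ((z - c) * (1 - conjc c * w) - (w - c) * (1 - conjc c * z)); first by ring.
  by rewrite E subrr.
rewrite mulc_conj => /eqP; rewrite mulf_eq0 => /orP[|].
  by rewrite subr_eq0 => /eqP.
have := one_minus_sqr_gt0 c1; rewrite -(rmorph1 (real_complex R)) -rmorphB/=.
by rewrite eq_complex/= => /gt_eqF ->.
Qed.

Lemma normc_dmobius c z : normc c < 1 ->
  normc (dmobius c z) = (1 - normc c ^+ 2) / normc (1 - conjc c * z) ^+ 2.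
Proof.
move=> c1; rewrite normcM normcV normcX normc_real gtr0_norm//.
exact: one_minus_sqr_gt0.
Qed.

Lemma normc_nat n : normc (n%:R : R[i]) = n%:R.
Proof. by rewrite -(rmorph_nat (real_complex R)) normc_real normr_nat. Qed.

Lemma mobius0 c : mobius c c = 0.
Proof. by rewrite /mobius subrr mul0r. Qed.

Lemma mobius_eq0 c z : normc c < 1 -> normc z < 1 -> mobius c z = 0 -> z = c.
Proof. by move=> c1 z1; rewrite -(mobius0 c); exact: mobius_inj. Qed.

Lemma dmobius_neq0 c z : normc c < 1 -> normc z < 1 -> dmobius c z != 0.
Proof.
move=> c1 z1; rewrite /dmobius mulf_neq0// ?invr_eq0 ?expf_eq0 ?mobius_den//.
by rewrite eq_complex/= gt_eqF// one_minus_sqr_gt0.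
Qed.

Lemma holo_mobius c : normc c < 1 -> holo (disc 0 1) (mobius c) (dmobius c).
Proof.
move=> c1.
have den z : disc 0 1 z -> 1 + (- conjc c) * z != 0.
  by rewrite /disc /= subr0 mulNr => z1; rewrite mobius_den.
have H1 := holoD (@holo_id R (disc 0 1)) (holo_cst (- c)).
have H2 := holoV (holoD (holo_cst (U := disc 0 1) 1) (holoZ (- conjc c) (@holo_id R (disc 0 1)))) den.
have H := holoM H1 H2.
have E1 : (fun z => (id z - c) * (1 + - conjc c * id z)^-1) = mobius c.
  by apply/funext => z; rewrite /mobius mulNr.
have E2 z : disc 0 1 z -> (1 + 0) * (1 + - conjc c * id z)^-1 +
    (id z - c) * (- (0 + - conjc c * 1) / (1 + - conjc c * id z) ^+ 2) = dmobius c z.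
  move=> /den d0; rewrite /dmobius.
  have -> : (1 - normc c ^+ 2)%:C%C = 1 - c * conjc c.
    by rewrite mulc_conj rmorphB rmorph1.
  by field; move: d0; rewrite mulNr.
move=> z hz; have [dz cz] := H z hz; rewrite -E1 -E2//; split => //.
move=> e e0; apply: filterS2 (copen_disc hz) (cz e e0) => w hw.
by rewrite -(E2 w hw).
Qed.

End Mobius.

(** * Limits along an ultrafilter *)

Section UltraLimits.
Context {R : realType} (F : set_system nat) {FU : UltraFilter F}.

(** Compactness gives a cluster point, and a cluster point of an ultrafilter is a limit. *)
Lemma ultra_cvg_real (x : nat -> R) (K : R) : (forall n, `|x n| <= K) ->
  exists l : R, x @ F --> l.
Proof.
move=> xK.
have xF : (x @ F) `[- K, K]%classic.
  apply: (@filterE _ F) => n; have := xK n.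
  by rewrite /preimage /= in_itv/= -ler_norml.
have FP : ProperFilter F by exact: ultra_proper.
have [l [_ xl]] := @segment_compact R (- K) K (x @ F) _ xF.
exists l => B lB; have [//|FB] := in_ultra_setVsetC (x @^-1` B) FU.
have [y [/= By By']] := xl (~` B) B FB lB.
by case: By.
Qed.

Lemma ultra_cto (x : nat -> R[i]) (K : R) : (forall n, normc (x n) <= K) ->
  exists l, cto F x l.
Proof.
move=> xK.
have [a xa] := ultra_cvg_real (fun n => le_trans (normr_Re_le (x n)) (xK n)).
have [b xb] := ultra_cvg_real (fun n => le_trans (normr_Im_le (x n)) (xK n)).
by exists (a +i* b)%C; exact: cto_ReIm.
Qed.

End UltraLimits.

Lemma cto_le {R : realType} {T} (F : set_system T) {FF : ProperFilter F}
    (x : T -> R[i]) (l : R[i]) (K : R) :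
  cto F x l -> (forall n, normc (x n) <= K) -> normc l <= K.
Proof.
move=> xl xK; apply/ler_addgt0Pl => e e0.
have [n hn] := filter_ex (xl e e0).
have := lerB_normc l (x n); have := xK n; rewrite normc_distC in hn; lra.
Qed.

Section RiemannMapping.
Context {R : realType} (V : set R[i]) (p : R[i]).

(** The competitors in the extremal problem for [normc (g' p)]. That [g'] has no zero is carried
    along with injectivity, and both are shown to survive the square-root construction and
    limits. *)
Definition schlicht (g g' : R[i] -> R[i]) := [/\ holo V g g',
  forall z, V z -> normc (g z) < 1, g p = 0,
  forall z w, V z -> V w -> g z = g w -> z = w & forall z, V z -> g' z != 0].

Hypothesis oV : copen V.
Hypothesis Vp : V p.
Hypothesis sqrtV : forall h h', holo V h h' -> (forall z, V z -> h z != 0) ->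
  exists s, forall z, V z -> ccont s z /\ s z ^+ 2 = h z.

(** Moving the omitted value to 0 makes the function zero-free, so it has a square root, which is
    then renormalised at [p]. With [b] the value of the root at [p], the derivative grows by the
    factor (1 + |b|^2) / (2 |b|), which exceeds 1 because 0 < |b| < 1. *)
Lemma koebe g g' w0 : schlicht g g' -> normc w0 < 1 ->
  (forall z, V z -> g z <> w0) ->
  exists k k', schlicht k k' /\ normc (g' p) < normc (k' p).
Proof.
move=> [Hg g1 gp ginj g'0] w1 gw.
have disc01 z : normc z < 1 -> disc 0 1 z by rewrite /disc /= subr0.
pose h z := mobius w0 (g z).
have Hh : holo V h (fun z => dmobius w0 (g z) * g' z).
  by apply: (holo_comp (holo_mobius w1) Hg) => z /g1/disc01.
have h0 z : V z -> h z != 0.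
  by move=> Vz; apply/eqP => /(mobius_eq0 w1 (g1 z Vz)); exact: gw.
have [s Hs] := sqrtV Hh h0.
have Ds := holo_sqrt oV Hh h0 Hs.
have s1 z : V z -> normc (s z) < 1.
  move=> Vz; have [_ sh] := Hs z Vz.
  rewrite -(@expr_lt1 _ 2)// ?normc_ge0// -normcX sh.
  by apply: normc_mobius => //; exact: g1.
have s0 z : V z -> s z != 0.
  by move=> Vz; have [_ sh] := Hs z Vz; have := h0 z Vz; rewrite -sh expf_eq0.
have s'0 z : V z -> dmobius w0 (g z) * g' z / (2 * s z) != 0.
  move=> Vz; rewrite mulf_neq0//; first by rewrite mulf_neq0 ?g'0 ?dmobius_neq0 ?g1.
  by rewrite invr_eq0 mulf_neq0 ?s0// pnatr_eq0.
pose b := s p; have b1 : normc b < 1 by exact: s1.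
exists (fun z => mobius b (s z)),
  (fun z => dmobius b (s z) * (dmobius w0 (g z) * g' z / (2 * s z))).
split; first split.
- by apply: (holo_comp (holo_mobius b1) Ds) => z /s1/disc01.
- by move=> z Vz; apply: normc_mobius => //; exact: s1.
- exact: mobius0.
- move=> z w Vz Vw /(mobius_inj b1 (s1 z Vz) (s1 w Vw)) E; apply: ginj => //.
  apply: (mobius_inj w1 (g1 z Vz) (g1 w Vw)).
  by rewrite -[LHS]/(h z) -[RHS]/(h w); have [_ <-] := Hs z Vz; have [_ <-] := Hs w Vw; rewrite E.
- by move=> z Vz; rewrite mulf_neq0 ?s'0// dmobius_neq0 ?s1.
(* As [g p = 0], [b] is a square root of [mobius w0 0 = - w0]. *)
have tt : normc b ^+ 2 = normc w0.
  rewrite -normcX /b; have [_ ->] := Hs p Vp.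
  by rewrite /h gp /mobius sub0r mulr0 subr0 divr1 normc_N.
have b0 : 0 < normc b by rewrite normc_gt0 s0.
have g'p : 0 < normc (g' p) by rewrite normc_gt0 g'0.
rewrite (normcM (dmobius b (s p))) (normcM (_ * g' p)) normcV (normcM 2).
rewrite (normcM (dmobius w0 _)) !normc_dmobius ?gp// -/b mulr0 subr0 normc1.
rewrite expr1n divr1 mulrC [conjc b * b]mulrC mulc_conj.
have -> : 1 - (normc b ^+ 2)%:C%C = (1 - normc b ^+ 2)%:C%C :> R[i].
  by rewrite rmorphB rmorph1.
have bb := one_minus_sqr_gt0 b1.
rewrite normc_real gtr0_norm// normc_nat -tt.
have -> : (1 - (normc b ^+ 2) ^+ 2) * normc (g' p) / (2 * normc b) *
   ((1 - normc b ^+ 2) / (1 - normc b ^+ 2) ^+ 2) =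
   normc (g' p) * ((1 + normc b ^+ 2) / (2 * normc b)).
  by field; rewrite !gt_eqF.
rewrite ltr_pMr// ltr_pdivlMr ?mulr_gt0// mul1r -subr_gt0.
have -> : 1 + normc b ^+ 2 - 2 * normc b = (1 - normc b) ^+ 2 by ring.
by rewrite exprn_gt0// subr_gt0.
Qed.

(* Montel's theorem is replaced by the pointwise limit along an ultrafilter: the
   Cauchy estimates pass to that limit and give its holomorphy. *)
Lemma schlicht_limit (G G' : nat -> R[i] -> R[i]) (S : R) :
  (forall Z : set R[i], (forall z, V z -> Z z -> cnbhs z Z) ->
    (forall z, V z -> ~ Z z -> cnbhs z (~` Z)) -> Z p -> forall z, V z -> Z z) ->
  (forall n, schlicht (G n) (G' n)) -> 0 < S ->
  (forall n, S - n.+1%:R^-1 < normc (G' n p)) ->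
  exists g g', schlicht g g' /\ S <= normc (g' p).
Proof.
move=> conV HG S0 HS.
have [F [FU oF]] := ultraFilterLemma (@eventually_filter).
have FP : ProperFilter F by exact: ultra_proper.
have HGn n : holo V (G n) (G' n) by have [] := HG n.
have radius a : V a -> exists2 r : R, 0 < r & disc a r `<=` V.
  by move=> /oV[r r0 rV]; exists r.
have Gn1 n z : V z -> normc (G n z) <= 1.
  by move=> Vz; have [_ G1 _ _ _] := HG n; rewrite ltW ?G1.
have so a r n : 0 < r -> disc a r `<=` V -> _ :=
  fun r0 rV => second_order r0 (holoS rV (HGn n)) (fun z hz => Gn1 n z (rV z hz)).
have limG z : V z -> exists l, cto F (fun n => G n z) l.
  by move=> Vz; apply: (@ultra_cto _ _ FU _ 1) => n; exact: Gn1.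
have limG' z : V z -> exists l, cto F (fun n => G' n z) l.
  move=> Vz; have [r r0 rV] := radius z Vz.
  apply: (@ultra_cto _ _ FU _ (3 / r)) => n.
  have [+ _] := so z r n r0 rV; apply; apply: disc_center; exact: divr_gt0.
pose g z := xget 0 [set l | cto F (fun n => G n z) l].
pose g' z := xget 0 [set l | cto F (fun n => G' n z) l].
have gE z : V z -> cto F (fun n => G n z) (g z).
  by move=> /limG[l hl]; exact: (@xgetI _ 0 [set l | cto F (fun n => G n z) l] l).
have g'E z : V z -> cto F (fun n => G' n z) (g' z).
  by move=> /limG'[l hl]; exact: (@xgetI _ 0 [set l | cto F (fun n => G' n z) l] l).
have sog a r : 0 < r -> disc a r `<=` V -> forall z, disc a (r / 3) z ->
    normc (g' z - g' a) <= 9 / r ^+ 2 * normc (z - a) /\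
    normc (g z - g a - g' a * (z - a)) <= 9 / r ^+ 2 * normc (z - a) ^+ 2.
  move=> r0 rV z hz; have r3 : 0 < r / 3 by rewrite divr_gt0.
  have ha := disc_center a r3; have Va := rV a (disc_center a r0).
  have Vz : V z by apply: rV; apply: lt_trans hz _; lra.
  split.
    have H : cto F (fun n => G' n z - G' n a) (g' z - g' a).
      by apply: ctoD; [exact: g'E|apply: ctoN; exact: g'E].
    apply: (cto_le H) => n; have [_ +] := so a r n r0 rV.
    by move=> /(_ a z ha hz)[].
  have H : cto F (fun n => G n z - G n a - G' n a * (z - a)) (g z - g a - g' a * (z - a)).
    apply: ctoD; first by apply: ctoD; [exact: gE|apply: ctoN; exact: gE].
    by apply: ctoN; apply: ctoM; [exact: g'E|exact: cto_cst].
  apply: (cto_le H) => n; have [_ +] := so a r n r0 rV.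
  by move=> /(_ a z ha hz)[].
have Hg : holo V g g'.
  move=> a Va; have [r r0 rV] := radius a Va; have r3 : 0 < r / 3 by rewrite divr_gt0.
  have K0 : 0 < 9 / r ^+ 2 by rewrite divr_gt0// exprn_gt0.
  split.
    apply/cderP => e e0; have eK : 0 < e / (9 / r ^+ 2) by rewrite divr_gt0.
    apply: filterS2 (cnbhs_ball a r3) (cnbhs_ball a eK) => z hz hze.
    have [_ /le_trans] := sog a r r0 rV z hz; apply.
    rewrite expr2 mulrA ler_wpM2r ?normc_ge0//.
    by rewrite mulrC -ler_pdivlMr// ltW.
  move=> e e0; have eK : 0 < e / (9 / r ^+ 2) by rewrite divr_gt0.
  apply: filterS2 (cnbhs_ball a r3) (cnbhs_ball a eK) => z hz hze.
  have [/le_lt_trans + _] := sog a r r0 rV z hz; apply.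
  by rewrite mulrC -ltr_pdivlMr.
have Sg : S <= normc (g' p).
  apply/ler_addgt0Pl => e e0; have e2 : 0 < e / 2 by rewrite divr_gt0.
  have [n [hn1 hn2]] : exists n, normc (G' n p - g' p) < e / 2 /\ n.+1%:R^-1 < e / 2.
    apply: (@filter_ex _ F); apply: filterI; first exact: (g'E p Vp _ e2).
    by apply: oF; exact: (near_infty_natSinv_lt (PosNum e2)).
  have h1 : S < normc (G' n p) + n.+1%:R^-1 by rewrite -ltrBlDr HS.
  apply/ltW/(lt_trans h1); rewrite addrC (splitr e) -addrA ltrD//.
  by rewrite -ltrBlDr; apply: le_lt_trans hn1; exact: lerB_normc.
have g'p : g' p != 0 by rewrite -normc_gt0 (lt_le_trans S0).
(* The set where [g'] is nonzero contains [p] and is open by continuity. Its complement is open too: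
   near a zero of the limit, the zero-free [G' n] are uniformly small by [hurwitz_unif].
   Connectedness concludes. *)
have g'0 z : V z -> g' z != 0.
  apply: (conV [set z | g' z != 0]) => // {}z Vz /=.
    move=> gz; have [_ cg] := Hg z Vz.
    apply: filterS (cto_neq0 cg gz) => w /= hw; rewrite -normc_gt0; apply: le_lt_trans hw.
    by rewrite divr_ge0// normc_ge0.
  move=> /negP; rewrite negbK => /eqP gz.
  have [r r0 rV] := radius z Vz.
  pose q := r / 3; have q0 : 0 < q by rewrite divr_gt0.
  (* This scaling brings the bound [3 / r] on [G' n] down to 3 / 4, below the 1 required by
     [hurwitz_unif]. *)
  pose c : R[i] := (r / 4)%:C%C.
  have c0 : 0 < r / 4 by rewrite divr_gt0.
  have qV : disc z q `<=` V.
    by apply: subset_trans rV; apply: sub_disc; rewrite subrr normc0 /q; lra.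
  suff Z0 w : disc z (q / 2) w -> g' w = 0.
    exists (q / 2); first exact: divr_gt0.
    by move=> w /Z0 gw0; rewrite /setC /= gw0 eqxx.
  move=> hw; have q2 : disc z q w by apply: lt_trans hw _; lra.
  have limw := g'E w (qV w q2).
  have limcw : cto F (fun n => c * G' n w) (c * g' w).
    by apply: ctoM => //; exact: cto_cst.
  have limz : cto F (fun n => c * G' n z) 0.
    by rewrite -(mulr0 c) -gz; apply: ctoM; [exact: cto_cst|exact: g'E].
  suff : c * g' w = 0.
    move=> /eqP; rewrite mulf_eq0 => /orP[|/eqP//].
    by rewrite eq_complex/= gt_eqF.
  apply/eqP; rewrite -normc_le0; apply/ler_addgt0Pl => e e0; rewrite addr0.
  have e2 : 0 < e / 2 by rewrite divr_gt0.
  have [d d0 dP] := hurwitz_unif e2.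
  have [n [hn1 hn2]] : exists n, normc (c * G' n w - c * g' w) < e / 2 /\
      normc (c * G' n z - 0) < d.
    by apply: (@filter_ex _ F); apply: filterI; [exact: limcw|exact: limz].
  have [_ _ _ _ Gn0] := HG n.
  have [G2 HG2] := holo_deriv oV (HGn n).
  have := dP z q _ _ q0 (holoZ c (holoS qV HG2)).
  rewrite subr0 in hn2.
  have P y : disc z q y -> c * G' n y != 0 /\ normc (c * G' n y) < 1.
    move=> hy; split.
      have cc0 : c != 0 by rewrite eq_complex/= gt_eqF.
      by apply: mulf_neq0 => //; apply: Gn0; exact: qV.
    rewrite normcM normc_real gtr0_norm//.
    have [+ _] := so z r n r0 rV => /(_ y hy) le3.
    apply: (@le_lt_trans _ _ (r / 4 * (3 / r))); first by rewrite ler_pM2l.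
    have -> : r / 4 * (3 / r) = 3 / 4 by field; rewrite gt_eqF.
    lra.
  move=> /(_ P hn2 w hw) h3.
  have := lerB_normc (c * g' w) (c * G' n w).
  rewrite [normc (c * g' w - _)]normc_distC; lra.
exists g, g'; split => //; split => //.
(* A limit only gives [normc (g z) <= 1]; the strict bound follows from [gradient_bound], since
   [g' z != 0]. *)
- move=> z Vz; have [r r0 rV] := radius z Vz.
  have gz1 y : V y -> normc (g y) <= 1.
    by move=> Vy; apply: (cto_le (gE y Vy)) => n; exact: Gn1.
  have := gradient_bound r0 (holoS rV Hg) (fun y hy => gz1 y (rV y hy)).
  have : 0 < r * normc (g' z) by rewrite mulr_gt0// normc_gt0 g'0.
  lra.
- apply/eqP; rewrite -normc_le0; apply: (cto_le (gE p Vp)) => n.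
  by have [_ _ -> _ _] := HG n; rewrite normc0.
- move=> a b Va Vb gab; apply: contrapT => /eqP ab.
  have [r0 r00 r0V] := radius a Va.
  have nab : 0 < normc (b - a) by rewrite normc_gt0 subr_eq0 eq_sym.
  (* This keeps [b] out of the open disc about [a], so that [G n - G n b] is zero-free there by
     injectivity. If [g a = g b], Hurwitz makes [g] constant near [a], against [g' a != 0]. The
     factor 1 / 2 below keeps the differences under 1. *)
  pose r := Num.min r0 (normc (b - a)).
  have rr : 0 < r by rewrite lt_min r00.
  have rV : disc a r `<=` V.
    by apply: subset_trans r0V => z; rewrite /disc /= lt_min => /andP[].
  have Z0 w : disc a (r / 2) w -> g w = g b.
    move=> hw; have hw' : disc a r w.
      by apply: lt_trans hw _; rewrite ltr_pdivrMr// mulr_natr mulr2n ltrDl.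
    have lim y : V y -> cto F (fun n => 2^-1 * (G n y - G n b)) (2^-1 * (g y - g b)).
      move=> Vy; apply: ctoM; first exact: cto_cst.
      by apply: ctoD; [exact: gE|apply: ctoN; exact: gE].
    suff : 2^-1 * (g w - g b) = 0.
      move=> /eqP; rewrite mulf_eq0 invr_eq0 pnatr_eq0/= subr_eq0.
      by move=> /eqP.
    apply/eqP; rewrite -normc_le0; apply/ler_addgt0Pl => e e0; rewrite addr0.
    have e2 : 0 < e / 2 by rewrite divr_gt0.
    have [d d0 dP] := hurwitz_unif e2.
    have [n [hn1 hn2]] : exists n,
        normc (2^-1 * (G n w - G n b) - 2^-1 * (g w - g b)) < e / 2 /\
        normc (2^-1 * (G n a - G n b) - 2^-1 * (g a - g b)) < d.
      apply: (@filter_ex _ F); apply: filterI; first exact: (lim w (rV w hw')).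
      exact: (lim a Va).
    rewrite gab subrr mulr0 subr0 in hn2.
    have [_ Gn1' _ Gninj _] := HG n.
    have := dP a r _ _ rr (holoZ 2^-1 (holoD (holoS rV (HGn n)) (holo_cst (- G n b)))).
    have P y : disc a r y -> 2^-1 * (G n y - G n b) != 0 /\
        normc (2^-1 * (G n y - G n b)) < 1.
      move=> hy; split.
        rewrite mulf_neq0 ?invr_eq0 ?pnatr_eq0// subr_eq0; apply/eqP.
        move=> /(Gninj y b (rV y hy) Vb) yb.
        by move: hy; rewrite /disc /= yb lt_min ltxx andbF.
      rewrite normcM normcV normc_nat ltr_pdivrMl// mulr1.
      apply: le_lt_trans (normcB _ _) _.
      by have := Gn1' y (rV y hy); have := Gn1' b Vb; lra.
    move=> /(_ P hn2 w hw) h3.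
    have := lerB_normc (2^-1 * (g w - g b)) (2^-1 * (G n w - G n b)).
    rewrite [normc (2^-1 * (g w - g b) - _)]normc_distC; lra.
  have [dg _] := Hg a Va.
  have : cder g a 0.
    apply: cder_near (cder_cst (g b) a).
    exists (r / 2); first exact: divr_gt0.
    by move=> w /Z0 ->.
  by move=> /(cder_unique dg) E; have := g'0 a Va; rewrite E eqxx.
Qed.

(** The supremum of [normc (g' p)] is attained by [schlicht_limit], and [koebe] would exceed it if a
    value of the disc were omitted. The hypothesis on [Z] is connectedness of [V], in the form that
    propagates [g' z != 0] from [p]. *)
Theorem riemann_mapping (R0 : R) : 0 < R0 -> V `<=` disc p R0 ->
  (forall Z : set R[i], (forall z, V z -> Z z -> cnbhs z Z) ->
    (forall z, V z -> ~ Z z -> cnbhs z (~` Z)) -> Z p -> forall z, V z -> Z z) ->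
  exists g g' f : R[i] -> R[i], [/\ schlicht g g',
    forall w, disc 0 1 w -> V (f w), forall w, disc 0 1 w -> g (f w) = w,
    forall z, V z -> f (g z) = z &
    holo (disc 0 1) f (fun w => (g' (f w))^-1)].
Proof.
move=> R00 VR conV.
pose E := [set x : R | exists g g', schlicht g g' /\ x = normc (g' p)].
have R0V : 0 < R0^-1 by rewrite invr_gt0.
have ER0 : E R0^-1.
  pose c : R[i] := (R0^-1)%:C%C.
  have c0 : c != 0 by rewrite eq_complex/= gt_eqF.
  exists (fun z => c * (z - p)), (fun=> c * (1 + 0)); split; last first.
    by rewrite addr0 mulr1 normc_real gtr0_norm.
  split.
  - exact: (holoZ c (holoD (@holo_id R V) (holo_cst (- p)))).
  - move=> z /VR; rewrite /disc /= normcM normc_real gtr0_norm// => h.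
    by rewrite ltr_pdivrMl// mulr1.
  - by rewrite subrr mulr0.
  - by move=> z w _ _ /(mulfI c0)/addIr.
  - by move=> z _; rewrite addr0 mulr1.
have [r r0 rV] := oV Vp.
have ubE : ubound E r^-1.
  move=> _ [g [g' [[Hg g1 _ _ _] ->]]].
  have := cauchy_estimate (K := 1) (holoS (rV : disc p r `<=` V) Hg) r0.
  rewrite -ler_pdivlMl// mulr1; apply => z /rV /g1; exact: ltW.
have supE : has_sup E by split; [exists R0^-1|exists r^-1].
pose S := sup E.
have S0 : 0 < S by rewrite (lt_le_trans R0V)//; apply: sup_ubound => //; case: supE.
have /choice[G HG] n : exists gg : (R[i] -> R[i]) * (R[i] -> R[i]),
    schlicht gg.1 gg.2 /\ S - n.+1%:R^-1 < normc (gg.2 p).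
  have n0 : 0 < n.+1%:R^-1 :> R by rewrite invr_gt0.
  have [_ [g [g' [gg' ->]]] lt] := sup_adherent n0 supE.
  by exists (g, g').
have [g [g' [gg' Sg']]] := schlicht_limit conV
  (fun n => proj1 (HG n)) S0 (fun n => proj2 (HG n)).
have onto w : disc 0 1 w -> exists z, V z /\ g z = w.
  rewrite /disc /= subr0 => w1; apply: contrapT => H.
  have [|k [k' [kk' lt]]] := koebe gg' w1.
    by move=> z Vz gz; apply: H; exists z.
  have : normc (k' p) <= S.
    by apply: sup_ubound; [case: supE|exists k, k'].
  by move=> /(lt_le_trans lt)/(le_lt_trans Sg'); rewrite ltxx.
pose f w := xget 0 [set z | V z /\ g z = w].
have fP w : disc 0 1 w -> V (f w) /\ g (f w) = w.
  by move=> /onto[z hz]; exact: (@xgetI _ 0 [set z | V z /\ g z = w] z hz).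
have [Hg g1 gp ginj g'0] := gg'.
have disc01 z : V z -> disc 0 1 (g z) by move=> /g1; rewrite /disc /= subr0.
have fg z : V z -> f (g z) = z.
  by move=> Vz; have [Vf gf] := fP _ (disc01 z Vz); exact: ginj.
exists g, g', f; split => //; [by move=> w /fP[]|by move=> w /fP[]|].
move=> w hw; have [Vf gf] := fP w hw.
(* Openness of [g] at [f w] is continuity of its inverse at [w]. *)
have cf : ccont f w.
  move=> e e0; have [d d0 dV] := oV Vf.
  pose q := Num.min e d; have q0 : 0 < q by rewrite lt_min e0.
  have qV : disc (f w) q `<=` V.
    by move=> z; rewrite /disc /= lt_min => /andP[_ /dV].
  have [b b0 bP] := open_mapping q0 (holoS qV Hg) (g'0 _ Vf).
  exists b => // y yw; have [|z hz gz] := bP y; first by rewrite gf.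
  rewrite -gz fg; last exact: qV.
  by move: hz; rewrite /disc /= lt_min => /andP[].
have [[s gs sl] cg'] := Hg _ Vf.
split; last by apply: ctoV; [exact: (cto_comp cg' cf)|exact: g'0].
exists (fun y => (s (f y))^-1); last first.
  by apply: ctoV; [exact: (cto_comp sl cf)|exact: g'0].
have [d d0 dP] := gs.
have c2 : \forall y \near cnbhs w, normc (g' (f w)) / 2 < normc (s (f y)).
  exact: (cto_neq0 (cto_comp sl cf) (g'0 _ Vf)).
apply: filterS3 (cf _ d0) c2 (copen_disc hw) => y yd ys hy.
have [_ gy] := fP y hy.
have s0 : s (f y) != 0.
  by rewrite -normc_gt0 (le_lt_trans _ ys)// divr_ge0// normc_ge0.
by have := dP (f y) yd; rewrite gy gf => ->; rewrite mulKf.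
Qed.

End RiemannMapping.

(** * Square roots on simply connected plane domains *)

Section Plane.
Context {R : realType}.

Definition toC (p : 'rV[R]_2) : R[i] := (p 0 0 +i* p 0 1)%C.
Definition ofC (z : R[i]) : 'rV[R]_2 := \row_j (if j == 0 then Re z else Im z).

Lemma toCK : cancel toC ofC.
Proof.
move=> p; apply/rowP => j; rewrite mxE /=.
by case: j => -[|[|//]] hj /=; congr (p _ _); apply/val_inj.
Qed.

Lemma ofCK : cancel ofC toC.
Proof. by move=> [a b]; rewrite /toC !mxE. Qed.

Lemma cto_toC p : cto (nbhs p) toC (toC p).
Proof. by apply: cto_ReIm => /=; exact: coord_continuous. Qed.

Lemma cvg_ofC z : ofC @ cnbhs z --> ofC z.
Proof.
move=> A /nbhs_ballP[e /= e0 eA]; exists e => // w wz; apply: eA; split => // i j.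
rewrite /ball /= !mxE distrC; case: eqP => _; rewrite -?ReB -?ImB.
  exact: le_lt_trans (normr_Re_le _) wz.
exact: le_lt_trans (normr_Im_le _) wz.
Qed.

Lemma cto_rV {T} {F : set_system T} (f : T -> 'rV[R]_2) p : f @ F --> p ->
  cto F (fun x => toC (f x)) (toC p).
Proof. by move=> fp; exact: (cto_cvg_comp fp (@cto_toC p)). Qed.

End Plane.

Lemma within_continuous_comp {S T U : topologicalType} (A : set T) (f : T -> U)
    (g : S -> T) : {within A, continuous f} -> continuous g -> (forall x, A (g x)) ->
  continuous (f \o g).
Proof.
move=> /subspace_continuousP cf cg gA x.
have H : g @ x --> within A (nbhs (g x)).
  move=> B /(cg x).
  change (nbhs x (g @^-1` (fun u => A u -> B u)) -> nbhs x (g @^-1` B)).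
  by apply: filterS => y h; apply: h; exact: gA.
exact: (cvg_comp _ _ H (cf _ (gA x))).
Qed.

Section Clamp.
Context {R : realType}.
Implicit Types t : R.

(** Retracts the line onto the unit segment, so that maps continuous within [[0, 1]] become
    continuous everywhere. *)
Definition clamp t : R := Num.max 0 (Num.min t 1).

Lemma clamp_itv t : clamp t \in `[0, 1].
Proof. by rewrite in_itv/= le_max lexx ge_max ler01 ge_min lexx orbT. Qed.

Lemma clampE t : t \in `[0, 1] -> clamp t = t.
Proof.
rewrite in_itv/= => /andP[t0 t1]; rewrite /clamp.
by have /min_idPl -> := t1; apply/max_idPr.
Qed.

Lemma continuous_clamp : continuous clamp.
Proof.
move=> t; apply: (@continuous_max R R (fun=> 0) (Num.min^~ 1) t); first exact: cvg_cst.
by apply: (@continuous_min R R id (fun=> 1) t); [exact: cvg_id|exact: cvg_cst].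
Qed.

End Clamp.

(** * Continuous square roots over a square and along paths *)

Section SquareRoots.
Context {R : realType}.

Lemma sqrtc_Re_ge (q : R[i]) : normc (q - 1) < 1 / 2 -> 1 / 2 <= Re (sqrtc q).
Proof.
move=> q1; have : `|Re (q - 1)| < 1 / 2 by exact: le_lt_trans (normr_Re_le _) q1.
rewrite ReB /= ltr_norml => /andP[h1 _].
have := Re_le_normc q; case: q {q1} h1 => a b /= h1 h2.
set r := Num.sqrt (a ^+ 2 + b ^+ 2) in h2 *.
have -> : 1 / 2 = Num.sqrt ((1 / 2) ^+ 2) :> R by rewrite sqrtr_sqr ger0_norm//; lra.
by rewrite ler_wsqrtr//; lra.
Qed.

(** Difference of squares: the sum of the two roots has real part at least 1, so dividing by it does
    not increase the modulus. *)
Lemma sqrtc_lip (q r : R[i]) : normc (q - 1) < 1 / 2 -> normc (r - 1) < 1 / 2 ->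
  normc (sqrtc q - sqrtc r) <= normc (q - r).
Proof.
move=> /sqrtc_Re_ge hq /sqrtc_Re_ge hr.
rewrite -[in leRHS](sqr_sqrtc q) -[in leRHS](sqr_sqrtc r) subr_sqr normcM.
rewrite ler_peMr ?normc_ge0//; apply: le_trans (Re_le_normc _).
by rewrite ReD; lra.
Qed.

Lemma cto_sqrtc {T} (F : set_system T) {FF : Filter F} (f : T -> R[i]) q :
  normc (q - 1) < 1 / 2 -> cto F f q -> cto F (fun x => sqrtc (f x)) (sqrtc q).
Proof.
move=> q1 fq e e0.
have e1 : 0 < 1 / 2 - normc (q - 1) by rewrite subr_gt0.
apply: filterS2 (fq _ e0) (fq _ e1) => x h1 h2.
apply: le_lt_trans h1; apply: sqrtc_lip => //.
have := normc_triangle q (f x) 1; lra.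
Qed.

Lemma ratio_close (a b k : R[i]) : k != 0 -> normc (a - k) < normc k / 8 ->
  normc (b - k) < normc k / 8 -> normc (a / b - 1) < 1 / 2.
Proof.
rewrite -normc_gt0 => k0 ak bk.
have nb : 7 / 8 * normc k < normc b.
  have := lerB_normc k b; rewrite normc_distC; lra.
have b0 : b != 0 by rewrite -normc_gt0; lra.
have -> : a / b - 1 = (a - b) / b by field.
rewrite normcM normcV ltr_pdivrMr ?normc_gt0//.
have := normc_triangle k a b; rewrite [normc (k - b)]normc_distC; lra.
Qed.

Let sq : set (R * (R * R)) := `[0, 1] `*` (`[0, 1] `*` `[0, 1]).

Let clamp2 (x : R * R) := (clamp x.1, clamp x.2).

Let scale (l : R) (x : R * R) := (l * x.1, l * x.2).

(** The square is contracted to the origin by scaling. In sufficiently many equal steps of the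
    scale, consecutive values of [K] have ratio close to 1, where the principal root is continuous;
    the product of these roots telescopes. *)
Lemma sqrt_square (K : R * R -> R[i]) : (forall x, cto (nbhs x) K (K x)) ->
  (forall x, K x != 0) -> exists S : R * R -> R[i],
  (forall x, cto (nbhs x) S (S x)) /\
  forall s t, s \in `[0, 1] -> t \in `[0, 1] -> S (s, t) ^+ 2 = K (s, t).
Proof.
move=> cK K0.
have cscale (y : R * (R * R)) :
    (fun y : R * (R * R) => scale y.1 y.2) @ y --> scale y.1 y.2.
  have c1 : (fun y : R * (R * R) => y.1) @ y --> y.1 by exact: cvg_fst.
  have c2 : (fun y : R * (R * R) => y.2.1) @ y --> y.2.1.
    exact: (cvg_comp _ _ (@cvg_snd _ _ (nbhs y.1) (nbhs y.2) _) cvg_fst).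
  have c3 : (fun y : R * (R * R) => y.2.2) @ y --> y.2.2.
    exact: (cvg_comp _ _ (@cvg_snd _ _ (nbhs y.1) (nbhs y.2) _) cvg_snd).
  exact: (cvg_pair (cvgM c1 c2) (cvgM c1 c3)).
(* One step size serves all points and scales, by compactness of [sq]. *)
have [d d0 dP] : exists2 d : R, 0 < d & forall x l m, sq (l, x) -> `|m - l| < d ->
    normc (K (scale m x) / K (scale l x) - 1) < 1 / 2.
  have cptsq : compact sq.
    by apply: compact_setX; [|apply: compact_setX]; exact: segment_compact.
  move/compact_near_coveringP : cptsq => /(_ R (0 : R)^'+
    (fun d y => forall m, `|m - y.1| < d ->
       normc (K (scale m y.2) / K (scale y.1 y.2) - 1) < 1 / 2)) /=.
  case.
    move=> y _; pose k := K (scale y.1 y.2).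
    have k8 : 0 < normc k / 8 by rewrite divr_gt0// normc_gt0 K0.
    have ck : cto (nbhs y) (fun y => K (scale y.1 y.2)) k.
      exact: (cto_cvg_comp (cscale y) (cK (scale y.1 y.2))).
    have [[A B] /= [/nbhs_ballP[a /= a0 aA] yB] AB] := ck _ k8.
    have a2 : 0 < a / 2 by rewrite divr_gt0.
    exists (ball y.1 (a / 2) `*` B, [set d | d < a / 2]) => /=.
      split; last by near=> d; rewrite /=; near: d; exact: nbhs_right_lt.
      exists (ball y.1 (a / 2), B) => //=; split => //; exact: nbhsx_ballx.
    move=> [[l x] d] /= [[hl hx] hd] m ml.
    have hl' : `|y.1 - l| < a / 2 by exact: hl.
    have Al : A l by apply: aA; rewrite /ball /=; apply: lt_trans hl' _; lra.
    have Am : A m.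
      apply: aA; rewrite /ball /= -(subrK l y.1) -addrA.
      rewrite (le_lt_trans (ler_normD _ _))// [X in _ < X](splitr a) ltrD//.
      by rewrite distrC; exact: lt_trans ml hd.
    exact: (ratio_close (K0 _) (AB (m, x) (conj Am hx)) (AB (l, x) (conj Al hx))).
  move=> d /= d0 dP; exists (d / 2) => //; first by rewrite divr_gt0.
  move=> x l m lx ml; apply: (dP (d / 2) _ _ (l, x)) => //=.
    by rewrite sub0r normrN gtr0_norm ?divr_gt0//; lra.
  by rewrite divr_gt0.
have [n nd] : exists n : nat, n.+1%:R^-1 < d.
  have [n _ /(_ n (leqnn n))] := near_infty_natSinv_lt (PosNum d0).
  by exists n.
pose p j := j%:R / n.+1%:R : R.
pose s0 := sqrtc (K (0, 0)).
(* At scale 0 all points are sent to the origin, so the recursion starts from a constant. *)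
pose fix S (j : nat) (x : R * R) {struct j} : R[i] := if j is j'.+1 then
   S j' x * sqrtc (K (scale (p j'.+1) (clamp2 x)) / K (scale (p j') (clamp2 x))) else s0.
have sqS j x : S j x ^+ 2 = K (scale (p j) (clamp2 x)).
  elim: j => [|j IH] /=.
    by rewrite /scale /p mul0r !mul0r sqr_sqrtc.
  by rewrite exprMn IH sqr_sqrtc mulrC divfK.
have p01 j : (j <= n.+1)%N -> p j \in `[0, 1].
  move=> jn; rewrite in_itv/= /p divr_ge0//= ler_pdivrMr ?ltr0n// mul1r.
  by rewrite ler_nat.
have cS j x : (j <= n.+1)%N -> cto (nbhs x) (S j) (S j x).
  elim: j => [|j IH] jn /=; first exact: cto_cst.
  apply: ctoM; first by apply: IH; exact: ltnW.
  apply: cto_sqrtc.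
    apply: dP.
      by split => /=; [exact: (p01 j (ltnW jn))|split; exact: clamp_itv].
    rewrite /p -mulrBl -addn1 natrD addrAC subrr add0r mul1r.
    by rewrite gtr0_norm// invr_gt0.
  have csc l : cto (nbhs x) (fun x => K (scale l (clamp2 x))) (K (scale l (clamp2 x))).
    apply: (cto_cvg_comp _ (cK _)).
    have c2 : (fun y : R * R => clamp y.1) @ x --> clamp x.1.
      exact: (cvg_comp _ _ (@cvg_fst _ _ (nbhs x.1) (nbhs x.2) _) (@continuous_clamp R x.1)).
    have c3 : (fun y : R * R => clamp y.2) @ x --> clamp x.2.
      exact: (cvg_comp _ _ (@cvg_snd _ _ (nbhs x.1) (nbhs x.2) _) (@continuous_clamp R x.2)).
    exact: (cvg_pair (cvgM (cvg_cst l) c2) (cvgM (cvg_cst l) c3)).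
  by apply: ctoM; [|apply: ctoV].
exists (S n.+1); split; first by move=> x; exact: cS.
move=> s t hs ht; rewrite sqS /clamp2 /= !clampE// /scale /p divff ?pnatr_eq0//.
by rewrite !mul1r.
Unshelve. all: end_near. Qed.

(** The quotient of two roots takes only the values 1 and -1; by the intermediate value theorem it
    cannot change. *)
Lemma root_unique (a b : R -> R[i]) : ccurve a -> ccurve b ->
  (forall t, t \in `[0, 1] -> b t != 0 /\ a t ^+ 2 = b t ^+ 2) ->
  a 0 = b 0 -> a 1 = b 1.
Proof.
move=> ca cb ab ab0.
pose q t := Re (a (clamp t) / b (clamp t)).
have qE t : a (clamp t) = b (clamp t) \/ a (clamp t) = - b (clamp t).
  have [_ /eqP] := ab _ (clamp_itv t).
  by rewrite eqf_sqr => /orP[] /eqP; [left|right].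
have b0 t : b (clamp t) != 0 by have [] := ab _ (clamp_itv t).
have cq : continuous q.
  move=> t; apply: cto_Re.
  have cc (c : R -> R[i]) : ccurve c -> cto (nbhs t) (fun t => c (clamp t)) (c (clamp t)).
    by move=> hc; exact: (cto_cvg_comp (@continuous_clamp R t) (hc (clamp t))).
  by apply: ctoM; [exact: cc|apply: ctoV; [exact: cc|exact: b0]].
have I0 : (0 : R) \in `[0, 1] by rewrite in_itv/= lexx ler01.
have I1 : (1 : R) \in `[0, 1] by rewrite in_itv/= lexx ler01.
have q0 : q 0 = 1.
  by rewrite /q (clampE I0) ab0 divff//; have [] := ab 0 I0.
have [E|E] := qE 1; first by rewrite (clampE I1) in E.
have q1 : q 1 = -1.
  have bb : b 1 != 0 by have [] := ab 1 I1.
  by rewrite /q (clampE I1); rewrite (clampE I1) in E; rewrite E mulNr divff.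
have [||c _] := @IVT R q 0 1 0 ler01.
- exact: continuous_subspaceT.
- by rewrite q0 q1 ge_min le_max lerN10 ler01 orbT.
rewrite /q; have [->|->] := qE c.
  by rewrite divff//= => /eqP; rewrite oner_eq0.
by rewrite mulNr divff//= => /eqP; rewrite oppr_eq0 oner_eq0.
Qed.

Section Lifting.
Variables (Omega : set 'rV[R]_2) (h : R[i] -> R[i]).
Hypothesis scO : simply_connected R Omega.
Hypothesis ch : forall p, Omega p -> ccont h (toC p).
Hypothesis h0 : forall p, Omega p -> h (toC p) != 0.

(* A path is parametrised by the whole line; only its values on [0, 1] matter. *)
Definition path_from (a b : 'rV[R]_2) (c : R -> 'rV[R]_2) :=
  [/\ continuous c, forall t, Omega (c t), c 0 = a & c 1 = b].

Let I0 : (0 : R) \in `[0, 1]. Proof. by rewrite in_itv/= lexx ler01. Qed.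
Let I1 : (1 : R) \in `[0, 1]. Proof. by rewrite in_itv/= lexx ler01. Qed.

Lemma path_from_exists a b : Omega a -> Omega b -> exists c, path_from a b c.
Proof.
move=> Oa Ob; have [pc _] := scO; have [c [[cc Oc] ca cb]] := pc a b Oa Ob.
exists (c \o @clamp R); split => /=.
- by apply: (within_continuous_comp cc (@continuous_clamp R)) => x; exact: clamp_itv.
- by move=> t; apply: Oc; exact: clamp_itv.
- by rewrite clampE.
- by rewrite clampE.
Qed.

Lemma path_from_rev a b c : path_from a b c -> path_from b a (fun t => c (1 - t)).
Proof.
move=> [cc Oc c0 c1]; split; [|by move=> t; exact: Oc|by rewrite subr0|by rewrite subrr].
move=> t; have H : (fun t : R => 1 - t) @ t --> 1 - t.
  by apply: cvgB; [exact: cvg_cst|exact: cvg_id].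
exact: (cvg_comp _ _ H (cc _)).
Qed.

(** A sum of reparametrised paths, continuous without any gluing; it is the usual concatenation when
    [c 1 = d 0]. *)
Definition concat (c d : R -> 'rV[R]_2) (t : R) : 'rV[R]_2 :=
  c (Num.min (2 * t) 1) + d (Num.max (2 * t - 1) 0) - c 1.

Lemma concatl c d t : c 1 = d 0 -> t <= 1 / 2 -> concat c d t = c (2 * t).
Proof.
move=> cd t2; rewrite /concat.
have /min_idPl -> : 2 * t <= 1 by lra.
have /max_idPr -> : 2 * t - 1 <= 0 by lra.
by rewrite cd addrK.
Qed.

Lemma concatr c d t : c 1 = d 0 -> 1 / 2 <= t -> concat c d t = d (2 * t - 1).
Proof.
move=> cd t2; rewrite /concat.
have /min_idPr -> : 1 <= 2 * t by lra.
have /max_idPl -> : 0 <= 2 * t - 1 by lra.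
by rewrite [c 1 + _]addrC addrK.
Qed.

Let cont_min : continuous (fun t : R => Num.min (2 * t) 1).
Proof.
move=> t; apply: (@continuous_min R R (fun t => 2 * t) (fun=> 1) t); last exact: cvg_cst.
by apply: cvgM; [exact: cvg_cst|exact: cvg_id].
Qed.

Let cont_max : continuous (fun t : R => Num.max (2 * t - 1) 0).
Proof.
move=> t; apply: (@continuous_max R R (fun t => 2 * t - 1) (fun=> 0) t); last exact: cvg_cst.
by apply: cvgB; [apply: cvgM; [exact: cvg_cst|exact: cvg_id]|exact: cvg_cst].
Qed.

Lemma path_from_concat a b e c d : path_from a b c -> path_from b e d ->
  path_from a e (concat c d).
Proof.
move=> [cc Oc c0 c1] [cd Od d0 d1]; have cd1 : c 1 = d 0 by rewrite c1 d0.
split.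
- move=> t; apply: cvgB; last exact: cvg_cst.
  apply: cvgD; first exact: (cvg_comp _ _ (@cont_min t) (cc _)).
  exact: (cvg_comp _ _ (@cont_max t) (cd _)).
- move=> t; have [t2|/ltW t2] := leP t (1 / 2); first by rewrite concatl.
  by rewrite concatr.
- by rewrite concatl ?mulr0//; lra.
- by rewrite concatr//; [rewrite -d1; congr d|]; lra.
Qed.

Let ch_path a b c : path_from a b c -> ccurve (fun t => h (toC (c t))).
Proof.
move=> [cc Oc _ _] t.
exact: (cto_comp (ch (Oc t)) (cto_rV (cc t))).
Qed.

Definition root_along (c : R -> 'rV[R]_2) (s : R -> R[i]) :=
  ccurve s /\ forall t, t \in `[0, 1] -> s t ^+ 2 = h (toC (c t)).

Lemma root_along_exists a b c s0 : path_from a b c -> s0 ^+ 2 = h (toC a) ->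
  exists2 s, root_along c s & s 0 = s0.
Proof.
move=> pc s0a; have [cc Oc c0 c1] := pc.
(* A path is regarded as a square that is constant in the first variable; the sign is adjusted
   afterwards. *)
have [x|x|S [cS SE]] := @sqrt_square (fun x => h (toC (c x.2))).
- exact: (cto_cvg_comp (@cvg_snd _ _ (nbhs x.1) (nbhs x.2) _) (ch_path pc x.2)).
- exact: h0.
have cs : ccurve (fun t => S (0, t)).
  move=> t; apply: (cto_cvg_comp _ (cS (0, t))).
  exact: (cvg_pair (cvg_cst (0 : R)) (@cvg_id _ (nbhs t))).
have : S (0, 0) ^+ 2 = s0 ^+ 2 by rewrite SE //= c0 s0a.
move/eqP; rewrite eqf_sqr => /orP[] /eqP E.
  by exists (fun t => S (0, t)) => //; split => // t ht; rewrite SE.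
exists (fun t => - S (0, t)); last by rewrite E opprK.
by split=> [t|t ht]; [apply: ctoN; exact: cs|rewrite sqrrN SE].
Qed.

Lemma root_along_unique a b c s s' : path_from a b c -> root_along c s ->
  root_along c s' -> s 0 = s' 0 -> s 1 = s' 1.
Proof.
move=> [_ Oc _ _] [cs sE] [cs' sE'] E.
apply: root_unique => // t ht; rewrite sE// sE'//; split => //.
by have := h0 (Oc t); rewrite -sE'// expf_eq0.
Qed.

(** Take a root over the whole contracting homotopy. On three sides of the square the homotopy stays
    at the base point, so the root is constant there, and the two ends of the fourth side, which is
    the loop, carry the same value. *)
Lemma root_along_loop a c s : path_from a a c -> root_along c s -> s 0 = s 1.
Proof.
move=> pc [cs sE]; have [cc Oc c0 c1] := pc.
have [_ /(_ c)] := scO; case.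
- by split => //; exact: continuous_subspaceT.
- by rewrite c0 c1.
move=> H [cH OH H0 H1 Hs].
pose G (x : R * R) := H (clamp x.1, clamp x.2).
have cG : continuous G.
  apply: (within_continuous_comp cH (g := fun x : R * R => (clamp x.1, clamp x.2))).
    move=> x.
    have c2 : (fun y : R * R => clamp y.1) @ x --> clamp x.1.
      exact: (cvg_comp _ _ (@cvg_fst _ _ (nbhs x.1) (nbhs x.2) _) (@continuous_clamp R x.1)).
    have c3 : (fun y : R * R => clamp y.2) @ x --> clamp x.2.
      exact: (cvg_comp _ _ (@cvg_snd _ _ (nbhs x.1) (nbhs x.2) _) (@continuous_clamp R x.2)).
    exact: (cvg_pair c2 c3).
  by move=> x; split; exact: clamp_itv.
have OG x : Omega (G x) by apply: OH; exact: clamp_itv.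
have [x|x|S [cS SE]] := @sqrt_square (fun x => h (toC (G x))).
- exact: (cto_comp (ch (OG x)) (cto_rV (cG x))).
- exact: h0.
have hor (e : R) : ccurve (fun t => S (t, e)).
  move=> t; apply: (cto_cvg_comp _ (cS (t, e))).
  exact: (cvg_pair (@cvg_id _ (nbhs t)) (cvg_cst e)).
have ver (e : R) : ccurve (fun t => S (e, t)).
  move=> t; apply: (cto_cvg_comp _ (cS (e, t))).
  exact: (cvg_pair (cvg_cst e) (@cvg_id _ (nbhs t))).
have cstE (f : R -> R[i]) : ccurve f ->
    (forall t, t \in `[0, 1] -> f t ^+ 2 = h (toC (c 0))) -> f 0 = f 1.
  move=> cf fE; apply/esym; apply: (@root_unique f (fun=> f 0)) => //.
    by move=> t; exact: cto_cst.
  move=> t ht; rewrite !fE//; split => //.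
  by have := h0 (Oc 0); rewrite -(fE 0 I0) expf_eq0.
have e1 : S (0, 0) = S (1, 0).
  apply: (@cstE (fun t => S (t, 0))) => // t ht.
  by rewrite SE// /G /= !clampE//; have [-> _] := Hs t ht.
have e2 : S (1, 0) = S (1, 1).
  by apply: (@cstE (fun t => S (1, t))) => // t ht; rewrite SE// /G /= !clampE// H1.
have e3 : S (0, 1) = S (1, 1).
  apply: (@cstE (fun t => S (t, 1))) => // t ht.
  by rewrite SE// /G /= !clampE//; have [_ ->] := Hs t ht.
have S0 t : t \in `[0, 1] -> S (0, t) ^+ 2 = h (toC (c t)).
  by move=> ht; rewrite SE// /G /= !clampE// H0.
have ra : root_along c (fun t => S (0, t)) by split.
have /eqP : s 0 ^+ 2 = S (0, 0) ^+ 2 by rewrite sE// S0.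
rewrite eqf_sqr => /orP[] /eqP E.
  rewrite E e1 e2 -e3; apply/esym.
  exact: (root_along_unique pc (conj cs sE) ra E).
have raN : root_along c (fun t => - S (0, t)).
  by split=> [t|t ht]; [apply: ctoN; exact: ver|rewrite sqrrN S0].
rewrite E e1 e2 -e3; apply/esym.
exact: (root_along_unique pc (conj cs sE) raN E).
Qed.

Definition continuation p s0 q l := exists c s,
  [/\ path_from p q c, root_along c s, s 0 = s0 & s 1 = l].

Let half_itv (t : R) : t \in `[0, 1] -> t / 2 \in `[0, 1].
Proof. by rewrite !in_itv/= => /andP[? ?]; apply/andP; split; lra. Qed.

Let half_itv' (t : R) : t \in `[0, 1] -> 1 - t / 2 \in `[0, 1].
Proof. by rewrite !in_itv/= => /andP[? ?]; apply/andP; split; lra. Qed.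

(** The first path followed by the second one reversed is a loop, along which a root closes up. Its
    two halves are roots along the two paths with the same initial value. *)
Lemma continuation_unique p s0 q l l' : continuation p s0 q l ->
  continuation p s0 q l' -> l = l'.
Proof.
move=> [c [s [pc rc s00 s1]]] [d [u [pd rd u0 u1]]].
have pr := path_from_rev pd.
have pl := path_from_concat pc pr; have [_ _ c0 c1] := pc.
have cd : c 1 = d (1 - 0) by rewrite subr0 c1; have [_ _ _ ->] := pd.
have s0p : s0 ^+ 2 = h (toC p) by have [_ sE] := rc; rewrite -s00 sE// c0.
have [w [cw wE] w0] := root_along_exists pl s0p.
have w1 := root_along_loop pl (conj cw wE).
have rw1 : root_along c (fun t => w (t / 2)).
  split=> [t|t ht].
    apply: (@cto_cvg_comp _ _ _ _ (nbhs (t / 2)) (fun t => t / 2)); last exact: cw.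
    by apply: cvgM; [exact: cvg_id|exact: cvg_cst].
  rewrite wE ?half_itv// concatl//; last first.
    by move: ht; rewrite in_itv/= => /andP[_ ht]; lra.
  by congr (h (toC (c _))); field.
(* The second half of the loop runs backwards along [d], hence the parameter [1 - t / 2]. *)
have rw2 : root_along d (fun t => w (1 - t / 2)).
  split=> [t|t ht].
    apply: (@cto_cvg_comp _ _ _ _ (nbhs (1 - t / 2)) (fun t => 1 - t / 2)); last exact: cw.
    apply: cvgB; first exact: cvg_cst.
    by apply: cvgM; [exact: cvg_id|exact: cvg_cst].
  rewrite wE ?half_itv'// concatr//; last first.
    by move: ht; rewrite in_itv/= => /andP[_ ht]; lra.
  by congr (h (toC (d _))); field.
have e1 : s 1 = w (1 / 2).
  by apply: (root_along_unique pc rc rw1); rewrite s00 mul0r w0.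
have e2 : u 1 = w (1 - 1 / 2).
  by apply: (root_along_unique pd rd rw2); rewrite u0 mul0r subr0 -w1 w0.
rewrite -s1 -u1 e1 e2; congr w; lra.
Qed.

(** The multiplicative counterpart of [concat]: the second root starts where the first ends, and the
    common value is divided out. *)
Lemma root_along_concat a b e c d s u : path_from a b c -> path_from b e d ->
  root_along c s -> root_along d u -> s 1 = u 0 ->
  root_along (concat c d) (fun t => s (Num.min (2 * t) 1) * u (Num.max (2 * t - 1) 0) / u 0).
Proof.
move=> [_ _ _ c1] [_ Od d0 _] [cs sE] [cu uE] su.
have cd1 : c 1 = d 0 by rewrite c1 d0.
have u0 : u 0 != 0 by have := h0 (Od 0); rewrite -(uE 0 I0) expf_eq0.
split.
  move=> t; apply: ctoM; last exact: cto_cst.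
  apply: ctoM; first exact: (cto_cvg_comp (@cont_min t) (cs _)).
  exact: (cto_cvg_comp (@cont_max t) (cu _)).
move=> t; rewrite in_itv/= => /andP[t0 t1].
have [t2|/ltW t2] := leP t (1 / 2).
  have /min_idPl -> : 2 * t <= 1 by lra.
  have /max_idPr -> : 2 * t - 1 <= 0 by lra.
  by rewrite mulfK// concatl// sE// in_itv/=; apply/andP; split; lra.
have /min_idPr -> : 1 <= 2 * t by lra.
have /max_idPl -> : 0 <= 2 * t - 1 by lra.
by rewrite su mulrAC divff// mul1r concatr// uE// in_itv/=; apply/andP; split; lra.
Qed.

Lemma continuation_exists p s0 q : Omega p -> s0 ^+ 2 = h (toC p) -> Omega q ->
  exists l, continuation p s0 q l.
Proof.
move=> Op s0p Oq; have [c pc] := path_from_exists Op Oq.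
have [s rs s00] := root_along_exists pc s0p.
by exists (s 1), c, s.
Qed.

Lemma continuation_sqr p s0 q l : continuation p s0 q l -> l ^+ 2 = h (toC q).
Proof.
by move=> [c [s [[_ _ _ <-] [_ sE] _ <-]]]; rewrite sE.
Qed.

Hypothesis oO : open Omega.

Let V := [set z | Omega (ofC z)].

Lemma copen_preimage : copen V.
Proof. by move=> z Oz; apply: (@cvg_ofC R z Omega); apply: open_nbhs_nbhs. Qed.

(** The root at a point is defined by continuation from [p]. Near [z] it agrees with the explicit
    continuous branch [b]: extending a path to [z] by a straight segment gives a continuation to [w]
    with value [b w]. *)
Theorem sqrt_exists p : Omega p ->
  exists s, forall z, V z -> ccont s z /\ s z ^+ 2 = h z.
Proof.
move=> Op; pose s0 := sqrtc (h (toC p)).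
have s0p : s0 ^+ 2 = h (toC p) by rewrite sqr_sqrtc.
pose s z := xget 0 [set l | continuation p s0 (ofC z) l].
have sP z : V z -> continuation p s0 (ofC z) (s z).
  move=> Vz; have [l hl] := continuation_exists Op s0p Vz.
  exact: (@xgetI _ 0 [set l | continuation p s0 (ofC z) l] l hl).
exists s => z Vz.
have sz : s z ^+ 2 = h z by rewrite (continuation_sqr (sP z Vz)) ofCK.
split=> //.
have chz : ccont h z by have := ch Vz; rewrite ofCK.
have hz0 : h z != 0 by have := h0 Vz; rewrite ofCK.
pose b w := s z * sqrtc (h w / h z).
have c1 : cto (cnbhs z) (fun w => h w / h z) 1.
  by rewrite -(divff hz0); apply: ctoM => //; exact: cto_cst.
have bz : b z = s z by rewrite /b divff// sqrtc1 mulr1.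
have half1 : normc (1 - 1 : R[i]) < 1 / 2 by rewrite subrr normc0; lra.
have half : (0 : R) < 1 / 2 by lra.
have cb : ccont b z.
  rewrite bz -[X in cto _ _ X]mulr1 -[1 in X in cto _ _ X]sqrtc1.
  by apply: ctoM; [exact: cto_cst|exact: cto_sqrtc].
have [d d0 dP] : \forall w \near cnbhs z, V w /\ normc (h w / h z - 1) < 1 / 2.
  by apply: filterI; [exact: copen_preimage|exact: c1].
suff sb w : disc z d w -> s w = b w.
  move=> e e0; rewrite -bz; apply: filterS2 (cnbhs_ball z d0) (cb e e0) => w hw.
  by rewrite (sb w hw).
move=> hw; apply: (continuation_unique (sP w _)); first by have [] := dP w hw.
have seg t : t \in `[0, 1] -> disc z d (z + t%:C%C * (w - z)).
  by rewrite in_itv/= => /andP[t0 t1]; apply: disc_convex => //; exact: disc_center.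
pose m (t : R) : R[i] := z + (clamp t)%:C%C * (w - z).
have md t : disc z d (m t) by apply: seg; exact: clamp_itv.
have cm : ccurve m.
  move=> t; apply: ctoD; first exact: cto_cst.
  apply: ctoM; last exact: cto_cst.
  by apply: cto_real; exact: continuous_clamp.
have m0 : m 0 = z by rewrite /m clampE// mul0r addr0.
have m1 : m 1 = w by rewrite /m clampE// mul1r subrKC.
have pd : path_from (ofC z) (ofC w) (fun t => ofC (m t)).
  split; rewrite ?m0 ?m1//.
    move=> t A /(@cvg_ofC R (m t)) [e e0 eA].
    by apply: filterS (cm t e e0) => u; exact: eA.
  by move=> t; have [] := dP _ (md t).
have rd : root_along (fun t => ofC (m t)) (fun t => b (m t)).
  split=> [t|t ht].
    apply: ctoM; first exact: cto_cst.
    apply: cto_sqrtc; first by have [] := dP _ (md t).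
    apply: ctoM; last exact: cto_cst.
    have [Vm _] := dP _ (md t).
    by have := ch Vm; rewrite ofCK => chm; exact: (cto_comp chm (cm t)).
  by rewrite ofCK /b exprMn sqr_sqrtc sz mulrC divfK.
have [c [u [pc rc u0 u1]]] := sP z Vz.
have E : u 1 = b (m 0) by rewrite u1 m0 bz.
have ra := root_along_concat pc pd rc rd E.
exists (concat c (fun t => ofC (m t))); eexists; split.
- exact: path_from_concat pc pd.
- exact: ra.
- rewrite /= mulr0.
  have /min_idPl -> : (0 : R) <= 1 by exact: ler01.
  have /max_idPr -> : (0 : R) - 1 <= 0 by lra.
  rewrite mulfK ?u0// m0 bz; have := hz0; by rewrite -sz expf_eq0.
- rewrite /= mulr1.
  have /min_idPr -> : (1 : R) <= 2 by lra.
  have -> : (2 - 1 : R) = 1 by lra.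
  have /max_idPl -> : (0 : R) <= 1 by exact: ler01.
  rewrite E mulrAC divff ?mul1r ?m1//.
  by rewrite m0 bz; have := hz0; rewrite -sz expf_eq0.
Qed.

End Lifting.

End SquareRoots.

(** * Partial derivatives *)

Section PartialDerivatives.
Context {R : realType}.
Implicit Types (w : R[i] -> R) (z : R[i]).

Definition xder w z (a : R) := is_derive (0 : R) 1 (fun t : R => w (z + (t +i* 0)%C)) a.
Definition yder w z (b : R) := is_derive (0 : R) 1 (fun t : R => w (z + (0 +i* t)%C)) b.

Let addxx z (s t : R) : z + (s +i* 0)%C + (t +i* 0)%C = z + ((s + t) +i* 0)%C.
Proof. by case: z => a b; apply: eqcP => /=; rewrite ?addr0 ?addrA. Qed.

Let addyy z (s t : R) : z + (0 +i* s)%C + (0 +i* t)%C = z + (0 +i* (s + t))%C.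
Proof. by case: z => a b; apply: eqcP => /=; rewrite ?addr0 ?addrA. Qed.

Lemma is_derive_shift (f : R -> R) (s l : R) :
  is_derive (0 : R) 1 (fun t => f (s + t)) l <-> is_derive s 1 f l.
Proof.
split => /is_deriveP h; apply/is_deriveP.
  by apply: cvg_trans h; apply: near_eq_cvg; apply: nearW => t; rewrite add0r addr0.
by apply: cvg_trans h; apply: near_eq_cvg; apply: nearW => t; rewrite add0r addr0.
Qed.

Lemma xderP w z s a : xder w (z + (s +i* 0)%C) a <->
  is_derive s 1 (fun t : R => w (z + (t +i* 0)%C)) a.
Proof.
rewrite -(is_derive_shift (fun t : R => w (z + (t +i* 0)%C))) /xder.
by under eq_fun do rewrite addxx.
Qed.

Lemma yderP w z s a : yder w (z + (0 +i* s)%C) a <->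
  is_derive s 1 (fun t : R => w (z + (0 +i* t)%C)) a.
Proof.
rewrite -(is_derive_shift (fun t : R => w (z + (0 +i* t)%C))) /yder.
by under eq_fun do rewrite addyy.
Qed.

Lemma MVT_x w a z (h : R) :
  (forall s : R, `|s| <= `|h| -> xder w (z + (s +i* 0)%C) (a (z + (s +i* 0)%C))) ->
  exists2 c : R, `|c| <= `|h| &
  w (z + (h +i* 0)%C) - w z = a (z + (c +i* 0)%C) * h.
Proof.
move=> wa.
have [|c ch E] := @MVT_dist R (fun t : R => w (z + (t +i* 0)%C))
    (fun t : R => a (z + (t +i* 0)%C)) 0 h.
  by move=> s; rewrite subr0 => sh; apply/xderP/wa.
rewrite subr0 in ch; exists c => //; rewrite -E add0r.
by congr (_ - w _); apply: eqcP; rewrite ?ReD ?ImD /= addr0.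
Qed.

Lemma MVT_y w b z (h : R) :
  (forall s : R, `|s| <= `|h| -> yder w (z + (0 +i* s)%C) (b (z + (0 +i* s)%C))) ->
  exists2 c : R, `|c| <= `|h| &
  w (z + (0 +i* h)%C) - w z = b (z + (0 +i* c)%C) * h.
Proof.
move=> wb.
have [|c ch E] := @MVT_dist R (fun t : R => w (z + (0 +i* t)%C))
    (fun t : R => b (z + (0 +i* t)%C)) 0 h.
  by move=> s; rewrite subr0 => sh; apply/yderP/wb.
rewrite subr0 in ch; exists c => //; rewrite -E add0r.
by congr (_ - w _); apply: eqcP; rewrite ?ReD ?ImD /= addr0.
Qed.

Let normc_ReIm z (c d : R) : `|c| <= `|Re z| -> `|d| <= `|Im z| ->
  normc (c +i* d)%C <= normc z.
Proof.
move=> hc hd; rewrite -(@ler_pXn2r _ 2) ?nnegrE ?normc_ge0// !normc_sqr /=.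
by apply: lerD; rewrite -(real_normK (num_real _)) -[leRHS](real_normK (num_real _))
  ler_pXn2r ?nnegrE.
Qed.

(** One moves from [z] vertically and then horizontally. The slopes are partial derivatives at
    intermediate points no farther from [z] than [y], so continuity of the partials gives their
    limits. *)
Lemma rder_partials (U : set R[i]) w a b z : copen U -> U z ->
  (forall y, U y -> xder w y (a y) /\ yder w y (b y)) ->
  a @ cnbhs z --> a z -> b @ cnbhs z --> b z -> rder w z (a z) (b z).
Proof.
move=> oU Uz wab ca cb; have [r r0 rU] := oU z Uz.
have ex y : exists pq : R[i] * R[i], disc z r y ->
   [/\ normc (pq.1 - z) <= normc (y - z), normc (pq.2 - z) <= normc (y - z) &
   w y - w z = a pq.1 * Re (y - z) + b pq.2 * Im (y - z)].
  have [hy|?] := pselect (disc z r y); last by exists (0, 0).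
  pose m := z + (0 +i* Im (y - z))%C.
  have in_y (c : R) : `|c| <= `|Im (y - z)| -> normc (z + (0 +i* c)%C - z) <= normc (y - z).
    by move=> hc; rewrite addrAC subrr add0r; apply: normc_ReIm => //; rewrite normr0.
  have in_x (c : R) : `|c| <= `|Re (y - z)| -> normc (m + (c +i* 0)%C - z) <= normc (y - z).
    move=> hc; have -> : m + (c +i* 0)%C - z = (c +i* Im (y - z))%C.
      by apply: eqcP; rewrite /m !(ReD, ImD, ReN, ImN) /=; ring.
    exact: normc_ReIm.
  have [|c ch Ec] := @MVT_y w b z (Im (y - z)).
    by move=> s /in_y hs; have /wab[] := rU _ (le_lt_trans hs hy).
  have [|d dh Ed] := @MVT_x w a m (Re (y - z)).
    by move=> s /in_x hs; have /wab[] := rU _ (le_lt_trans hs hy).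
  exists (m + (d +i* 0)%C, z + (0 +i* c)%C) => _; split => /=; [exact: in_x|exact: in_y|].
  rewrite -Ed -Ec -/m.
  have -> : m + (Re (y - z) +i* 0)%C = y.
    by apply: eqcP; rewrite /m !(ReD, ImD, ReN, ImN) /=; ring.
  by ring.
have /choice[q qP] := ex.
exists (fun y => a (q y).1), (fun y => b (q y).2); split.
- by exists r => // y hy; have [_ _] := qP y hy.
- apply: (cvg_comp (fun y => (q y).1) _ _ ca) => A [e e0 eA].
  apply: filterS2 (cnbhs_ball z r0) (cnbhs_ball z e0) => y hy he.
  by apply: eA; have [h _ _] := qP y hy; exact: le_lt_trans h he.
- apply: (cvg_comp (fun y => (q y).2) _ _ cb) => A [e e0 eA].
  apply: filterS2 (cnbhs_ball z r0) (cnbhs_ball z e0) => y hy he.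
  by apply: eA; have [_ h _] := qP y hy; exact: le_lt_trans h he.
Qed.

(** The second difference [D] over a small square is computed in both orders, as [ab p * h * h] and
    as [ba q * h * h], with [p] and [q] near [z]. *)
Lemma mixed_partials (U : set R[i]) w a b ab ba z : copen U -> U z ->
  (forall y, U y -> xder w y (a y) /\ yder w y (b y)) ->
  (forall y, U y -> yder a y (ab y) /\ xder b y (ba y)) ->
  ab @ cnbhs z --> ab z -> ba @ cnbhs z --> ba z -> ab z = ba z.
Proof.
move=> oU Uz wab wab2 cab cba; apply/eqP; rewrite -subr_eq0 -normr_le0.
apply/ler_addgt0Pl => e e0; rewrite addr0.
have e2 : 0 < e / 2 by rewrite divr_gt0.
have [d d0 dP] : \forall y \near cnbhs z,
    [/\ U y, `|ab z - ab y| < e / 2 & `|ba z - ba y| < e / 2].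
  move/cvgrPdist_lt : cab => /(_ _ e2) cab; move/cvgrPdist_lt : cba => /(_ _ e2) cba.
  by apply: filterS3 (oU z Uz) cab cba.
pose h := d / 3; have h0 : 0 < h by rewrite divr_gt0.
have near_z (s t : R) : `|s| <= `|h| -> `|t| <= `|h| ->
    normc (z + (s +i* 0)%C + (0 +i* t)%C - z) < d.
  rewrite (gtr0_norm h0) => hs ht.
  have -> : z + (s +i* 0)%C + (0 +i* t)%C - z = (s +i* t)%C.
    by apply: eqcP; rewrite ?(ReD, ReN, ImD, ImN) /=; ring.
  by apply: le_lt_trans (normc_le_ReIm _) _ => /=; rewrite /h in hs ht *; lra.
have swap (s t : R) : z + (s +i* 0)%C + (0 +i* t)%C = z + (0 +i* t)%C + (s +i* 0)%C.
  by rewrite addrAC.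
have z0 (s : R) : `|s| <= `|h| -> `|(0 : R)| <= `|h| by rewrite normr0.
pose D := w (z + (h +i* 0)%C + (0 +i* h)%C) - w (z + (h +i* 0)%C)
  - (w (z + (0 +i* h)%C) - w z).
have zx (s : R) : z + (s +i* 0)%C + (0 +i* 0)%C = z + (s +i* 0)%C.
  by rewrite -[X in _ + X]/(0 : R[i]) addr0.
have zy (s : R) : z + (0 +i* 0)%C + (0 +i* s)%C = z + (0 +i* s)%C.
  by rewrite -[X in _ + X + _]/(0 : R[i]) addr0.
have h00 : `|(0 : R)| <= `|h| by rewrite normr0.
have [p pz E1] : exists2 p, normc (p - z) < d & D = ab p * h * h.
  have [|c ch Ec] := @MVT_x (fun y => w (y + (0 +i* h)%C) - w y)
      (fun y => a (y + (0 +i* h)%C) - a y) z h.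
    move=> s hs; have hz1 := near_z s h hs (lexx _).
    have hz2 := near_z s 0 hs h00; rewrite zx in hz2.
    have [U1 _ _] := dP _ hz1; have [U2 _ _] := dP _ hz2.
    have [dw1 _] := wab _ U1; have [dw2 _] := wab _ U2.
    apply: is_deriveB; last exact: dw2.
    move: dw1; rewrite /xder; congr (is_derive _ _ _ _); apply/funext => t.
    by congr w; rewrite addrAC.
  have [|c' ch' Ec'] := @MVT_y a ab (z + (c +i* 0)%C) h.
    move=> s hs; have [U1 _ _] := dP _ (near_z c s ch hs).
    by have [] := wab2 _ U1.
  exists (z + (c +i* 0)%C + (0 +i* c')%C); first exact: near_z.
  by rewrite /D Ec Ec'.
have [q qz E2] : exists2 q, normc (q - z) < d & D = ba q * h * h.
  have [|c ch Ec] := @MVT_y (fun y => w (y + (h +i* 0)%C) - w y)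
      (fun y => b (y + (h +i* 0)%C) - b y) z h.
    move=> s hs; have hz1 := near_z h s (lexx _) hs; rewrite swap in hz1.
    have hz2 := near_z 0 s h00 hs; rewrite zy in hz2.
    have [U1 _ _] := dP _ hz1; have [U2 _ _] := dP _ hz2.
    have [_ dw1] := wab _ U1; have [_ dw2] := wab _ U2.
    apply: is_deriveB; last exact: dw2.
    move: dw1; rewrite /yder; congr (is_derive _ _ _ _); apply/funext => t.
    by congr w; rewrite addrAC.
  have [|c' ch' Ec'] := @MVT_x b ba (z + (0 +i* c)%C) h.
    move=> s hs; have := near_z s c hs ch; rewrite swap => hz.
    have [U1 _ _] := dP _ hz.
    by have [] := wab2 _ U1.
  exists (z + (0 +i* c)%C + (c' +i* 0)%C); first by rewrite -swap; exact: near_z.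
  rewrite -Ec' -Ec /D swap; ring.
have pq : ab p = ba q.
  have hne : h != 0 by rewrite gt_eqF.
  by apply: (mulIf hne); apply: (mulIf hne); rewrite -E1 -E2.
have [_ h1 _] := dP p pz; have [_ _ h2] := dP q qz.
have -> : ab z - ba z = (ab z - ab p) - (ba z - ba q) by rewrite pq; ring.
by apply: le_trans (ler_normB _ _) _; rewrite (splitr e) lerD// ltW.
Qed.

End PartialDerivatives.

(** * From partial derivatives of row-vector maps to the complex plane *)

Section Transfer.
Context {R : realType}.

Lemma continuous_extension_cvg {T W : topologicalType} (A : set T) (f : T -> W) p :
  open A -> extends_continuously A f -> A p -> f @ p --> f p.
Proof.
move=> oA [g [cg fg]] Ap; have nA : nbhs p A by exact: open_nbhs_nbhs.
move/subspace_continuousP : cg => /(_ p (subset_closure Ap)) cp.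
have E : f p = g p by exact: fg.
rewrite E; apply: (cvg_trans (G := g @ p)).
  by apply: near_eq_cvg; apply: filterS nA => q /fg.
apply: cvg_trans cp => B; rewrite !nbhs_filterE => gB.
change (nbhs p (g @^-1` B)).
have h : nbhs p (fun q => closure A q -> B (g q)) by exact: gB.
by apply: filterS2 nA h => q /subset_closure Aq; apply.
Qed.

Lemma coord_cvg {n} {T} {F : set_system T} {FF : Filter F} (f : T -> 'rV[R]_n)
  (l : 'rV[R]_n) k : f @ F --> l -> (fun x => f x 0 k) @ F --> l 0 k.
Proof.
move=> fl.
exact: (cvg_comp f (fun M : 'rV[R]_n => M 0 k) fl (@coord_continuous R 1 n 0 k l)).
Qed.

Lemma ofC_addx z (h : R) : ofC (z + (h +i* 0)%C) = h *: delta_mx 0 0 + ofC z.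
Proof.
apply/rowP => j; rewrite !mxE eqxx /=; case: z => a b /=.
by case: eqP => _; rewrite ?mulr1 ?mulr0 ?add0r ?addr0 // addrC.
Qed.

Lemma ofC_addy z (h : R) : ofC (z + (0 +i* h)%C) = h *: delta_mx 0 1 + ofC z.
Proof.
apply/rowP => j; rewrite !mxE eqxx /=; case: z => a b /=.
by case: j => -[|[|//]] hj /=; rewrite ?mulr1 ?mulr0 ?add0r ?addr0 // addrC.
Qed.

Let coord_derive {n} (f : 'rV[R]_2 -> 'rV[R]_n) p u k : derivable f p u ->
  (fun h : R => h^-1 * (f (h *: u + p) 0 k - f p 0 k)) @ 0^' --> 'D_u f p 0 k.
Proof.
move=> /(coord_cvg (F := 0^') (k := k)); apply: cvg_trans.
by apply: near_eq_cvg; apply: nearW => h; rewrite !mxE.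
Qed.

Lemma partial_xder n (f : 'rV[R]_2 -> 'rV[R]_n) z k :
  derivable f (ofC z) (delta_mx 0 0) ->
  xder (fun z => f (ofC z) 0 k) z (partial 0 f (ofC z) 0 k).
Proof.
move=> /(coord_derive (k := k)) h; apply/is_deriveP; apply: cvg_trans h.
apply: near_eq_cvg; apply: nearW => h.
by rewrite !ofC_addx add0r scale0r add0r.
Qed.

Lemma partial_yder n (f : 'rV[R]_2 -> 'rV[R]_n) z k :
  derivable f (ofC z) (delta_mx 0 1) ->
  yder (fun z => f (ofC z) 0 k) z (partial 1 f (ofC z) 0 k).
Proof.
move=> /(coord_derive (k := k)) h; apply/is_deriveP; apply: cvg_trans h.
apply: near_eq_cvg; apply: nearW => h.
by rewrite !ofC_addy add0r scale0r add0r.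
Qed.

Lemma coord_cvg_ofC n (f : 'rV[R]_2 -> 'rV[R]_n) z k : f @ ofC z --> f (ofC z) ->
  (fun y => f (ofC y) 0 k) @ cnbhs z --> f (ofC z) 0 k.
Proof. by move=> cf; apply: coord_cvg; exact: (cvg_comp _ _ (@cvg_ofC R z) cf). Qed.

Lemma rder_partial n (A : set 'rV[R]_2) (f : 'rV[R]_2 -> 'rV[R]_n) z k : open A ->
  derivatives_extend 1 A f -> A (ofC z) ->
  rder (fun z => f (ofC z) 0 k) z (partial 0 f (ofC z) 0 k) (partial 1 f (ofC z) 0 k).
Proof.
move=> oA [_ dA] Az; have [dx [cx _]] := dA 0; have [dy [cy _]] := dA 1.
apply: (@rder_partials _ [set z | A (ofC z)] (fun z => f (ofC z) 0 k)
  (fun z => partial 0 f (ofC z) 0 k) (fun z => partial 1 f (ofC z) 0 k)) => //.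
- exact: copen_preimage.
- by move=> y Ay; split; [apply/partial_xder/dx|apply/partial_yder/dy].
- by apply: coord_cvg_ofC; exact: continuous_extension_cvg cx Az.
- by apply: coord_cvg_ofC; exact: continuous_extension_cvg cy Az.
Qed.

Lemma partialC n (A : set 'rV[R]_2) (f : 'rV[R]_2 -> 'rV[R]_n) p k : open A ->
  derivatives_extend 2 A f -> A p ->
  partial 1 (partial 0 f) p 0 k = partial 0 (partial 1 f) p 0 k.
Proof.
move=> oA [_ dA] Ap; have [dx [_ dxA]] := dA 0; have [dy [_ dyA]] := dA 1.
have [dxy [cxy _]] := dxA 1; have [dyx [cyx _]] := dyA 0.
rewrite -(toCK p).
apply: (@mixed_partials _ [set z | A (ofC z)] (fun z => f (ofC z) 0 k)
  (fun z => partial 0 f (ofC z) 0 k) (fun z => partial 1 f (ofC z) 0 k)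
  (fun z => partial 1 (partial 0 f) (ofC z) 0 k)
  (fun z => partial 0 (partial 1 f) (ofC z) 0 k)) => //=; rewrite ?toCK//.
- exact: copen_preimage.
- by move=> y Ay; split; [apply/partial_xder/dx|apply/partial_yder/dy].
- by move=> y Ay; split; [apply/partial_yder/dxy|apply/partial_xder/dyx].
- by rewrite -{2}(toCK p); apply: coord_cvg_ofC; rewrite toCK; exact: continuous_extension_cvg cxy Ap.
- by rewrite -{2}(toCK p); apply: coord_cvg_ofC; rewrite toCK; exact: continuous_extension_cvg cyx Ap.
Qed.

End Transfer.

(** Three explicit terms rather than an iterated sum, so that after unfolding [ring] and [lra]
    apply. *)
Definition sum3 {R : realType} (f : 'I_3 -> R) : R := f 0 + f 1 + f 2.

(* [x], [y], [xx], [xy], [yy] are the first and second partial derivatives of [w]. *)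
Record C2 {R : realType} (V : set R[i]) (w x y xx xy yy : 'I_3 -> R[i] -> R) : Prop := {
  C2w : forall k z, V z -> rder (w k) z (x k z) (y k z);
  C2x : forall k z, V z -> rder (x k) z (xx k z) (xy k z);
  C2y : forall k z, V z -> rder (y k) z (xy k z) (yy k z);
  C2xx : forall k z, V z -> xx k @ cnbhs z --> xx k z;
  C2xy : forall k z, V z -> xy k @ cnbhs z --> xy k z;
  C2yy : forall k z, V z -> yy k @ cnbhs z --> yy k z }.

(** * Second-order data and the Hopf differential *)

Section C2Data.
Context {R : realType}.

Lemma C2_partial (A : set 'rV[R]_2) (v : 'rV[R]_2 -> 'rV[R]_3) : open A ->
  derivatives_extend 2 A v ->
  C2 [set z | A (ofC z)] (fun k z => v (ofC z) 0 k)
    (fun k z => partial 0 v (ofC z) 0 k) (fun k z => partial 1 v (ofC z) 0 k)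
    (fun k z => partial 0 (partial 0 v) (ofC z) 0 k)
    (fun k z => partial 1 (partial 0 v) (ofC z) 0 k)
    (fun k z => partial 1 (partial 1 v) (ofC z) 0 k).
Proof.
move=> oA dA; have [cv dv] := dA; have [dx dxA] := dv 0; have [dy dyA] := dv 1.
have [cx dxx] := dxA; have [cy dyy] := dyA.
split => k z Az.
- have dA1 : derivatives_extend 1 A v.
    exact: (conj cv (fun j => conj (dv j).1 (conj (dv j).2.1 I))).
  exact: (@rder_partial R 3 A v z k oA dA1 Az).
- exact: (@rder_partial R 3 A (partial 0 v) z k oA dxA Az).
- exact: (eq_ind_r (fun c => rder (fun z0 => partial 1 v (ofC z0) 0 k) z c
      (partial 1 (partial 1 v) (ofC z) 0 k))
    (@rder_partial R 3 A (partial 1 v) z k oA dyA Az)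
    (@partialC R 3 A v (ofC z) k oA dA Az)).
- exact: (@coord_cvg_ofC R 3 (partial 0 (partial 0 v)) z k
    (continuous_extension_cvg oA (dxx 0).2.1 Az)).
- exact: (@coord_cvg_ofC R 3 (partial 1 (partial 0 v)) z k
    (continuous_extension_cvg oA (dxx 1).2.1 Az)).
- exact: (@coord_cvg_ofC R 3 (partial 1 (partial 1 v)) z k
    (continuous_extension_cvg oA (dyy 1).2.1 Az)).
Qed.

Lemma rder_sum3 (f a b : 'I_3 -> R[i] -> R) z : (forall k, rder (f k) z (a k z) (b k z)) ->
  rder (fun y => sum3 (f^~ y)) z (sum3 (a^~ z)) (sum3 (b^~ z)).
Proof. by move=> h; apply: rderD; [apply: rderD|]. Qed.

Variables (V : set R[i]) (w x y xx xy yy : 'I_3 -> R[i] -> R).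
Hypothesis c2 : C2 V w x y xx xy yy.
Hypothesis xL : forall z, V z -> sum3 (fun k => x k z * (xx k z + yy k z)) = 0.
Hypothesis yL : forall z, V z -> sum3 (fun k => y k z * (xx k z + yy k z)) = 0.

(** Four times the complex bilinear square of (w_x - i w_y) / 2; [dhopf] is its derivative in the
    real direction. *)
Definition hopf z : R[i] := (sum3 (fun k => x k z ^+ 2 - y k z ^+ 2) +i*
  (- 2 * sum3 (fun k => x k z * y k z)))%C.

Definition dhopf z : R[i] := (2 * sum3 (fun k => x k z * xx k z - y k z * xy k z) +i*
  (- 2 * sum3 (fun k => xx k z * y k z + x k z * xy k z)))%C.

Let cvg_sum3 (f : 'I_3 -> R[i] -> R) z : (forall k, f k @ cnbhs z --> f k z) ->
  (fun y => sum3 (f^~ y)) @ cnbhs z --> sum3 (f^~ z).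
Proof. by move=> h; apply: cvgD; [apply: cvgD|]. Qed.

(** The two defects in the Cauchy-Riemann equations are twice the inner products of the Laplacian
    with w_x and with w_y, which vanish by [xL] and [yL]. *)
Lemma holo_hopf : holo V hopf dhopf.
Proof.
move=> z Vz; have hx k := C2x c2 k Vz; have hy k := C2y c2 k Vz; split.
  apply: rder_cauchy_riemann.
    have -> : 2 * sum3 (fun k => x k z * xx k z - y k z * xy k z) =
        sum3 (fun k => xx k z * x k z + x k z * xx k z - (xy k z * y k z + y k z * xy k z)).
      by rewrite /sum3; ring.
    have -> : - (- 2 * sum3 (fun k => xx k z * y k z + x k z * xy k z)) =
        sum3 (fun k => xy k z * x k z + x k z * xy k z - (yy k z * y k z + y k z * yy k z)).
      by have := yL Vz; rewrite /sum3; lra.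
    apply: (@rder_sum3 (fun k z => x k z ^+ 2 - y k z ^+ 2)
      (fun k z => xx k z * x k z + x k z * xx k z - (xy k z * y k z + y k z * xy k z))
      (fun k z => xy k z * x k z + x k z * xy k z -
        (yy k z * y k z + y k z * yy k z))) => k.
    by apply: rderD; [|apply: rderN]; apply: rderM.
  have -> : 2 * sum3 (fun k => x k z * xx k z - y k z * xy k z) =
      - 2 * sum3 (fun k => xy k z * y k z + x k z * yy k z).
    by have := xL Vz; rewrite /sum3; lra.
  apply: rderZ.
  apply: (@rder_sum3 (fun k z => x k z * y k z)
    (fun k z => xx k z * y k z + x k z * xy k z)
    (fun k z => xy k z * y k z + x k z * yy k z)) => k.
  exact: rderM.
have cx k := rder_cont (hx k); have cy k := rder_cont (hy k).
apply: cto_ReIm => /=; apply: cvgM; try exact: cvg_cst;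
  [apply: (@cvg_sum3 (fun k z => x k z * xx k z - y k z * xy k z)) => k
  |apply: (@cvg_sum3 (fun k z => xx k z * y k z + x k z * xy k z)) => k].
  apply: cvgB; apply: cvgM => //; [exact: C2xx c2 _ _ Vz|exact: C2xy c2 _ _ Vz].
by apply: cvgD; apply: cvgM => //; [exact: C2xx c2 _ _ Vz|exact: C2xy c2 _ _ Vz].
Qed.

End C2Data.

(** * The Hopf differential vanishes *)

Section DecayObstruction.
Context {R : realType}.

(** [MVT_dist] asks for the derivative on an interval symmetric about its base point; seen from the
    midpoint this interval is exactly [[a, b]]. *)
Lemma slope_ge (f df : R -> R) (a b k : R) : a <= b ->
  (forall t, a <= t -> t <= b -> is_derive (t : R) 1 f (df t)) ->
  (forall t, a <= t -> t <= b -> k <= df t) -> k * (b - a) <= f b - f a.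
Proof.
move=> ab fd kd; pose x := (a + b) / 2; pose h := (b - a) / 2.
have h0 : 0 <= h by rewrite /h; lra.
have side s : `|s - x| <= `|h| -> a <= s /\ s <= b.
  by rewrite (ger0_norm h0) ler_norml /x /h => /andP[? ?]; split; lra.
have [s /side[a1 a2]|c1 /side[b1 b2] E1] := @MVT_dist R f df x h; first exact: fd.
have [s|c2 c2h E2] := @MVT_dist R f df x (- h); first by rewrite normrN => /side[a1 a2]; exact: fd.
move: c2h; rewrite normrN => /side[d1 d2].
have -> : f b - f a = df c1 * h + df c2 * h.
  have eb : x + h = b by rewrite /x /h; field.
  have ea : x - h = a by rewrite /x /h; field.
  by move: E1 E2; rewrite eb ea mulrN; lra.
have k1 := kd _ b1 b2; have k2 := kd _ d1 d2.
have -> : k * (b - a) = k * h + k * h by rewrite /h; field.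
by apply: lerD; rewrite ler_wpM2r.
Qed.

Lemma slope_le (f df : R -> R) (a b k : R) : a <= b ->
  (forall t, a <= t -> t <= b -> is_derive (t : R) 1 f (df t)) ->
  (forall t, a <= t -> t <= b -> df t <= k) -> f b - f a <= k * (b - a).
Proof.
move=> ab fd kd.
have : - k * (b - a) <= - f b - - f a; last by lra.
apply: (@slope_ge (fun t => - f t) (fun t => - df t) a b (- k) ab) => t ta tb.
  by apply: is_deriveN; exact: fd.
by rewrite lerN2; exact: kd.
Qed.

Lemma is_derive_div (f g : R -> R) (x a b : R) : g x != 0 ->
  is_derive x 1 f a -> is_derive x 1 g b ->
  is_derive x 1 (fun y => f y / g y) ((a * g x - f x * b) / g x ^+ 2).
Proof.
move=> gx da db.
have -> : (a * g x - f x * b) / g x ^+ 2 =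
    f x *: (- g x ^- 2 *: b) + (g x)^-1 *: a.
  by rewrite /GRing.scale /=; field.
exact: is_deriveM da (is_deriveV gx db).
Qed.

Variables (M M1 M2 A : R -> R) (t0 c : R).
Hypothesis t00 : t0 < (0 : R).
Hypothesis c0 : (0 : R) < c.
Hypothesis dM : forall t : R, t0 < t -> t < 0 -> is_derive (t : R) 1 M (M1 t).
Hypothesis dM1 : forall t : R, t0 < t -> t < 0 -> is_derive (t : R) 1 M1 (M2 t).
Hypothesis M_ge0 : forall t : R, t0 < t -> t < 0 -> 0 <= M t.
Hypothesis M2A : forall t : R, t0 < t -> t < 0 -> 7 / 2 * A t <= M2 t.
Hypothesis M1A : forall t : R, t0 < t -> t < 0 -> M1 t ^+ 2 <= 4 * M t * A t.
Hypothesis cA : forall t : R, t0 < t -> t < 0 -> c <= A t.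
Hypothesis M_to0 : forall e : R, 0 < e ->
  exists2 s : R, s < 0 & forall t : R, s < t -> t < 0 -> M t <= e.

(** Passage to the limit at 0 from the left: [- s] and [M s] can be made small together. *)
Let le_lim0 (x k s0 : R) : s0 < 0 -> 0 <= k ->
  (forall e s : R, 0 < e -> s0 < s -> s < 0 -> - s <= e -> M s <= e -> x <= k * e) -> x <= 0.
Proof.
move=> s00 k0 H; apply/ler_addgt0Pl => e e0; rewrite addr0.
pose e' := e / (k + 1); have k1 : 0 < k + 1 by lra.
have e'0 : 0 < e' by rewrite divr_gt0.
have [s1 s10 Ms] := M_to0 e'0.
pose m := Num.max (Num.max s0 s1) (- e'); pose s := m / 2.
have m0 : m < 0 by rewrite /m !gt_max s00 s10 oppr_lt0.
have ms : m < s by rewrite /s; lra.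
have s0' : s < 0 by rewrite /s; lra.
move: ms; rewrite {1}/m !gt_max => /andP[/andP[h1 h2] h3].
have h4 : - s <= e' by lra.
apply: (le_trans (H e' s e'0 h1 s0' h4 (Ms _ h2 s0'))).
have -> : e = (k + 1) * e' by rewrite /e' mulrC divfK// gt_eqF.
by rewrite ler_wpM2r ?ltW//; lra.
Qed.

Let slopeM a b k : t0 < a -> a <= b -> b < 0 ->
  (forall t, a <= t -> t <= b -> k <= M1 t) -> k * (b - a) <= M b - M a.
Proof.
move=> ta ab b0 h; apply: (@slope_ge M M1 a b k ab) => // t h1 h2.
by apply: dM; [exact: lt_le_trans h1|exact: le_lt_trans h2 _].
Qed.

Let slopeM1 a b : t0 < a -> a <= b -> b < 0 -> 7 / 2 * c * (b - a) <= M1 b - M1 a.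
Proof.
move=> ta ab b0; apply: (@slope_ge M1 M2 a b) => // t h1 h2.
  by apply: dM1; [exact: lt_le_trans h1|exact: le_lt_trans h2 _].
have h3 : t0 < t by exact: lt_le_trans h1.
have h4 : t < 0 by exact: le_lt_trans h2 _.
by have := cA h3 h4; have := M2A h3 h4; lra.
Qed.

(** [M] is strictly convex. If its slope were nonnegative somewhere, [M] would from then on be
    nondecreasing and become positive, and could not tend to 0. *)
Let M1_lt0 t : t0 < t -> t < 0 -> M1 t < 0.
Proof.
move=> h1 h2; rewrite ltNge; apply/negP => M1t.
have incr s s' : t <= s -> s <= s' -> s' < 0 -> M s <= M s'.
  move=> a1 a2 a3; rewrite -subr_ge0; have t0s : t0 < s by exact: lt_le_trans a1.
  have : 0 * (s' - s) <= M s' - M s; last by rewrite mul0r.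
  apply: slopeM => // r r1 r2.
  have h : t <= r by exact: le_trans r1.
  have := @slopeM1 t r h1 h (le_lt_trans r2 a3).
  have : 0 <= 7 / 2 * c * (r - t) by rewrite !mulr_ge0 ?subr_ge0 ?(ltW c0).
  lra.
pose s := t / 2; have ts : t < s by rewrite /s; lra.
have s0 : s < 0 by rewrite /s; lra.
have t0s : t0 < s by exact: lt_trans ts.
have M1s : 0 < M1 s.
  have := @slopeM1 t s h1 (ltW ts) s0.
  have : 0 < 7 / 2 * c * (s - t) by rewrite mulr_gt0 ?subr_gt0 ?mulr_gt0.
  lra.
have Ms : 0 < M s.
  rewrite lt_neqAle M_ge0// andbT; apply/eqP => Ms.
  have := M1A t0s s0; rewrite -Ms mulr0 mul0r => h.
  by have := exprn_gt0 2 M1s; lra.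
have [r r0 Mr] := M_to0 (divr_gt0 Ms (ltr0n R 2)).
pose q := Num.max s r / 2.
have m0 : Num.max s r < 0 by rewrite gt_max s0.
have q0 : q < 0 by rewrite /q; lra.
have : Num.max s r < q by rewrite /q; lra.
rewrite gt_max => /andP[sq rq].
have := Mr q rq q0; have := incr _ _ (ltW ts) (ltW sq) q0; lra.
Qed.

(** The tangent at [t] lies below the convex graph; at time 0, where [M] tends to 0, its height is
    [M t - M1 t * t]. *)
Let M_le t : t0 < t -> t < 0 -> M t <= M1 t * t.
Proof.
move=> h1 h2; rewrite -subr_le0; have k0 := M1_lt0 h1 h2.
apply: (@le_lim0 _ 1 t h2 ler01) => e s e0 ts s0 se Ms.
have := @slopeM t s (M1 t) h1 (ltW ts) s0.
have -> : M1 t * (s - t) = M1 t * s - M1 t * t by ring.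
move=> H; have {}H : M1 t * s - M1 t * t <= M s - M t.
  apply: H => r tr rs.
  have := @slopeM1 t r h1 tr (le_lt_trans rs s0).
  have : 0 <= 7 / 2 * c * (r - t) by rewrite !mulr_ge0 ?subr_ge0 ?(ltW c0).
  lra.
have : 0 <= M1 t * s by rewrite mulr_le0 ?ltW.
lra.
Qed.

Let M_gt0 t : t0 < t -> t < 0 -> 0 < M t.
Proof.
move=> h1 h2; rewrite lt_neqAle M_ge0// andbT; apply/eqP => Mt.
have := M1A h1 h2; rewrite -Mt mulr0 mul0r.
have := M1_lt0 h1 h2 => k0; have : 0 < M1 t ^+ 2 by rewrite exprn_even_gt0//= lt_eqF.
lra.
Qed.

(** M M2 >= (7/8) M1^2 bounds the derivative of M / M1 by 1 / 8. By [M_le] this quotient tends to 0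
    at 0, so it can be integrated from [t] to 0. *)
Let M_le8 t : t0 < t -> t < 0 -> M t <= M1 t * (t / 8).
Proof.
move=> h1 h2; have k0 := M1_lt0 h1 h2.
suff : t / 8 - M t / M1 t <= 0 by rewrite subr_le0 ler_ndivlMr// mulrC.
apply: (@le_lim0 _ 1 t h2 ler01) => e s e0 ts s0 se _.
have t0s : t0 < s by exact: lt_trans ts.
have Ws : s <= M s / M1 s by rewrite ler_ndivlMr ?M1_lt0// mulrC M_le.
have : M s / M1 s - M t / M1 t <= 1 / 8 * (s - t); last by lra.
apply: (@slope_le (fun t => M t / M1 t)
  (fun t => (M1 t * M1 t - M t * M2 t) / M1 t ^+ 2)) (ltW ts) _ _ => r tr rs.
  have r1 : t0 < r by exact: lt_le_trans tr.
  have r2 : r < 0 by exact: le_lt_trans s0.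
  apply: is_derive_div; [by rewrite lt_eqF ?M1_lt0|exact: dM|exact: dM1].
have r1 : t0 < r by exact: lt_le_trans tr.
have r2 : r < 0 by exact: le_lt_trans s0.
have kr := M1_lt0 r1 r2.
rewrite ler_pdivrMr; last by rewrite exprn_even_gt0//= lt_eqF.
have := M1A r1 r2; have := M2A r1 r2 => /(ler_wpM2l (ltW (M_gt0 r1 r2))).
have -> : M r * (7 / 2 * A r) = 7 / 8 * (4 * M r * A r) by field.
rewrite expr2; lra.
Qed.

(* [(M / M1)' <= 1 / 8] improves [M <= |M1| |t|] by the factor 8, so that
   [M1' >= 7 |M1| / |t|]; then [|M1|] is at most quadratic in [t], whereas
   [M1' >= 7 c / 2] makes it at least linear. *)
Lemma decay_obstruction : False.
Proof.
have [t h1 h2] : exists2 t : R, t0 < t & t < 0.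
  by exists (t0 / 2); move: t00; lra.
have k0 := M1_lt0 h1 h2.
have c72 : 0 < 7 / 2 * c by rewrite mulr_gt0// divr_gt0.
suff : 7 / 2 * c <= 0 by rewrite leNgt c72.
pose N := M1 t / t ^+ 2.
have N0 : N < 0 by rewrite /N pmulr_llt0// invr_gt0 exprn_even_gt0//= lt_eqF.
have NK : 0 <= - N by lra.
apply: (@le_lim0 _ (- N) t h2 NK) => e s e0 ts s0 se _.
have t0s : t0 < s by exact: lt_trans ts.
(* M1 / t^2 is nondecreasing: [M_le8] in M1^2 <= 4 M A gives A t / 2 <= M1, and with M2 >= (7/2) A
   the derivative has the right sign. *)
have Ns : N * s ^+ 2 <= M1 s.
  rewrite -ler_pdivlMr; last by rewrite exprn_even_gt0//= lt_eqF.
  have : 0 * (s - t) <= M1 s / s ^+ 2 - M1 t / t ^+ 2; last by rewrite mul0r subr_ge0.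
  apply: (@slope_ge (fun t => M1 t / t ^+ 2)
    (fun t => (M2 t * t ^+ 2 - M1 t * (2 * t)) / (t ^+ 2) ^+ 2)) (ltW ts) _ _ => r tr rs.
    have r2 : r < 0 by exact: le_lt_trans s0.
    apply: (@is_derive_div M1 (fun t => t ^+ 2)).
    - by rewrite expf_eq0/= lt_eqF.
    - by apply: dM1 => //; exact: lt_le_trans tr.
    - have := @is_deriveX R R id 2 r 1 1 _; rewrite /GRing.scale /= expr1 mulr1.
      by apply; exact: is_derive_id.
  have r1 : t0 < r by exact: lt_le_trans tr.
  have r2 : r < 0 by exact: le_lt_trans s0.
  have kr := M1_lt0 r1 r2.
  rewrite divr_ge0 ?sqr_ge0//.
  have -> : M2 r * r ^+ 2 - M1 r * (2 * r) = - r * (2 * M1 r - r * M2 r) by ring.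
  apply: mulr_ge0; first by lra.
  have Ar : A r * r / 2 <= M1 r.
    rewrite -(ler_nM2l kr) -expr2.
    have Ap : 0 <= A r by have := cA r1 r2; lra.
    have := ler_wpM2r Ap (M_le8 r1 r2); have := M1A r1 r2.
    lra.
  have M2r : M2 r * r <= 7 / 2 * A r * r by rewrite ler_wnM2r ?(ltW r2)// M2A.
  lra.
have Ms : M1 s <= 7 / 2 * c * s.
  rewrite -subr_le0.
  have kc : 0 <= 7 / 2 * c by lra.
  apply: (@le_lim0 _ (7 / 2 * c) s s0 kc) => e' r e'0 sr r0 re' _.
  have := @slopeM1 s r t0s (ltW sr) r0.
  have := M1_lt0 (lt_trans t0s sr) r0.
  have := ler_wpM2l kc re'.
  lra.
have : 7 / 2 * c <= N * s.
  rewrite -(ler_nM2r s0) -[N * s * s]mulrA -expr2.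
  exact: le_trans Ns Ms.
have := ler_wpM2l NK se; lra.
Qed.

End DecayObstruction.

(** Lagrange's identity: the defect is a sum of three squares. *)
Lemma sum3_CS {R : realType} (a b : 'I_3 -> R) :
  sum3 (fun k => a k * b k) ^+ 2 <= sum3 (fun k => a k ^+ 2) * sum3 (fun k => b k ^+ 2).
Proof.
rewrite /sum3; move: (a 0) (a 1) (a 2) (b 0) (b 1) (b 2) => a0 a1 a2 b0 b1 b2.
rewrite -subr_ge0.
have -> : (a0 ^+ 2 + a1 ^+ 2 + a2 ^+ 2) * (b0 ^+ 2 + b1 ^+ 2 + b2 ^+ 2) -
    (a0 * b0 + a1 * b1 + a2 * b2) ^+ 2 =
    (a0 * b1 - a1 * b0) ^+ 2 + (a0 * b2 - a2 * b0) ^+ 2 + (a1 * b2 - a2 * b1) ^+ 2.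
  by ring.
by rewrite !addr_ge0 ?sqr_ge0.
Qed.

Lemma sum3_ge0 {R : realType} (a : 'I_3 -> R) : (forall k, 0 <= a k) -> 0 <= sum3 a.
Proof. by move=> h; rewrite /sum3 !addr_ge0. Qed.

(** * Calculus and circle means in the coordinate exp(t + i s) *)

Section PolarCalculus.
Context {R : realType}.
Implicit Types (F G : R[i] -> R).

Definition polar (t s : R) : R[i] := (expR t)%:C%C * cis s.

Lemma normc_polar t s : normc (polar t s) = expR t.
Proof.
rewrite /polar (normcM (expR t)%:C%C) normc_cis mulr1 normc_real.
by rewrite gtr0_norm ?expR_gt0.
Qed.

Lemma polar_disc (t s : R) : t < 0 -> disc 0 1 (polar t s).
Proof.
by move=> t0; rewrite /disc /mkset subr0 normc_polar expR_lt1.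
Qed.

Lemma polar2pi t : polar t 0 = polar t (2 * pi).
Proof. by rewrite /polar cis0 cis2pi. Qed.

Lemma dcurve_polar1 (s t : R) : dcurve (polar^~ s) t (polar t s).
Proof.
have h : dcurve (fun t : R => (expR t)%:C%C) t (expR t)%:C%C.
  by split => /=; [exact: is_derive_expR|exact: is_derive_cst].
have := dcurveM h (dcurve_cst (cis s) t).
by rewrite mulr0 addr0.
Qed.

Lemma dcurve_polar2 (t s : R) : dcurve (polar t) s ('i%C * polar t s).
Proof.
apply: dcurve_eq (dcurveZ _ (dcurve_cis s)) _; by rewrite /polar mulrCA.
Qed.

Lemma cto_polar_log (t s : R) :
  cto (nbhs (t, s)) (fun p : R * R => polar p.1 p.2) (polar t s).
Proof.
apply: ctoM.
  apply: cto_real; apply: (cvg_comp _ _ (@cvg_fst _ _ (nbhs t) (nbhs s) _)).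
  exact: continuous_expR.
apply: (cto_cvg_comp (@cvg_snd _ _ (nbhs t) (nbhs s) _)); exact: ccurve_cis.
Qed.

Definition cont_disc F := forall z, disc 0 1 z -> F @ cnbhs z --> F z.

(** Both derivatives are functions of the point of the disc rather than of (t, s), so the same rules
    apply to them again. *)
Definition polar_der F F1 F2 := forall t s : R, t < 0 ->
  is_derive t 1 (fun t => F (polar t s)) (F1 (polar t s)) /\
  is_derive s 1 (fun s => F (polar t s)) (F2 (polar t s)).

Lemma cont_discD F G : cont_disc F -> cont_disc G -> cont_disc (fun z => F z + G z).
Proof. by move=> cF cG z hz; apply: cvgD; [exact: cF|exact: cG]. Qed.

Lemma cont_discN F : cont_disc F -> cont_disc (fun z => - F z).
Proof. by move=> cF z hz; apply: cvgN; exact: cF. Qed.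

Lemma cont_discM F G : cont_disc F -> cont_disc G -> cont_disc (fun z => F z * G z).
Proof. by move=> cF cG z hz; apply: cvgM; [exact: cF|exact: cG]. Qed.

Lemma cont_disc_cst (c : R) : cont_disc (fun=> c).
Proof. by move=> z hz; exact: cvg_cst. Qed.

Lemma cont_disc_sum3 (F : 'I_3 -> R[i] -> R) : (forall k, cont_disc (F k)) ->
  cont_disc (fun z => sum3 (F^~ z)).
Proof. by move=> h; apply: cont_discD => //; exact: cont_discD. Qed.

Lemma polar_derD F F1 F2 G G1 G2 : polar_der F F1 F2 -> polar_der G G1 G2 ->
  polar_der (fun z => F z + G z) (fun z => F1 z + G1 z) (fun z => F2 z + G2 z).
Proof.
move=> dF dG t s t0; have [f1 f2] := dF t s t0; have [g1 g2] := dG t s t0.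
by split; exact: is_deriveD.
Qed.

Lemma polar_derM F F1 F2 G G1 G2 : polar_der F F1 F2 -> polar_der G G1 G2 ->
  polar_der (fun z => F z * G z) (fun z => F1 z * G z + F z * G1 z)
    (fun z => F2 z * G z + F z * G2 z).
Proof.
move=> dF dG t s t0; have [f1 f2] := dF t s t0; have [g1 g2] := dG t s t0.
split.
  have := is_deriveM f1 g1; rewrite /GRing.scale /= => h.
  by rewrite addrC [F1 _ * _]mulrC.
have := is_deriveM f2 g2; rewrite /GRing.scale /= => h.
by rewrite addrC [F2 _ * _]mulrC.
Qed.

Lemma polar_derN F F1 F2 : polar_der F F1 F2 ->
  polar_der (fun z => - F z) (fun z => - F1 z) (fun z => - F2 z).
Proof.
by move=> dF t s t0; have [f1 f2] := dF t s t0; split; exact: is_deriveN.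
Qed.

Lemma polar_der_sum3 (F F1 F2 : 'I_3 -> R[i] -> R) :
  (forall k, polar_der (F k) (F1 k) (F2 k)) ->
  polar_der (fun z => sum3 (F^~ z)) (fun z => sum3 (F1^~ z)) (fun z => sum3 (F2^~ z)).
Proof. by move=> h; apply: polar_derD => //; exact: polar_derD. Qed.

Definition polar_mean F (t : R) : R := mean (fun s => F (polar t s)).

Lemma cont_polar F t : cont_disc F -> t < 0 -> continuous (fun s => F (polar t s)).
Proof.
move=> cF t0 s.
have h : (polar t) @ s --> cnbhs (polar t s).
  move=> A [d d0 dA]; have := dcurve_cont (dcurve_polar2 t s) d0.
  by apply: filterS => ?; exact: dA.
exact: (cvg_comp _ _ h (cF _ (polar_disc s t0))).
Qed.

Lemma cont_polar2 F t s : cont_disc F -> t < 0 ->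
  {for (t, s), continuous (fun p : R * R => F (polar p.1 p.2))}.
Proof.
move=> cF t0.
have h : (fun p : R * R => polar p.1 p.2) @ (t, s) --> cnbhs (polar t s).
  by move=> A [d d0 dA]; have := cto_polar_log t s d0; apply: filterS => ?; exact: dA.
exact: (cvg_comp _ _ h (cF _ (polar_disc s t0))).
Qed.

Lemma is_derive_polar_mean F F1 F2 (t : R) : polar_der F F1 F2 -> cont_disc F ->
  cont_disc F1 -> t < 0 -> is_derive t 1 (polar_mean F) (polar_mean F1 t).
Proof.
move=> dF cF cF1 t0.
have nt : \forall r \near t, r < 0.
  by apply: (@cvgr_lt _ _ (nbhs t) _ id t); first exact: cvg_id.
apply: (@is_derive_mean R (fun t s => F (polar t s)) (fun t s => F1 (polar t s))).
- by apply: filterS nt => r r0 s; have [] := dF r s r0.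
- by apply: filterS nt => r r0; exact: cont_polar.
- by move=> s; exact: cont_polar2.
Qed.

Lemma polar_mean_der2 F F1 F2 (t : R) : polar_der F F1 F2 -> cont_disc F2 -> t < 0 ->
  polar_mean F2 t = 0.
Proof.
move=> dF cF2 t0; apply: (@mean_derive R (fun s => F (polar t s))).
- by move=> s; have [] := dF t s t0.
- exact: cont_polar.
- by rewrite polar2pi.
Qed.

Lemma polar_meanD F G t : cont_disc F -> cont_disc G -> t < 0 ->
  polar_mean (fun z => F z + G z) t = polar_mean F t + polar_mean G t.
Proof. by move=> cF cG t0; apply: meanD; exact: cont_polar. Qed.

Lemma polar_meanZ k F t : cont_disc F -> t < 0 -> polar_mean (fun z => k * F z) t = k * polar_mean F t.
Proof. by move=> cF t0; apply: meanZ; exact: cont_polar. Qed.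

Lemma le_polar_mean F G t : cont_disc F -> cont_disc G -> t < 0 ->
  (forall s, F (polar t s) <= G (polar t s)) -> polar_mean F t <= polar_mean G t.
Proof. by move=> cF cG t0 FG; apply: le_mean => //; exact: cont_polar. Qed.

End PolarCalculus.

(** The squared modulus is (|x|^2 - |y|^2)^2 + 4 (x . y)^2; Cauchy-Schwarz completes it to the
    square of the sum. *)
Lemma normc_hopf {R : realType} (x y : 'I_3 -> R[i] -> R) z :
  normc (hopf x y z) <= sum3 (fun k => x k z ^+ 2) + sum3 (fun k => y k z ^+ 2).
Proof.
have := sum3_CS (x^~ z) (y^~ z).
have E : normc (hopf x y z) ^+ 2 =
    (sum3 (fun k => x k z ^+ 2) - sum3 (fun k => y k z ^+ 2)) ^+ 2 +
    4 * sum3 (fun k => x k z * y k z) ^+ 2.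
  by rewrite normc_sqr /= /sum3; ring.
have : 0 <= sum3 (fun k => x k z ^+ 2) by apply: sum3_ge0 => k; exact: sqr_ge0.
have : 0 <= sum3 (fun k => y k z ^+ 2) by apply: sum3_ge0 => k; exact: sqr_ge0.
move: E; set p := sum3 (fun k => x k z ^+ 2); set q := sum3 (fun k => y k z ^+ 2).
set c := sum3 (fun k => x k z * y k z) => E q0 p0 hc.
rewrite -ler_sqr ?nnegrE ?normc_ge0 ?(addr_ge0 p0 q0)// E.
by have -> : (p + q) ^+ 2 = (p - q) ^+ 2 + 4 * (p * q); [ring|rewrite lerD2l ler_pM2l].
Qed.

(** * Pull-back to the disc and the differential inequality *)

Section HopfVanishing.
Context {R : realType}.
Variables (V : set R[i]) (w x y xx xy yy : 'I_3 -> R[i] -> R).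
Hypothesis c2 : C2 V w x y xx xy yy.
Hypothesis xL : forall z, V z -> sum3 (fun k => x k z * (xx k z + yy k z)) = 0.
Hypothesis yL : forall z, V z -> sum3 (fun k => y k z * (xx k z + yy k z)) = 0.
Variables (f f1 : R[i] -> R[i]).
Hypothesis Hf : holo (disc 0 1) f f1.
Hypothesis fV : forall z, disc 0 1 z -> V (f z).
Variable eps : R.
Hypothesis eps0 : 0 < eps.
Hypothesis small_near_bdry : forall z, V z -> sum3 (fun k => w k z ^+ 2) <= eps ->
  `|sum3 (fun k => w k z * (xx k z + yy k z))| <=
    1 / 8 * sum3 (fun k => x k z ^+ 2 + y k z ^+ 2).
Hypothesis vanish_near_bdry : forall e : R, 0 < e -> exists2 r : R, r < 1 &
  forall z, disc 0 1 z -> r < normc z -> sum3 (fun k => w k (f z) ^+ 2) <= e.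

Lemma polar_der_eq (F F1 F2 G1 G2 : R[i] -> R) : polar_der F F1 F2 ->
  F1 =1 G1 -> F2 =1 G2 -> polar_der F G1 G2.
Proof. by move=> dF /funext <- /funext <-. Qed.

Section Second.
Variable f2 : R[i] -> R[i].
Hypothesis Hf1 : holo (disc 0 1) f1 f2.

(** The t-derivative of [f] in the coordinate exp(t + i s); [K2] is that of [K1]. Derivatives in s
    have an additional factor i. *)
Let K1 z := f1 z * z.
Let K2 z := f2 z * z ^+ 2 + f1 z * z.

Let K1_der z : disc 0 1 z -> cder K1 z (f2 z * z + f1 z).
Proof.
by move=> /Hf1[h _]; have := cderM h (cder_id z); rewrite mulr1.
Qed.

Let dcurve_K1 (t s : R) : t < 0 ->
  dcurve (fun t => K1 (polar t s)) t (K2 (polar t s)) /\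
  dcurve (fun s => K1 (polar t s)) s ('i%C * K2 (polar t s)).
Proof.
move=> t0; have h := K1_der (polar_disc s t0); split.
  by apply: dcurve_eq (dcurve_comp (c := polar^~ s) h (dcurve_polar1 s t)) _; rewrite /K2; ring.
by apply: dcurve_eq (dcurve_comp (c := polar t) h (dcurve_polar2 t s)) _; rewrite /K2; ring.
Qed.

Let dA : polar_der (fun z => Re (K1 z)) (fun z => Re (K2 z)) (fun z => - Im (K2 z)).
Proof.
move=> t s t0; have [[h1 _] [h2 _]] := dcurve_K1 s t0; split => //.
by move: h2; rewrite ReM /= mul0r sub0r mul1r.
Qed.

Let dB : polar_der (fun z => Im (K1 z)) (fun z => Im (K2 z)) (fun z => Re (K2 z)).
Proof.
move=> t s t0; have [[_ h1] [_ h2]] := dcurve_K1 s t0; split => //.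
by move: h2; rewrite ImM /= mul0r add0r mul1r.
Qed.

Let polar_der_pull (F a b : R[i] -> R) : (forall z, V z -> rder F z (a z) (b z)) ->
  polar_der (fun z => F (f z))
    (fun z => a (f z) * Re (K1 z) + b (f z) * Im (K1 z))
    (fun z => a (f z) * - Im (K1 z) + b (f z) * Re (K1 z)).
Proof.
move=> dF t s t0; have hz := polar_disc s t0; have [hf _] := Hf hz.
have hF := dF _ (fV hz); split.
  exact: (is_derive_rder (c := fun t => f (polar t s)) hF
    (dcurve_comp (c := polar^~ s) hf (dcurve_polar1 s t))).
have := is_derive_rder (c := fun s => f (polar t s)) hF
  (dcurve_comp (c := polar t) hf (dcurve_polar2 t s)).
have -> : f1 (polar t s) * ('i%C * polar t s) = 'i%C * K1 (polar t s).
  by rewrite /K1; ring.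
have [-> ->] : Re ('i%C * K1 (polar t s)) = - Im (K1 (polar t s)) /\
    Im ('i%C * K1 (polar t s)) = Re (K1 (polar t s)).
  by case: (K1 _) => a' b'; rewrite /= !mul0r !mul1r sub0r add0r.
by [].
Qed.

Let cK1 z : disc 0 1 z -> ccont K1 z.
Proof. by move=> /K1_der /cder_cont. Qed.

Let cK2 z : disc 0 1 z -> ccont K2 z.
Proof.
move=> hz; have [_ h2] := Hf1 hz; have [_ h1] := Hf hz.
apply: ctoD; apply: ctoM => //; last exact: ccont_id.
by rewrite expr2; under eq_fun do rewrite expr2; apply: ctoM; exact: ccont_id.
Qed.

Let cA : cont_disc (fun z => Re (K1 z)).
Proof. by move=> z /cK1; exact: cto_Re. Qed.
Let cB : cont_disc (fun z => Im (K1 z)).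
Proof. by move=> z /cK1; exact: cto_Im. Qed.
Let cA2 : cont_disc (fun z => Re (K2 z)).
Proof. by move=> z /cK2; exact: cto_Re. Qed.
Let cB2 : cont_disc (fun z => Im (K2 z)).
Proof. by move=> z /cK2; exact: cto_Im. Qed.

Let cont_disc_pull (F : R[i] -> R) : (forall z, V z -> F @ cnbhs z --> F z) ->
  cont_disc (fun z => F (f z)).
Proof.
move=> cF z hz; have h : f @ cnbhs z --> cnbhs (f z).
  by move=> P [d d0 dP]; have := holo_cont Hf hz d0; apply: filterS => ?; exact: dP.
exact: (cvg_comp _ _ h (cF _ (fV hz))).
Qed.

Let W k z := w k (f z).
Let ut k z := x k (f z) * Re (K1 z) + y k (f z) * Im (K1 z).
Let us k z := x k (f z) * - Im (K1 z) + y k (f z) * Re (K1 z).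
Let utt k z :=
  (xx k (f z) * Re (K1 z) + xy k (f z) * Im (K1 z)) * Re (K1 z) + x k (f z) * Re (K2 z) +
  ((xy k (f z) * Re (K1 z) + yy k (f z) * Im (K1 z)) * Im (K1 z) + y k (f z) * Im (K2 z)).
Let uts k z :=
  (xx k (f z) * - Im (K1 z) + xy k (f z) * Re (K1 z)) * Re (K1 z) + x k (f z) * - Im (K2 z) +
  ((xy k (f z) * - Im (K1 z) + yy k (f z) * Re (K1 z)) * Im (K1 z) + y k (f z) * Re (K2 z)).
Let uss k z :=
  (xx k (f z) * - Im (K1 z) + xy k (f z) * Re (K1 z)) * - Im (K1 z) + x k (f z) * - Re (K2 z) +
  ((xy k (f z) * - Im (K1 z) + yy k (f z) * Re (K1 z)) * Re (K1 z) + y k (f z) * - Im (K2 z)).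

Let dW k : polar_der (W k) (ut k) (us k).
Proof. by apply: polar_der_pull => z; exact: (C2w c2). Qed.
Let dX k := polar_der_pull (C2x c2 k).
Let dY k := polar_der_pull (C2y c2 k).
Let dut k : polar_der (ut k) (utt k) (uts k).
Proof. exact: (polar_derD (polar_derM (dX k) dA) (polar_derM (dY k) dB)). Qed.
Let dus k : polar_der (us k) (uts k) (uss k).
Proof.
apply: polar_der_eq (polar_derD (polar_derM (dX k) (polar_derN dB))
  (polar_derM (dY k) dA)) _ _ => z //.
by rewrite /uts /=; ring.
Qed.

Let cW k : cont_disc (W k).
Proof. by apply: cont_disc_pull => z /(C2w c2 k); exact: rder_cont. Qed.
Let cX k : cont_disc (fun z => x k (f z)).
Proof. by apply: cont_disc_pull => z /(C2x c2 k); exact: rder_cont. Qed.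
Let cY k : cont_disc (fun z => y k (f z)).
Proof. by apply: cont_disc_pull => z /(C2y c2 k); exact: rder_cont. Qed.
Let cXX k : cont_disc (fun z => xx k (f z)).
Proof. by apply: cont_disc_pull => z Vz; exact: C2xx c2 _ _ Vz. Qed.
Let cXY k : cont_disc (fun z => xy k (f z)).
Proof. by apply: cont_disc_pull => z Vz; exact: C2xy c2 _ _ Vz. Qed.
Let cYY k : cont_disc (fun z => yy k (f z)).
Proof. by apply: cont_disc_pull => z Vz; exact: C2yy c2 _ _ Vz. Qed.

Let cut k : cont_disc (ut k).
Proof. by apply: cont_discD; apply: cont_discM. Qed.
Let cus k : cont_disc (us k).
Proof. by apply: cont_discD; apply: cont_discM => //; exact: cont_discN. Qed.
Let cutt k : cont_disc (utt k).
Proof.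
by apply: cont_discD; apply: cont_discD; apply: cont_discM => //;
  apply: cont_discD; apply: cont_discM.
Qed.
Let cuss k : cont_disc (uss k).
Proof.
have cBN := cont_discN cB; have cA2N := cont_discN cA2; have cB2N := cont_discN cB2.
by apply: cont_discD; apply: cont_discD; apply: cont_discM => //;
  apply: cont_discD; apply: cont_discM.
Qed.

(* With [u = w \o f] in the coordinate [exp (t + i s)], the functions [ut], [us],
   [utt], [uts], [uss] are the partial derivatives of [u], and
   [u_tt + u_ss = |K1|^2 (Lap w) \o f]. *)
Let m0 z := sum3 (fun k => W k z * W k z).
Let m1 z := sum3 (fun k => W k z * ut k z).
Let n1 z := sum3 (fun k => W k z * us k z).
Let m2 z := sum3 (fun k => ut k z * ut k z + W k z * utt k z).
Let n2 z := sum3 (fun k => us k z * us k z + W k z * uss k z).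
Let a1 z := sum3 (fun k => ut k z * ut k z).
Let a2 z := sum3 (fun k => us k z * us k z).

Let cm0 : cont_disc m0.
Proof. by apply: cont_disc_sum3 => k; apply: cont_discM. Qed.
Let cm1 : cont_disc m1.
Proof. by apply: cont_disc_sum3 => k; apply: cont_discM. Qed.
Let cm2 : cont_disc m2.
Proof. by apply: cont_disc_sum3 => k; apply: cont_discD; apply: cont_discM. Qed.
Let cn2 : cont_disc n2.
Proof. by apply: cont_disc_sum3 => k; apply: cont_discD; apply: cont_discM. Qed.
Let ca1 : cont_disc a1.
Proof. by apply: cont_disc_sum3 => k; apply: cont_discM. Qed.
Let ca2 : cont_disc a2.
Proof. by apply: cont_disc_sum3 => k; apply: cont_discM. Qed.

Let dm0 (t : R) : t < 0 -> is_derive (t : R) 1 (polar_mean m0) (2 * polar_mean m1 t).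
Proof.
move=> t0; rewrite -polar_meanZ//.
apply: (@is_derive_polar_mean R m0 (fun z => 2 * m1 z) (fun z => 2 * n1 z)) => //.
  apply: polar_der_eq (polar_der_sum3 (fun k => polar_derM (dW k) (dW k))) _ _ => z;
    rewrite /m1 /n1 /sum3; ring.
by apply: cont_discM => //; exact: cont_disc_cst.
Qed.

Let dm1 (t : R) : t < 0 -> is_derive (t : R) 1 (fun t => 2 * polar_mean m1 t) (2 * polar_mean m2 t).
Proof.
move=> t0; apply: is_deriveZ.
exact: (@is_derive_polar_mean R m1 m2 _ t
  (polar_der_sum3 (fun k => polar_derM (dW k) (dut k)))).
Qed.

Let mean_n2 (t : R) : t < 0 -> polar_mean n2 t = 0.
Proof.
exact: (@polar_mean_der2 R n1 _ n2 t
  (polar_der_sum3 (fun k => polar_derM (dW k) (dus k)))).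
Qed.

Let X2 z := sum3 (fun k => x k z ^+ 2).
Let Y2 z := sum3 (fun k => y k z ^+ 2).

Let a12 z : a1 z + a2 z = normc (K1 z) ^+ 2 * (X2 (f z) + Y2 (f z)).
Proof. by rewrite normc_sqr /a1 /a2 /ut /us /X2 /Y2 /sum3; ring. Qed.

(** The Hopf differential of [w \o f] in the coordinate z; the factor [z * z] turns it into the one
    in the coordinate t + i s. *)
Let Q z := hopf x y (f z) * (f1 z * f1 z).

Let ReQ z : Re (Q z * (z * z)) = a1 z - a2 z.
Proof.
have -> : Q z * (z * z) = hopf x y (f z) * (K1 z * K1 z) by rewrite /Q /K1; ring.
rewrite /hopf /a1 /a2 /ut /us /sum3; move: (K1 z) => [a b].
by rewrite !(ReM, ImM) /=; ring.
Qed.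

Let normcQ z : normc (Q z * (z * z)) <= a1 z + a2 z.
Proof.
have -> : Q z * (z * z) = hopf x y (f z) * (K1 z * K1 z) by rewrite /Q /K1; ring.
rewrite (normcM (hopf x y (f z))) (normcM (K1 z)) -expr2 a12 mulrC ler_wpM2l ?sqr_ge0//.
exact: normc_hopf.
Qed.

Let Q_holo : exists Q', holo (disc 0 1) Q Q'.
Proof.
eexists; apply: holoM; last exact: holoM Hf1 Hf1.
exact: holo_comp (holo_hopf c2 xL yL) Hf fV.
Qed.

Let QQ_holo : exists Q', holo (disc 0 1) (fun z => Q z * (z * z)) Q'.
Proof.
have [Q' hQ] := Q_holo; eexists; apply: (holoM hQ).
by apply: holoM; exact: holo_id.
Qed.

Let expR_in (t : R) : t < 0 -> 0 <= expR t < 1.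
Proof. by move=> t0; rewrite expR_ge0 expR_lt1. Qed.

(** [Q z * (z * z)] is holomorphic on the whole disc and vanishes at 0, so the mean of its real part
    [a1 - a2] is 0. *)
Let mean_a12 (t : R) : t < 0 -> polar_mean a1 t = polar_mean a2 t.
Proof.
move=> t0; have [Q' hQ] := QQ_holo.
have := mean_value hQ (expR_in t0); rewrite mulr0 mulr0 => /(congr1 (@Re R)) /= h.
apply/eqP; rewrite -subr_eq0; apply/eqP; rewrite -[RHS]h -meanB; last 2 first.
- exact: cont_polar.
- exact: cont_polar.
by congr mean; apply/funext => s; rewrite add0r -/(polar t s) ReQ.
Qed.

(** The mean value property bounds |Q 0| by the mean of |Q|, and exp(2 t) |Q| <= a1 + a2, whose mean
    is twice that of [a1]. The restriction to t > -1 turns exp(2 t) into a constant. *)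
Let A_lower (t : R) : -1 < t -> t < 0 -> expR (- 2) / 2 * normc (Q 0) <= polar_mean a1 t.
Proof.
move=> t1 t0; have [Q' hQ] := Q_holo.
have E s : normc (Q (polar t s)) = normc (Q (0 + (expR t)%:C%C * cis s)).
  by rewrite add0r.
have hs : `|expR t| < 1 by rewrite gtr0_norm ?expR_gt0// expR_lt1.
have ccQ : ccurve (fun s => Q (0 + (expR t)%:C%C * cis s)) by exact: ccurve_on_circle hQ _ hs.
have cQ : continuous (fun s => normc (Q (polar t s))).
  by under eq_fun do rewrite E; exact: ccurve_normc ccQ.
have h1 : normc (Q 0) <= mean (fun s => normc (Q (polar t s))).
  rewrite -(mean_value hQ (expR_in t0)).
  apply: (le_trans (normc_cmean ccQ)); apply: le_mean => //; first exact: ccurve_normc.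
  by move=> s; rewrite E.
have h2 : expR t ^+ 2 * mean (fun s => normc (Q (polar t s))) <= polar_mean a1 t + polar_mean a2 t.
  rewrite -polar_meanD// -meanZ//; apply: le_mean => [||s].
  - by move=> s; apply: cvgM; [exact: cvg_cst|exact: cQ].
  - exact: (cont_polar (F := fun z => a1 z + a2 z) (cont_discD ca1 ca2) t0).
  apply: le_trans (normcQ (polar t s)).
  by rewrite (normcM (Q (polar t s))) (normcM (polar t s)) normc_polar -expr2 mulrC.
rewrite -(mean_a12 t0) in h2.
have h3 : expR (- 2) <= expR t ^+ 2 by rewrite -expRM_natl ler_expR; lra.
have := ler_wpM2r (normc_ge0 (Q 0)) h3.
have := ler_wpM2l (sqr_ge0 (expR t)) h1; lra.
Qed.

(** Adding [n2] changes no mean, as it is an s-derivative of a periodic function. The sum [m2 + n2]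
    contains the full Laplacian, whose contribution is at most 1 / 8 of [a1 + a2]; the equal means
    of [a1] and [a2] and the factor 2 turn 7 / 8 into 7 / 2. *)
Let M2_lower (t : R) : t < 0 -> (forall s, m0 (polar t s) <= eps) ->
  7 / 2 * polar_mean a1 t <= 2 * polar_mean m2 t.
Proof.
move=> t0 small.
suff : 7 / 8 * (polar_mean a1 t + polar_mean a2 t) <= polar_mean m2 t + polar_mean n2 t.
  by rewrite (mean_n2 t0) -(mean_a12 t0); lra.
rewrite -(polar_meanD cm2 cn2 t0) -(polar_meanD ca1 ca2 t0) -(polar_meanZ (7 / 8) (cont_discD ca1 ca2) t0).
apply: le_polar_mean => //; [|exact: cont_discD|move=> s].
  by apply: cont_discM; [exact: cont_disc_cst|exact: cont_discD].
set z := polar t s.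
have -> : m2 z + n2 z = a1 z + a2 z + normc (K1 z) ^+ 2 *
    sum3 (fun k => w k (f z) * (xx k (f z) + yy k (f z))).
  by rewrite normc_sqr /m2 /n2 /a1 /a2 /utt /uss /W /sum3; ring.
have Vz : V (f z) by apply: fV; exact: polar_disc.
have := small_near_bdry Vz (small s).
have -> : sum3 (fun k => x k (f z) ^+ 2 + y k (f z) ^+ 2) = X2 (f z) + Y2 (f z).
  by rewrite /X2 /Y2 /sum3; ring.
rewrite ler_norml => /andP[h _].
have := ler_wpM2l (sqr_ge0 (normc (K1 z))) h.
have -> : normc (K1 z) ^+ 2 * - (1 / 8 * (X2 (f z) + Y2 (f z))) = - (1 / 8 * (a1 z + a2 z)).
  by rewrite a12; ring.
lra.
Qed.

Let M1_upper (t : R) : t < 0 -> (2 * polar_mean m1 t) ^+ 2 <= 4 * polar_mean m0 t * polar_mean a1 t.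
Proof.
move=> t0; have -> : (2 * polar_mean m1 t) ^+ 2 = 4 * polar_mean m1 t ^+ 2 by ring.
rewrite -mulrA ler_pM2l//.
apply: mean_CS; try exact: cont_polar.
- by move=> s; apply: sum3_ge0 => k; rewrite -expr2 sqr_ge0.
- by move=> s; apply: sum3_ge0 => k; rewrite -expr2 sqr_ge0.
- move=> s; apply: le_trans (sum3_CS _ _) _.
  by rewrite /m0 /a1 /sum3 !expr2.
Qed.

Let m0_small (e : R) : 0 < e -> exists2 t : R, t < 0 &
  forall r s : R, t < r -> r < 0 -> m0 (polar r s) <= e.
Proof.
move=> e0; have [r r1 rP] := vanish_near_bdry e0.
(* The radius is made positive so that its logarithm is a meaningful time. *)
pose q := Num.max r (1 / 2).
have q0 : 0 < q by rewrite lt_max divr_gt0 ?orbT.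
have q1 : q < 1 by rewrite gt_max r1/=; lra.
exists (ln q); first by rewrite ln_lt0// q0.
move=> t s qt t0; have -> : m0 (polar t s) = sum3 (fun k => w k (f (polar t s)) ^+ 2).
  by rewrite /m0 /W /sum3 !expr2.
apply: rP; first exact: polar_disc.
rewrite normc_polar; apply: (@le_lt_trans _ _ q); first by rewrite le_max lexx.
by rewrite -(lnK q0) ltr_expR.
Qed.

Lemma hopf_vanish_aux : f1 0 != 0 -> hopf x y (f 0) = 0.
Proof.
move=> f10; apply/eqP/negPn/negP => h0.
have Q0 : 0 < normc (Q 0) by rewrite normc_gt0 !mulf_neq0.
have [t1 t10 small] := m0_small eps0.
(* After [t1] the map is small enough for [M2_lower], and after -1 [A_lower] applies. *)
pose t0 := Num.max t1 (-1).
have t00 : t0 < 0 by rewrite gt_max t10 ltrN10.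
apply: (@decay_obstruction R (polar_mean m0) (fun t => 2 * polar_mean m1 t) (fun t => 2 * polar_mean m2 t)
  (polar_mean a1) t0 (expR (- 2) / 2 * normc (Q 0)) t00).
- by rewrite mulr_gt0// divr_gt0// expR_gt0.
- by move=> t _; exact: dm0.
- by move=> t _; exact: dm1.
- by move=> t _ th; apply: mean_ge0 => s; apply: sum3_ge0 => k; rewrite -expr2 sqr_ge0.
- move=> t; rewrite gt_max => /andP[h _] th; apply: M2_lower => // s; exact: small.
- by move=> t _; exact: M1_upper.
- by move=> t; rewrite gt_max => /andP[_ h] th; exact: A_lower.
- move=> e e0; have [t2 t20 t2P] := m0_small e0; exists t2 => // t h1 h2.
  rewrite -[leRHS]mean_cst; apply: le_mean => [||s]; last exact: t2P.
    exact: cont_polar.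
  by move=> s; exact: cvg_cst.
Qed.

End Second.

Theorem hopf_eq0 : f1 0 != 0 -> hopf x y (f 0) = 0.
Proof.
have [f2 Hf1] := holo_deriv (@copen_disc R 0 1) Hf.
exact: hopf_vanish_aux Hf1.
Qed.

End HopfVanishing.

(** * Maximum principle for conformal solutions *)

Section MaximumPrinciple.
Context {R : realType}.

(** [F1] is differentiable at 0 only, so no Taylor formula is used: if [l > 0], then
    [F1 s >= l / 2 * s] for small positive [s], and [F] minus [l / 4 * s ^+ 2] is nondecreasing,
    against maximality. *)
Lemma local_max_test (F F1 : R -> R) (l d : R) : 0 < d ->
  (forall t, `|t| < d -> is_derive (t : R) 1 F (F1 t)) -> is_derive (0 : R) 1 F1 l ->
  (forall t, `|t| < d -> F t <= F 0) -> F1 0 = 0 /\ l <= 0.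
Proof.
move=> d0 dF dF1 maxF.
have itv t : t \in `](- d), d[ -> `|t| < d by rewrite in_itv/= ltr_norml.
have F10 : F1 0 = 0.
  have h0 : is_derive (0 : R) 1 F 0.
    apply: (@derive1_at_max R F (- d) d 0); first by lra.
    - by move=> t /itv /dF[].
    - by rewrite in_itv/= oppr_lt0 d0.
    - by move=> t /itv; exact: maxF.
  have h1 : is_derive (0 : R) 1 F (F1 0) by apply: dF; rewrite normr0.
  by rewrite -(derive_val (is_derive := h1)) (derive_val (is_derive := h0)).
split=> //; rewrite leNgt; apply/negP => l0.
move/is_deriveP: dF1; rewrite F10 => /cvgrPdist_lt /(_ _ (divr_gt0 l0 (ltr0n R 2))).
rewrite /prop_near1 /= => /nbhs_ballP[r /= r0 rP].
pose t := Num.min r d / 2.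
have m0 : 0 < Num.min r d by rewrite lt_min r0.
have t0 : 0 < t by rewrite divr_gt0.
have : t < Num.min r d by rewrite /t; lra.
rewrite lt_min => /andP[tr td].
have F1_ge s : 0 <= s -> s <= t -> l / 2 * s <= F1 s.
  rewrite le_eqVlt => /predU1P[<- _|s0 st]; first by rewrite mulr0 F10.
  have := rP s; rewrite /ball /= sub0r normrN gtr0_norm// add0r subr0 => h.
  have := h (le_lt_trans st tr) (lt0r_neq0 s0).
  rewrite distrC ltr_norml => /andP[h1 _].
  have : l / 2 < s^-1 * F1 s by lra.
  by rewrite ltr_pdivlMl// mulrC => /ltW.
have : 0 * (t - 0) <= (F t - l / 4 * t ^+ 2) - (F 0 - l / 4 * 0 ^+ 2).
  apply: (@slope_ge R (fun s => F s - l / 4 * s ^+ 2) (fun s => F1 s - l / 2 * s) 0 t 0 (ltW t0)).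
    move=> s s0 st; apply: is_deriveB.
      by apply: dF; rewrite ger0_norm//; exact: le_lt_trans st td.
    have -> : l / 2 * s = l / 4 * (2 * s) by field.
    apply: is_deriveZ.
    have := @is_deriveX R R id 2 s 1 1 _; rewrite /GRing.scale /= expr1 mulr1.
    by apply; exact: is_derive_id.
  by move=> s s0 st; rewrite subr_ge0 F1_ge.
have := maxF t; rewrite gtr0_norm// => /(_ td).
have : 0 < l / 4 * t ^+ 2 by rewrite mulr_gt0// ?divr_gt0 ?exprn_gt0.
rewrite mul0r expr0n /= mulr0 subr0 => h1 h2 h3.
have : F t < F t by lra.
by rewrite ltxx.
Qed.

Lemma plane_max_test (V : set R[i]) (F Fx Fy : R[i] -> R) z (a b c d : R) :
  copen V -> V z -> (forall y, V y -> rder F y (Fx y) (Fy y)) ->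
  rder Fx z a b -> rder Fy z c d -> (forall y, V y -> F y <= F z) ->
  [/\ Fx z = 0, Fy z = 0, a <= 0 & d <= 0].
Proof.
move=> oV Vz dF dFx dFy maxF; have [r r0 rV] := oV z Vz.
have test k : normc k = 1 -> Fx z * Re k + Fy z * Im k = 0 /\
    (a * Re k + b * Im k) * Re k + (c * Re k + d * Im k) * Im k <= 0.
  move=> k1; have z0 : z + 0%:C%C * k = z by rewrite mul0r addr0.
  have line (t : R) : `|t| < r -> V (z + t%:C%C * k).
    move=> tr; apply: rV; rewrite addrAC subrr add0r.
    by rewrite (normcM t%:C%C) k1 mulr1 normc_real.
  have dl G p p' : rder G z p p' ->
      is_derive (0 : R) 1 (fun t => G (z + t%:C%C * k)) (p * Re k + p' * Im k).
    move=> dG; apply: (@is_derive_rder R G (fun t => z + t%:C%C * k) 0 k p p').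
      by rewrite z0.
    exact: dcurve_ray.
  have := @local_max_test (fun t => F (z + t%:C%C * k))
    (fun t => Re k * Fx (z + t%:C%C * k) + Im k * Fy (z + t%:C%C * k))
    (Re k * (a * Re k + b * Im k) + Im k * (c * Re k + d * Im k)) r r0.
  rewrite z0 [Re k * Fx z]mulrC [Im k * Fy z]mulrC.
  rewrite [Re k * (_ + _)]mulrC [Im k * (_ + _)]mulrC; apply.
  - move=> t tr; rewrite [Re k * _]mulrC [Im k * _]mulrC.
    exact: (is_derive_rder (c := fun t => z + t%:C%C * k) (dF _ (line t tr)) (dcurve_ray z k t)).
  - apply: is_deriveD; rewrite [X in is_derive _ _ _ X]mulrC; apply: is_deriveZ; exact: dl.
  - by move=> t /line; exact: maxF.
have [|h1 h2] := test 1; first by rewrite -[1]/(1%:C%C) normc_real normr1.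
have [|h3 h4] := test 'i%C; first by rewrite /= expr0n expr1n add0r sqrtr1.
move: h1 h2 h3 h4; rewrite /= !(mulr0, mulr1, addr0, add0r) => h1 h2 h3 h4.
by split.
Qed.

Section Weight.
Variables (C B : R).

Let psi (s : R) : R := expR ((C + 1) * (s + B)).
(* The exponents make [psi'' = (C + 1) psi' > C psi'] and [psi' >= C + 1]. *)
Definition weight (z : R[i]) : R := expR (2 * psi (Re z)).

Let dpsi (s : R) : is_derive s 1 psi ((C + 1) * psi s).
Proof.
rewrite /psi mulrC; apply: (@is_derive1_comp R expR (fun s => (C + 1) * (s + B)) s).
rewrite -[X in is_derive _ _ _ X]mulr1; apply: is_deriveZ.
by rewrite -[X in is_derive _ _ _ X]addr0; apply: is_deriveD.
Qed.

Definition weight1 (z : R[i]) : R := 2 * ((C + 1) * psi (Re z)) * weight z.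
Definition weight2 (z : R[i]) : R :=
  (2 * (C + 1) ^+ 2 * psi (Re z) + 4 * ((C + 1) * psi (Re z)) ^+ 2) * weight z.

Let rder_Re z : rder (@Re R) z 1 0.
Proof. by have := cder_Re (cder_id z); rewrite /= oppr0. Qed.

Lemma rder_weight z : rder weight z (weight1 z) 0.
Proof.
have h : is_derive (Re z) 1 (fun s => expR (2 * psi s)) (weight1 z).
  rewrite /weight1 mulrC; apply: (@is_derive1_comp R expR (fun s => 2 * psi s) (Re z)).
  exact: is_deriveZ (dpsi _).
by have := rder_comp1 h (rder_Re z); rewrite mulr1 mulr0.
Qed.

Lemma rder_weight1 z : rder weight1 z (weight2 z) 0.
Proof.
have h := rder_comp1 (dpsi (Re z)) (rder_Re z); rewrite mulr1 mulr0 in h.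
have := rderM (rderZ 2 (rderZ (C + 1) h)) (rder_weight z).
rewrite !mulr0 mul0r add0r; congr rder; rewrite /weight2 /weight1; ring.
Qed.

Lemma weight_gt0 z : 0 < weight z. Proof. exact: expR_gt0. Qed.

End Weight.

Variables (V : set R[i]) (w x y xx xy yy : 'I_3 -> R[i] -> R).
Hypothesis c2 : C2 V w x y xx xy yy.
Hypothesis oV : copen V.

Let q z := sum3 (fun k => w k z ^+ 2).

(** Let P = psi'(x), r = |w|, X = |w_x| = |w_y|. Criticality gives w . w_x = - P r^2, and the sum of
    the two second-order conditions becomes 2 X^2 - C r X - 2 P^2 r^2 + (C + 1) P r^2 <= 0. The left
    side equals (X - P r)(2 X + 2 P r - C r) + P r^2, which is positive unless r = 0. *)
Lemma no_interior_max (C B : R) z : 0 <= C -> V z -> 0 <= Re z + B ->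
  sum3 (fun k => x k z ^+ 2) = sum3 (fun k => y k z ^+ 2) ->
  `|sum3 (fun k => w k z * (xx k z + yy k z))| <=
    C * (Num.sqrt (q z) * Num.sqrt (sum3 (fun k => x k z ^+ 2))) ->
  (forall y, V y -> q y * weight C B y <= q z * weight C B z) -> q z = 0.
Proof.
move=> C0 Vz Bz conf Lz maxz.
pose qx z := 2 * sum3 (fun k => w k z * x k z).
pose qy z := 2 * sum3 (fun k => w k z * y k z).
pose qxx := 2 * sum3 (fun k => x k z ^+ 2 + w k z * xx k z).
pose qxy := 2 * sum3 (fun k => y k z * x k z + w k z * xy k z).
pose qyy := 2 * sum3 (fun k => y k z ^+ 2 + w k z * yy k z).
have dq p : V p -> rder q p (qx p) (qy p).
  move=> Vp; have := @rder_sum3 R (fun k z => w k z ^+ 2)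
    (fun k z => x k z * w k z + w k z * x k z)
    (fun k z => y k z * w k z + w k z * y k z) p (fun k => rderM (C2w c2 k Vp) (C2w c2 k Vp)).
  by congr rder; rewrite /qx /qy /sum3; ring.
have dqx : rder qx z qxx qxy.
  apply: rderZ; have := @rder_sum3 R (fun k z => w k z * x k z)
    (fun k z => x k z * x k z + w k z * xx k z)
    (fun k z => y k z * x k z + w k z * xy k z) z (fun k => rderM (C2w c2 k Vz) (C2x c2 k Vz)).
  by [].
have dqy : rder qy z qxy qyy.
  apply: rderZ; have := @rder_sum3 R (fun k z => w k z * y k z)
    (fun k z => x k z * y k z + w k z * xy k z)
    (fun k z => y k z * y k z + w k z * yy k z) z (fun k => rderM (C2w c2 k Vz) (C2y c2 k Vz)).
  by congr rder; rewrite /sum3; ring.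
have dF p : V p -> rder (fun z => q z * weight C B z) p
    (qx p * weight C B p + q p * weight1 C B p) (qy p * weight C B p + q p * 0).
  by move=> Vp; apply: rderM; [exact: dq|exact: rder_weight].
have dFx := rderD (rderM dqx (rder_weight C B z)) (rderM (dq z Vz) (rder_weight1 C B z)).
have dFy := rderD (rderM dqy (rder_weight C B z)) (rderM (dq z Vz) (rder_cst 0 z)).
have [E1 E2 E3 E4] := plane_max_test oV Vz dF dFx dFy maxz.
move: E1 E2 E3 E4; rewrite !mulr0 !addr0.
have g0 := weight_gt0 C B z.
rewrite /weight1 /weight2; set g := weight C B z in g0 *.
set p := expR _; set P := (C + 1) * p.
have -> : qx z * g + q z * (2 * P * g) = (qx z + 2 * P * q z) * g by ring.
have -> : qxx * g + qx z * (2 * P * g) + (qx z * (2 * P * g) +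
    q z * ((2 * (C + 1) ^+ 2 * p + 4 * P ^+ 2) * g)) =
  (qxx + 4 * P * qx z + q z * (2 * (C + 1) * P + 4 * P ^+ 2)) * g.
  by rewrite /P; ring.
move=> /eqP; rewrite mulf_eq0 (gt_eqF g0) orbF => /eqP E1.
move=> _; rewrite (pmulr_lle0 _ g0) => E3 ; rewrite (pmulr_lle0 _ g0) => E4.
have p1 : 1 <= p by rewrite -expR0 ler_expR mulr_ge0//; lra.
have CP : C + 1 <= P by rewrite /P ler_peMr//; lra.
set r := Num.sqrt (q z) in Lz; set X := Num.sqrt _ in Lz.
have q0 : 0 <= q z by apply: sum3_ge0 => k; exact: sqr_ge0.
have r0 : 0 <= r := sqrtr_ge0 _; have X0 : 0 <= X := sqrtr_ge0 _.
have rr : q z = r ^+ 2 by rewrite sqr_sqrtr.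
have T0 : 0 <= sum3 (fun k => x k z ^+ 2) by apply: sum3_ge0 => k; exact: sqr_ge0.
have XX : sum3 (fun k => x k z ^+ 2) = X ^+ 2 by rewrite sqr_sqrtr.
have YY : sum3 (fun k => y k z ^+ 2) = X ^+ 2 by rewrite -conf.
(* Cauchy-Schwarz in w . w_x = - P r^2. *)
have Pr : P * r <= X.
  rewrite leNgt; apply/negP => h.
  have rp : 0 < r.
    by rewrite lt_neqAle r0 andbT eq_sym; apply/eqP => re; move: h; rewrite re mulr0 ltNge X0.
  have := sum3_CS (w^~ z) (x^~ z); rewrite -/(q z) XX rr.
  have -> : sum3 (fun k => w k z * x k z) = - P * r ^+ 2.
    by move: E1; rewrite /qx rr; lra.
  have -> : (- P * r ^+ 2) ^+ 2 = r ^+ 2 * (P * r) ^+ 2 by ring.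
  rewrite ler_pM2l ?exprn_gt0// ler_sqr ?nnegrE//; last by rewrite mulr_ge0//; lra.
  by rewrite leNgt h.
rewrite rr; apply/eqP; rewrite expf_eq0 /=; apply/negPn/negP => rn0.
have rp : 0 < r by rewrite lt_neqAle eq_sym rn0.
move: Lz; rewrite ler_norml => /andP[Lz _].
have D : qxx + qyy = 4 * X ^+ 2 + 2 * sum3 (fun k => w k z * (xx k z + yy k z)).
  have -> : 4 * X ^+ 2 = 2 * sum3 (fun k => x k z ^+ 2) + 2 * sum3 (fun k => y k z ^+ 2).
    by rewrite XX YY; ring.
  by rewrite /qxx /qyy /sum3; ring.
have qxE : qx z = - 2 * P * r ^+ 2 by move: E1; rewrite rr; lra.
have h1 : 0 <= (X - P * r) * (2 * X + 2 * (P * r) - C * r).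
  apply: mulr_ge0; first by lra.
  have : C * r <= P * r by rewrite ler_wpM2r//; lra.
  have : 0 <= P * r by rewrite mulr_ge0//; lra.
  lra.
have h2 : 0 < P * r ^+ 2 by rewrite mulr_gt0 ?exprn_gt0//; lra.
have h3 : (X - P * r) * (2 * X + 2 * (P * r) - C * r) + P * r ^+ 2 =
  2 * X ^+ 2 - C * (r * X) - 2 * P ^+ 2 * r ^+ 2 + (C + 1) * P * r ^+ 2 by ring.
move: E3; rewrite qxE rr => E3.
have e1 : 4 * P * (- 2 * P * r ^+ 2) = - 8 * (P ^+ 2 * r ^+ 2) by ring.
have e2 : r ^+ 2 * (2 * (C + 1) * P + 4 * P ^+ 2) =
  2 * ((C + 1) * P * r ^+ 2) + 4 * (P ^+ 2 * r ^+ 2) by ring.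
move: E3; rewrite e1 e2 => E3.
have : (0 : R) < 0 by lra.
by rewrite ltxx.
Qed.

End MaximumPrinciple.

(** * Assembly *)

Section Compactness.
Context {R : realType}.

Lemma within_bounded (T : topologicalType) (A : set T) (f : T -> R) : compact A ->
  {within A, continuous f} -> exists2 K : R, 0 <= K & forall p, A p -> `|f p| <= K.
Proof.
move=> cA cf; have [[a Aa]|nA] := pselect (A !=set0); last first.
  by exists 0 => // p Ap; case: nA; exists p.
have cnf : {within A, continuous (fun p => `|f p|)}.
  apply/subspace_continuousP => p Ap; apply: cvg_norm.
  by move/subspace_continuousP : cf; exact.
have [c cinA maxc] := compact_EVT_max (ex_intro _ a Aa) cA cnf.
by exists `|f c| => // p Ap; apply: maxc; rewrite inE.
Qed.

Lemma closed_superlevel (T : topologicalType) (A : set T) (f : T -> R) (e : R) :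
  closed A -> {within A, continuous f} -> closed [set p | A p /\ e <= f p].
Proof.
move=> cA /subspace_continuousP cf p clp.
have Ap : A p.
  by apply: cA => B nB; have [x [[Ax _] Bx]] := clp B nB; exists x.
split=> //; rewrite leNgt; apply/negP => fpe.
have h : \forall x \near within A (nbhs p), f x < e.
  exact: (cvgr_lt _ (cf p Ap)).
by have [x [[Ax ex] /(_ Ax)]] := clp _ h; rewrite ltNge ex.
Qed.

Lemma le_coord_norm (p : 'rV[R]_2) i : `|p 0 i| <= `|p|.
Proof.
rewrite [leRHS]/Num.norm /= mx_normrE; apply/bigmax_geP; right => /=.
by exists (0, i).
Qed.

Lemma compact_closure (A : set 'rV[R]_2) : bounded_set A -> compact (closure A).
Proof.
move=> [M [Mreal MA]]; apply: bounded_closed_compact; last exact: closed_closure.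
(* One unit to exceed [M] strictly, one for the distance from a point of the closure to [A]. *)
exists (M + 2); split; first by rewrite num_real.
move=> x Mx p clp.
have [q [Aq]] := clp _ (nbhsx_ballx p 1 ltr01).
rewrite -ball_normE /= => pq.
have q1 : `|q| <= M + 1 by apply: MA => //; lra.
have := ler_normD (p - q) q; rewrite subrK; lra.
Qed.

Lemma cvg_matrix T (F : set_system T) {FF : Filter F} m n (f : T -> 'M[R]_(m, n))
    (M : 'M[R]_(m, n)) :
  (forall i j, (fun x => f x i j) @ F --> M i j) -> f @ F --> M.
Proof.
move=> h; apply/cvg_ballP => e e0.
have : \forall x \near F, forall ij : 'I_m * 'I_n, ball (M ij.1 ij.2) e (f x ij.1 ij.2).
  by apply: filter_forall => ij; apply: (h ij.1 ij.2); exact: nbhsx_ballx.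
by apply: filterS => x hx; split => // i j; exact: (hx (i, j)).
Qed.

End Compactness.

(** * Identities for the cross product *)

Section Cross.
Context {R : realType}.
Implicit Types u t : 'rV[R]_3.

Lemma crossE u t :
  [/\ cross u t 0 0 = u 0 1 * t 0 2 - u 0 2 * t 0 1,
      cross u t 0 1 = u 0 2 * t 0 0 - u 0 0 * t 0 2 &
      cross u t 0 2 = u 0 0 * t 0 1 - u 0 1 * t 0 0].
Proof.
by split; rewrite mxE; congr (u 0 _ * t 0 _ - u 0 _ * t 0 _); apply/val_inj.
Qed.

Lemma sum3_cross_l u t : sum3 (fun k => u 0 k * cross u t 0 k) = 0.
Proof. by have [e0 e1 e2] := crossE u t; rewrite /sum3 e0 e1 e2; ring. Qed.

Lemma sum3_cross_r u t : sum3 (fun k => t 0 k * cross u t 0 k) = 0.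
Proof. by have [e0 e1 e2] := crossE u t; rewrite /sum3 e0 e1 e2; ring. Qed.

(** Lagrange's identity: the defect is the squared inner product. *)
Lemma sum3_cross_sqr u t : sum3 (fun k => cross u t 0 k ^+ 2) <=
  sum3 (fun k => u 0 k ^+ 2) * sum3 (fun k => t 0 k ^+ 2).
Proof.
have [e0 e1 e2] := crossE u t.
have -> : sum3 (fun k => cross u t 0 k ^+ 2) = sum3 (fun k => u 0 k ^+ 2) *
    sum3 (fun k => t 0 k ^+ 2) - sum3 (fun k => u 0 k * t 0 k) ^+ 2.
  by rewrite /sum3 e0 e1 e2; ring.
by rewrite gerBl sqr_ge0.
Qed.

End Cross.

Lemma normr_le_sqr {R : realType} (s b : R) : 0 <= b -> s ^+ 2 <= b ^+ 2 -> `|s| <= b.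
Proof. by move=> b0 sb; rewrite -ler_sqr ?nnegrE// real_normK ?num_real. Qed.

(** * Vanishing of solutions with zero boundary values *)

Section ZeroBoundaryValues.
Context {R : realType}.
Variables (Omega : set 'rV[R]_2) (v : 'rV[R]_2 -> 'rV[R]_3).
Hypothesis domO : domain Omega.
Hypothesis bndO : bounded_set Omega.
Hypothesis scO : simply_connected R Omega.
Hypothesis cv : {within closure Omega, continuous v}.
Hypothesis v_bdry : forall xi, boundary Omega xi -> v xi = 0.

Let oO : open Omega. Proof. by case: domO. Qed.
Let cptO : compact (closure Omega). Proof. exact: compact_closure. Qed.

Let V := [set z : R[i] | Omega (ofC z)].
Let oV : copen V. Proof. exact: copen_preimage. Qed.
Let w (k : 'I_3) (z : R[i]) := v (ofC z) 0 k.
Variables x y xx xy yy : 'I_3 -> R[i] -> R.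
Hypothesis c2 : C2 V w x y xx xy yy.
Hypothesis xL : forall z, V z -> sum3 (fun k => x k z * (xx k z + yy k z)) = 0.
Hypothesis yL : forall z, V z -> sum3 (fun k => y k z * (xx k z + yy k z)) = 0.

Let q z := sum3 (fun k => w k z ^+ 2).
Let X2 z := sum3 (fun k => x k z ^+ 2).
Let Y2 z := sum3 (fun k => y k z ^+ 2).
Let wL z := sum3 (fun k => w k z * (xx k z + yy k z)).

Variables K L : R.
Hypothesis K0 : (0 : R) <= K.
Hypothesis L0 : (0 : R) <= L.
Hypothesis lap_sqr : forall z, V z -> wL z ^+ 2 <= q z * (K ^+ 2 * (X2 z * Y2 z)).
Hypothesis x_bounded : forall z, V z -> X2 z <= L ^+ 2.

Let q_ge0 z : 0 <= q z. Proof. by apply: sum3_ge0 => k; exact: sqr_ge0. Qed.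
Let X2_ge0 z : 0 <= X2 z. Proof. by apply: sum3_ge0 => k; exact: sqr_ge0. Qed.
Let Y2_ge0 z : 0 <= Y2 z. Proof. by apply: sum3_ge0 => k; exact: sqr_ge0. Qed.

Let small_near_bdry : exists2 eps : R, 0 < eps & forall z, V z -> q z <= eps ->
  `|wL z| <= 1 / 8 * sum3 (fun k => x k z ^+ 2 + y k z ^+ 2).
Proof.
(* |w| K <= 1 / 4 for such small w, and |w_x| |w_y| is at most half of |w_x|^2 + |w_y|^2, which
   gives 1 / 8. The summand 1 covers [K = 0]. *)
pose e := (4 * (K + 1)) ^- 2.
have k0 := K0; have K1 : 0 < 4 * (K + 1) by lra.
have e0 : 0 < e by rewrite /e invr_gt0 exprn_gt0.
exists e => // z Vz qe.
have -> : sum3 (fun k => x k z ^+ 2 + y k z ^+ 2) = X2 z + Y2 z.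
  by rewrite /X2 /Y2 /sum3; ring.
have := lap_sqr Vz; move: qe (X2_ge0 z) (Y2_ge0 z) (q_ge0 z).
move: (q z) (X2 z) (Y2 z) => r X Y re X0 Y0 r0 h.
apply: normr_le_sqr; first by apply: mulr_ge0; [lra|exact: addr_ge0].
apply: (le_trans h); rewrite mulrA.
have h1 : r * K ^+ 2 <= 1 / 16.
  have : r * K ^+ 2 <= e * (K + 1) ^+ 2.
    by apply: ler_pM => //; [exact: sqr_ge0|rewrite ler_sqr ?nnegrE//; lra].
  have -> : e * (K + 1) ^+ 2 = 1 / 16 by rewrite /e; field; lra.
  by [].
apply: (le_trans (ler_wpM2r (mulr_ge0 X0 Y0) h1)).
have := sqr_ge0 (X - Y).
have -> : (1 / 8 * (X + Y)) ^+ 2 = 1 / 16 * (X * Y) + 1 / 64 * (X - Y) ^+ 2 by field.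
lra.
Qed.

Let conformal_bound z : V z -> X2 z = Y2 z ->
  `|wL z| <= K * L * (Num.sqrt (q z) * Num.sqrt (X2 z)).
Proof.
move=> Vz XY; have := lap_sqr Vz; have := x_bounded Vz; rewrite -XY.
move: (X2_ge0 z) (q_ge0 z); move: (q z) (X2 z) => r X X0 r0 XL h.
apply: normr_le_sqr.
  by apply: mulr_ge0; [exact: mulr_ge0|apply: mulr_ge0; exact: sqrtr_ge0].
apply: (le_trans h).
rewrite (exprMn _ (K * L)) (exprMn _ K) (exprMn _ (Num.sqrt r)) !sqr_sqrtr//.
have -> : K ^+ 2 * L ^+ 2 * (r * X) = r * (K ^+ 2 * (L ^+ 2 * X)) by ring.
apply: ler_wpM2l => //; apply: ler_wpM2l; first exact: sqr_ge0.
exact: ler_wpM2r.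
Qed.

Let Q p := sum3 (fun k => v p 0 k ^+ 2).

Let cQ : {within closure Omega, continuous Q}.
Proof.
apply/subspace_continuousP => p clp.
have cvp : v @ within (closure Omega) (nbhs p) --> v p.
  by move/subspace_continuousP : cv; exact.
by apply: cvgD; [apply: cvgD|]; apply: cvgM; exact: coord_cvg.
Qed.

Let Q_bdry p : closure Omega p -> Q p != 0 -> Omega p.
Proof.
move=> clp; apply: contraNP => nOp; rewrite /Q v_bdry; last first.
  by split => // /interior_subset.
by rewrite /sum3 !mxE expr0n /= !addr0.
Qed.

(** The set where |v|^2 >= e is compact and inside [Omega], so |g| has a maximum below 1 on it;
    beyond that modulus [f z] has left the set. *)
Let vanish_near_bdry (g g' f : R[i] -> R[i]) : holo V g g' ->
  (forall z, V z -> normc (g z) < 1) ->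
  (forall z, disc 0 1 z -> V (f z)) -> (forall z, disc 0 1 z -> g (f z) = z) ->
  forall e : R, 0 < e -> exists2 r : R, r < 1 &
  forall z, disc 0 1 z -> r < normc z -> q (f z) <= e.
Proof.
move=> hg g1 fV gf e e0; pose S := [set p | closure Omega p /\ e <= Q p].
have SO p : S p -> Omega p.
  by move=> [clp ep]; apply: Q_bdry => //; rewrite gt_eqF//; exact: lt_le_trans ep.
have cS : compact S.
  apply: (subclosed_compact _ cptO); last by move=> p [].
  by apply: closed_superlevel => //; exact: closed_closure.
have VC p : Omega p -> V (toC p) by rewrite /V /mkset toCK.
have [[p0 Sp0]|nS] := pselect (S !=set0); last first.
  exists 0; first exact: ltr01.
  move=> z hz _; rewrite leNgt; apply/negP => qe; apply: nS; exists (ofC (f z)).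
  by split; [exact: subset_closure (fV z hz)|exact: ltW].
have [|c cS' maxc] := @compact_EVT_max _ R (fun p => normc (g (toC p))) S (ex_intro _ p0 Sp0) cS.
  apply/subspace_continuousP => p /SO Op; apply: cvg_within_filter; apply: cto_normc.
  exact: (cto_comp (holo_cont hg (VC p Op)) (@cto_toC R p)).
rewrite inE in cS'; exists (normc (g (toC c))); first by apply/g1/VC/SO.
move=> z hz; rewrite ltNge => /negP nz; rewrite leNgt; apply/negP => qe; apply: nz.
have Sz : S (ofC (f z)) by split; [exact: subset_closure (fV z hz)|exact: ltW].
by have := maxc (ofC (f z)); rewrite ofCK gf// => -> //; rewrite inE.
Qed.

Let V_connected p : V p -> forall Z : set R[i],
  (forall z, V z -> Z z -> cnbhs z Z) -> (forall z, V z -> ~ Z z -> cnbhs z (~` Z)) ->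
  Z p -> forall z, V z -> Z z.
Proof.
move=> Vp Z Z1 Z2 Zp; have [_ _ conO] := domO.
have VC s : Omega s -> V (toC s) by rewrite /V /mkset toCK.
have opn (W : set R[i]) : (forall z, V z -> W z -> cnbhs z W) ->
    open [set p | Omega p /\ W (toC p)].
  move=> W1; rewrite openE => s [Os Ws].
  have [d d0 dW] := W1 _ (VC s Os) Ws.
  have : \forall t \near s, Omega t /\ normc (toC t - toC s) < d.
    by apply: filterI; [exact: open_nbhs_nbhs|exact: (@cto_toC R s)].
  by apply: filterS => t [Ot /dW].
pose B := [set s | Omega s /\ Z (toC s)].
have BO : B = Omega.
  apply: conO.
  - by exists (ofC p); split => //; rewrite ofCK.
  - exists B; first exact: opn.
    by apply/seteqP; split => s; [case=> Os Zs|case].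
  - exists (~` [set s | Omega s /\ (~` Z) (toC s)]).
      by apply: open_closedC; exact: opn.
    apply/seteqP; split => s; first by move=> [Os Zs]; split => // -[_].
    by move=> [Os nZ]; split => //; apply: contrapT => nZs; apply: nZ.
move=> z Vz; have : B (ofC z) by rewrite BO.
by case; rewrite ofCK.
Qed.

Let V_bounded : exists2 M : R, 0 < M & forall z, V z -> normc z <= M.
Proof.
have [M [Mreal MO]] := bndO.
exists (2 * (`|M| + 1)) => [|z Vz]; first by have := normr_ge0 M; lra.
have hz : `|ofC z| <= `|M| + 1.
  by apply: MO => //; apply: (le_lt_trans (ler_norm M)); lra.
apply: (le_trans (normc_le_ReIm z)).
have h0 := le_coord_norm (ofC z) 0; have h1 := le_coord_norm (ofC z) 1.
have e0 : ofC z 0 0 = Re z by rewrite mxE.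
have e1 : ofC z 0 1 = Im z by rewrite mxE.
by move: h0 h1; rewrite e0 e1; lra.
Qed.

(** The Riemann map is based at the point under consideration, so [f 0 = z] and vanishing at the
    centre of the disc is enough. *)
Let conformal z : V z -> hopf x y z = 0.
Proof.
move=> Vz; have [M M0 VM] := V_bounded; have [eps eps0 small] := small_near_bdry.
have sub : V `<=` disc z (2 * M + 1).
  move=> u Vu; rewrite /disc /mkset; apply: (le_lt_trans (normcB _ _)).
  by have := VM _ Vu; have := VM _ Vz; lra.
have sq k k' : holo V k k' -> (forall z, V z -> k z != 0) ->
    exists s, forall z, V z -> ccont s z /\ s z ^+ 2 = k z.
  have VC p : Omega p -> V (toC p) by rewrite /V /mkset toCK.
  move=> hk k0; apply: (@sqrt_exists R Omega k scO _ _ oO (ofC z)) => // p /VC Vp.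
    exact: holo_cont hk Vp.
  exact: k0.
have R0 : 0 < 2 * M + 1 by lra.
have [g [g' [f [[hg g1 gz gi g'0] fV gf fg hf]]]] :=
  riemann_mapping oV Vz sq R0 sub (V_connected Vz).
have f0 : f 0 = z by rewrite -gz fg.
rewrite -f0.
apply: (hopf_eq0 c2 xL yL hf fV eps0 small (vanish_near_bdry hg g1 fV gf)).
by rewrite f0 invr_eq0 g'0.
Qed.

Lemma eq0_of_zero_boundary xi : Omega xi -> v xi = 0.
Proof.
move=> Oxi; pose C := K * L; have C0 : 0 <= C by exact: mulr_ge0.
have [M M0 VM] := V_bounded.
have clO0 : closure Omega !=set0 by exists xi; exact: subset_closure.
(* The shift [M] bounds |Re z| on [V], as [no_interior_max] requires. A maximum with [Q c != 0]
   would be interior, since [Q] vanishes on the boundary. *)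
have [|c cO maxc] := @compact_EVT_max _ R (fun p => Q p * weight C M (toC p)) _ clO0 cptO.
  apply/subspace_continuousP => p clp; apply: cvgM.
    by move/subspace_continuousP : cQ; apply.
  apply: cvg_within_filter.
  have cp : toC @ p --> cnbhs (toC p).
    by move=> A [d d0 dA]; have := @cto_toC R p d d0; apply: filterS => ?; exact: dA.
  exact: (cvg_comp _ _ cp (rder_cont (rder_weight C M (toC p)))).
rewrite inE in cO.
have Qc : Q c = 0.
  apply/eqP/negPn/negP => Qc0; have Oc := Q_bdry cO Qc0.
  have Vc : V (toC c) by rewrite /V /mkset toCK.
  have qc : q (toC c) = Q c by rewrite /q /w /Q toCK.
  case/eqP : Qc0; rewrite -qc.
  have XY : X2 (toC c) = Y2 (toC c).
    have := congr1 (@Re R) (conformal Vc); rewrite /hopf /= /X2 /Y2 /sum3; lra.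
  apply: (@no_interior_max R V w x y xx xy yy c2 oV C M (toC c) C0 Vc _ XY (conformal_bound Vc XY)).
    have := VM _ Vc; have := normr_Re_le (toC c).
    by rewrite ler_norml => /andP[]; lra.
  move=> z Vz; rewrite -/(q z) -/(q (toC c)) qc.
  have := maxc (ofC z); rewrite inE ofCK; apply.
  exact: subset_closure.
have := maxc xi; rewrite inE Qc mul0r => /(_ (subset_closure Oxi)).
rewrite (pmulr_lle0 _ (weight_gt0 _ _ _)) => Qxi.
apply/rowP => k; rewrite mxE; apply/eqP; rewrite -sqrf_eq0; apply/eqP/le_anti.
rewrite sqr_ge0 andbT; apply: le_trans Qxi.
have s0 := sqr_ge0 (v xi 0 0); have s1 := sqr_ge0 (v xi 0 1); have s2 := sqr_ge0 (v xi 0 2).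
have [->|[->|->]] : k = 0 \/ k = 1 \/ k = 2.
  case: k => -[|[|[|//]]] hk; [left|right; left|right; right]; exact/val_inj.
- by rewrite /Q /sum3; lra.
- by rewrite /Q /sum3; lra.
- by rewrite /Q /sum3; lra.
Qed.

End ZeroBoundaryValues.

(** * Bounds on the nonlinearity and the gradient from compactness *)

Section Bounds.
Context {R : realType}.
Variables (Omega : set 'rV[R]_2) (v : 'rV[R]_2 -> 'rV[R]_3).
Variable H : 'rV[R]_2 * 'rV[R]_3 * 'M[R]_(3, 2) -> R.
Hypothesis bndO : bounded_set Omega.
Hypothesis Cv : Ck_closure 2 Omega v.

Let cptO : compact (closure Omega). Proof. exact: compact_closure. Qed.

(** [gradient v] is meaningful only inside [Omega]; it is replaced by the continuous extension [G]
    of the partial derivatives, and compactness of the closure applies to [H] along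
    [(p, v p, G p)]. *)
Lemma nonlinearity_bounded : {within closure Omega `*` setT `*` setT, continuous H} ->
  exists2 K : R, 0 <= K &
  forall p, Omega p -> `|H (p, v p, gradient v p)| <= K.
Proof.
move=> cH; have [cv [_ dv]] := Cv.
have [g0 [cg0 E0]] := (dv 0).2.1; have [g1 [cg1 E1]] := (dv 1).2.1.
pose G p : 'M[R]_(3, 2) := \matrix_(i, j) (if j == 0 then g0 p 0 i else g1 p 0 i).
have GE p : Omega p -> gradient v p = G p.
  move=> Op; apply/matrixP => i j; rewrite !mxE.
  case: (altP (j =P 0)) => [->|j0]; first by rewrite -(E0 p Op).
  have -> : j = 1 by apply/val_inj; case: j j0 => -[|[|//]].
  by rewrite -(E1 p Op).
have cG p : closure Omega p -> G @ within (closure Omega) (nbhs p) --> G p.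
  move=> clp; apply: cvg_matrix => i j; rewrite mxE; under eq_fun do rewrite mxE.
  by case: ifP => _; apply: coord_cvg;
    [move/subspace_continuousP : cg0|move/subspace_continuousP : cg1]; exact.
have [|K K0 KP] := @within_bounded R _ (closure Omega) (fun p => H (p, v p, G p)) cptO.
  apply/subspace_continuousP => p clp.
  have cHp : H @ within (closure Omega `*` setT `*` setT) (nbhs (p, v p, G p)) -->
      H (p, v p, G p).
    by move/subspace_continuousP : cH; apply.
  have cvp : v @ within (closure Omega) (nbhs p) --> v p.
    by move/subspace_continuousP : cv; exact.
  have cid : id @ within (closure Omega) (nbhs p) --> p by exact: cvg_within.
  apply: (cvg_comp (fun p => (p, v p, G p)) H _ cHp) => A hA.
  have pq : (fun p => (p, v p, G p)) @ within (closure Omega) (nbhs p) --> (p, v p, G p).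
    have pq : (fun p => (p, v p)) @ within (closure Omega) (nbhs p) --> (p, v p).
      exact: (cvg_pair cid cvp).
    exact: (cvg_pair pq (cG p clp)).
  have {}hA : nbhs (p, v p, G p) (fun q =>
      (closure Omega `*` setT `*` setT) q -> A q) by exact: hA.
  have := pq _ hA.
  rewrite !nbhs_filterE /fmap /=; apply: filterS2; last exact: withinT.
  by move=> q clq; apply.
by exists K => // p Op; rewrite (GE p Op); exact: KP (subset_closure Op).
Qed.

Lemma partial_bounded : exists2 K : R, 0 <= K &
  forall p, Omega p -> sum3 (fun k => partial 0 v p 0 k ^+ 2) <= K ^+ 2.
Proof.
have [_ [_ dv]] := Cv; have [g0 [/subspace_continuousP cg0 E0]] := (dv 0).2.1.
have [|K K0 KP] := @within_bounded R _ (closure Omega)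
    (fun p => sum3 (fun k => g0 p 0 k ^+ 2)) cptO.
  apply/subspace_continuousP => p /cg0 cg.
  by apply: cvgD; [apply: cvgD|]; apply: cvgM; exact: coord_cvg.
(* The bound has to be a square, and [K <= (K + 1) ^+ 2]. *)
exists (K + 1) => [|p Op]; first by lra.
rewrite (E0 p Op); apply: (le_trans (ler_norm _)).
apply: (le_trans (KP p (subset_closure Op))).
have -> : (K + 1) ^+ 2 = K ^+ 2 + K + 1 + K by ring.
by have := sqr_ge0 K; lra.
Qed.

Lemma laplacian_coord p k : laplacian v p 0 k =
  partial 0 (partial 0 v) p 0 k + partial 1 (partial 1 v) p 0 k.
Proof.
have e : lift ord0 ord0 = 1 :> 'I_2 by apply/val_inj.
have add (M N : 'rV[R]_3) : (M + N) 0 k = M 0 k + N 0 k by rewrite mxE.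
rewrite -add /laplacian big_ord_recl (big_ord_recl 0) big_ord0.
by rewrite e [X in _ + X]addr0.
Qed.

End Bounds.

Theorem proposition3p1 (R : realType) (Omega : set 'rV[R]_2)
  (v : 'rV[R]_2 -> 'rV[R]_3)
  (H : 'rV[R]_2 * 'rV[R]_3 * 'M[R]_(3, 2) -> R) :
  domain Omega -> bounded_set Omega -> smooth_boundary Omega ->
  simply_connected R Omega ->
  Ck_closure 2 Omega v ->
  {within closure Omega `*` setT `*` setT, continuous H} ->
  (forall xi, Omega xi ->
     laplacian v xi =
       H (xi, v xi, gradient v xi) *:
         cross (partial 0 v xi) (partial 1 v xi)) ->
  (forall xi, boundary Omega xi -> v xi = 0) ->
  forall xi, Omega xi -> v xi = 0.
Proof.
move=> domO bndO _ scO Cv cH eqv v_bdry.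
have [_ oO _] := domO; have [cv dv] := Cv.
have [K K0 KP] := nonlinearity_bounded bndO Cv cH; have [L L0 LP] := partial_bounded bndO Cv.
pose h p := H (p, v p, gradient v p).
pose C p := cross (partial 0 v p) (partial 1 v p).
have LE p k : Omega p ->
    partial 0 (partial 0 v) p 0 k + partial 1 (partial 1 v) p 0 k = h p * C p 0 k.
  move=> Op; rewrite -laplacian_coord (eqv p Op) -/(h p) -/(C p).
  by move: (h p) (C p) => a M; rewrite mxE.
apply: (@eq0_of_zero_boundary R Omega v domO bndO scO cv v_bdry _ _ _ _ _
  (C2_partial oO dv) _ _ K L K0 L0) => z Vz.
- have := sum3_cross_l (partial 0 v (ofC z)) (partial 1 v (ofC z)).
  rewrite /sum3 !(LE _ _ Vz) -/(C _); move: (h _) (C _) (partial 0 v _) => a M N E.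
  by rewrite -[RHS](mulr0 a) -E; ring.
- have := sum3_cross_r (partial 0 v (ofC z)) (partial 1 v (ofC z)).
  rewrite /sum3 !(LE _ _ Vz) -/(C _); move: (h _) (C _) (partial 1 v _) => a M N E.
  by rewrite -[RHS](mulr0 a) -E; ring.
(* Cauchy-Schwarz against [v]; then the Laplacian is estimated by the bound [K] on [H] and the norm
   of the cross product. *)
- apply: le_trans (sum3_CS _ _) _; apply: ler_wpM2l.
    by apply: sum3_ge0 => k; exact: sqr_ge0.
  have -> : sum3 (fun k => (partial 0 (partial 0 v) (ofC z) 0 k +
      partial 1 (partial 1 v) (ofC z) 0 k) ^+ 2) =
      h (ofC z) ^+ 2 * sum3 (fun k => C (ofC z) 0 k ^+ 2).
    by rewrite /sum3 !(LE _ _ Vz); move: (h _) (C _) => a M; ring.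
  apply: ler_pM.
  + exact: sqr_ge0.
  + by apply: sum3_ge0 => k; exact: sqr_ge0.
  + rewrite -(real_normK (num_real (h _))) ler_sqr ?nnegrE//.
    exact: KP.
  + exact: sum3_cross_sqr.
- exact: LP.
Qed.
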